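(* Assume $x+x=x$ for all $x\in\mathbb K$. Then $\mathcal P_{\mathbb K}$ is generated by totally ordered traces: for every term $P$ there exist finitely many traces $T_1,\dots,T_n$ whose orders $\le_{T_i}$ are total, and $k_1,\dots,k_n\in\mathbb K$, such that $P\simeq k_1\cdot\{T_1\}\oplus\cdots\oplus k_n\cdot\{T_n\}$.
   Context: Calculus: fix a commutative semiring $\mathbb K$, a countable set $\mathcal N$ of names, polarities $+,-$ ($\neg$ exchanges them). Actions $u^\varepsilon(x)$ (subject $u$, bound name $x$); $u(x):=u^+(x)$, $\bar u(x):=u^-(x)$; an action written without object has a fresh bound object. Terms $P::=k\mid\alpha.P\mid\diamond P\mid P|Q\mid P\parallel Q\mid\nu xP$ ($k\in\mathbb K$), up to injective renaming of bound names and commutation of restrictions. Positions: finite integer sequences, prefix order, independent = incomparable. Labels: visible $u^\varepsilon(x):\iota$, internal $(\iota,\kappa)$. Transitions: $\alpha.P\xrightarrow{\alpha:\epsilon}\diamond P$; if $P\xrightarrow{a}P'$ then $\diamond P\xrightarrow{1.a}\diamond P'$, $P|Q\xrightarrow{1.a}P'|Q$, $Q|P\xrightarrow{2.a}Q|P'$, likewise for $\parallel$, $\nu xP\xrightarrow{a}\nu xP'$ if $x\notin a$; if $P\xrightarrow{u^\varepsilon(x):\iota}P'$, $Q\xrightarrow{u^{\neg\varepsilon}(y):\kappa}Q'$ then $P|Q\xrightarrow{(1.\iota,2.\kappa)}\nu x(P'|Q'[x/y])$. Homotopy: smallest congruence on label sequences with $ab\sim ba$ when all positions of $a,b$ are pairwise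 independent. Run: homotopy class of maximal internal-label transition sequences from $P$, end term $P/\rho$. State $s(k)=k$, $s(\alpha.P)=1$, $s(\diamond P)=s(\nu xP)=s(P)$, $s(P|Q)=s(P\parallel Q)=s(P)s(Q)$; outcome $\langle P\rangle=\sum_{\rho\in\mathrm{Runs}(P)}s(P/\rho)$; $P\simeq Q$ iff $\langle P|R\rangle=\langle Q|R\rangle$ for all $R$; $\mathcal P_{\mathbb K}$ is the $\mathbb K$-module of $\simeq$-classes with $P\oplus Q:=\nu u((u.P|u.Q)|\bar u.1)$ ($u$ fresh), $k\cdot P:=k|P$. Linear action $\underline{\alpha}.P:=\nu w(\alpha.(P|w.1)|(w.0|\bar w.1))$ ($w$ fresh); a prefix without continuation has continuation $1$. Trace $T=(|T|,p,s,\le_T,N)$: finite set $|T|$ of events, $p:|T|\to\{+,-\}$, $s:|T|\to\mathcal N\uplus|T|$, partial order $\le_T$ on $|T|$ with $s(b)=a\Rightarrow a<b$, finite $N\subseteq\{+,-\}\times(\mathcal N\uplus|T|)$. Implementation $\{T\}$: with fresh names $x_{ab},y_{ab},z_a$ ($a,b\in|T|$), $\mathrm{act}(a)=s(a)^{p(a)}(z_a)$ if $s(a)\in\mathcal N$, else $z_{s(a)}^{p(a)}(z_a)$; $A_a^T:=\{\underline{x}_{ba}\}_{b<a}.\underline{\mathrm{act}(a)}.(\prod_{a<c}\underline{\bar y}_{ac}\parallel\prod_{s(c)=a}A_c^T\parallel\prod_{(\varepsilon,a)\in N}z_a^\varepsilon.0)$, where $\{\underline{x}_{ba}\}_{b<a}$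 is a sequence of linear prefixes $\underline{x_{ba}}$ for all $b<a$ and $\prod$ is $\parallel$-composition; $\{T\}:=\nu(x_{ab},y_{ab})_{a,b}(\prod_{s(a)\in\mathcal N}A_a^T\,|\,\prod_{a<b}\underline{y}_{ab}.\underline{\bar x}_{ab})\parallel\prod_{(\varepsilon,u)\in N,u\in\mathcal N}u^\varepsilon.0$. *)

(* Defs.v *)
From Stdlib Require List.
From mathcomp Require Import all_boot all_algebra.
Set Implicit Arguments.
Unset Strict Implicit.
Unset Printing Implicit Defensive.
Import GRing.Theory.
Local Open Scope ring_scope.

(* Names are natural numbers; polarities are booleans (true = +, false = -,
   negation ~~ exchanges them).  Positions are sequences of naturals. *)
Definition name := nat.
Definition pol := bool.
Definition position := seq nat.

Section Terms.
Variable K : comPzSemiRingType.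

(* TAct u e x P  =  u^e(x).P  (x bound in P);  TNu x P = nu x P (x bound in P) *)
Inductive term : Type :=
| TConst of K
| TAct of name & pol & name & term
| TDia of term
| TPar of term & term
| TPPar of term & term
| TNu of name & term.

Fixpoint fn (P : term) : seq name :=
  match P with
  | TConst _ => [::]
  | TAct u _ x P => u :: [seq y <- fn P | y != x]
  | TDia P => fn P
  | TPar P Q | TPPar P Q => fn P ++ fn Q
  | TNu x P => [seq y <- fn P | y != x]
  end.

Fixpoint bn (P : term) : seq name :=
  match P with
  | TConst _ => [::]
  | TAct _ _ x P => x :: bn P
  | TDia P => bn P
  | TPar P Q | TPPar P Q => bn P ++ bn Q
  | TNu x P => x :: bn P
  end.

Definition allnames (P : term) : seq name := fn P ++ bn P.

Definition swapn (a b c : name) : name :=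
  if c == a then b else if c == b then a else c.

Fixpoint swap (a b : name) (P : term) : term :=
  match P with
  | TConst k => TConst k
  | TAct u e x P => TAct (swapn a b u) e (swapn a b x) (swap a b P)
  | TDia P => TDia (swap a b P)
  | TPar P Q => TPar (swap a b P) (swap a b Q)
  | TPPar P Q => TPPar (swap a b P) (swap a b Q)
  | TNu x P => TNu (swapn a b x) (swap a b P)
  end.

(* subst y x P  =  P[x/y] : replaces the free occurrences of y by x
   (capture-avoiding whenever x does not occur bound in P) *)
Fixpoint subst (y x : name) (P : term) : term :=
  match P with
  | TConst k => TConst k
  | TAct u e z P =>
      TAct (if u == y then x else u) e z (if z == y then P else subst y x P)
  | TDia P => TDia (subst y x P)
  | TPar P Q => TPar (subst y x P) (subst y x Q)
  | TPPar P Q => TPPar (subst y x P) (subst y x Q)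
  | TNu z P => TNu z (if z == y then P else subst y x P)
  end.

Inductive aeq : term -> term -> Prop :=
| aeq_refl P : aeq P P
| aeq_sym P Q : aeq P Q -> aeq Q P
| aeq_trans P Q R : aeq P Q -> aeq Q R -> aeq P R
| aeq_act u e x P Q : aeq P Q -> aeq (TAct u e x P) (TAct u e x Q)
| aeq_dia P Q : aeq P Q -> aeq (TDia P) (TDia Q)
| aeq_par P P' Q Q' : aeq P P' -> aeq Q Q' -> aeq (TPar P Q) (TPar P' Q')
| aeq_ppar P P' Q Q' : aeq P P' -> aeq Q Q' -> aeq (TPPar P Q) (TPPar P' Q')
| aeq_nu x P Q : aeq P Q -> aeq (TNu x P) (TNu x Q)
| aeq_alpha_act u e x y P : y \notin fn P ->
    aeq (TAct u e x P) (TAct u e y (swap x y P))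
| aeq_alpha_nu x y P : y \notin fn P ->
    aeq (TNu x P) (TNu y (swap x y P))
| aeq_nu_comm x y P : aeq (TNu x (TNu y P)) (TNu y (TNu x P)).

Inductive label : Type :=
| LVis of name & pol & name & position
| LInt of position & position.

Definition lpush (k : nat) (a : label) : label :=
  match a with
  | LVis u e x i => LVis u e x (k :: i)
  | LInt i j => LInt (k :: i) (k :: j)
  end.

Definition is_int (a : label) : bool :=
  if a is LInt _ _ then true else false.

Definition lnames (a : label) : seq name :=
  match a with LVis u _ x _ => [:: u; x] | LInt _ _ => [::] end.

(* side condition for context rules: the bound object of a visible label
   must not be captured by the sibling *)
Definition bnd_ok (a : label) (Q : term) : Prop :=
  match a with LVis _ _ x _ => x \notin fn Q | LInt _ _ => True end.

Inductive step : term -> label -> term -> Prop :=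
| s_act u e x P : x != u -> step (TAct u e x P) (LVis u e x [::]) (TDia P)
| s_dia P a P' : step P a P' -> step (TDia P) (lpush 1 a) (TDia P')
| s_par1 P Q a P' : step P a P' -> bnd_ok a Q ->
    step (TPar P Q) (lpush 1 a) (TPar P' Q)
| s_par2 P Q a Q' : step Q a Q' -> bnd_ok a P ->
    step (TPar P Q) (lpush 2 a) (TPar P Q')
| s_ppar1 P Q a P' : step P a P' -> bnd_ok a Q ->
    step (TPPar P Q) (lpush 1 a) (TPPar P' Q)
| s_ppar2 P Q a Q' : step Q a Q' -> bnd_ok a P ->
    step (TPPar P Q) (lpush 2 a) (TPPar P Q')
| s_nu z P a P' : step P a P' -> z \notin lnames a ->
    step (TNu z P) a (TNu z P')
| s_comm P Q P' Q' u e x y i j :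
    step P (LVis u e x i) P' -> step Q (LVis u (~~ e) y j) Q' ->
    x \notin fn Q -> x \notin bn Q' ->
    step (TPar P Q) (LInt (1 :: i) (2 :: j)) (TNu x (TPar P' (subst y x Q')))
| s_alpha P P0 a P1 P' : aeq P P0 -> step P0 a P1 -> aeq P1 P' -> step P a P'.

Definition indep (p q : position) : bool := ~~ prefix p q && ~~ prefix q p.

Definition lpos (a : label) : seq position :=
  match a with LVis _ _ _ i => [:: i] | LInt i j => [:: i; j] end.

Definition indep_lab (a b : label) : bool :=
  all (fun p => all (indep p) (lpos b)) (lpos a).

Inductive homot : seq label -> seq label -> Prop :=
| h_refl l : homot l l
| h_sym l l' : homot l l' -> homot l' l
| h_trans l1 l2 l3 : homot l1 l2 -> homot l2 l3 -> homot l1 l3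
| h_swap s t a b : indep_lab a b ->
    homot (s ++ a :: b :: t) (s ++ b :: a :: t).

Inductive exec : term -> seq label -> term -> Prop :=
| e_nil P : exec P [::] P
| e_cons P a P' l Q : is_int a -> step P a P' -> exec P' l Q -> exec P (a :: l) Q.

Definition stuck (E : term) : Prop :=
  forall a E', is_int a -> ~ step E a E'.

Fixpoint state (P : term) : K :=
  match P with
  | TConst k => k
  | TAct _ _ _ _ => 1
  | TDia P | TNu _ P => state P
  | TPar P Q | TPPar P Q => state P * state Q
  end.

(* <P> = k : k is the sum, over one representative (rho, P/rho) of each
   run (homotopy class of maximal internal transition sequences), of
   s(P/rho). *)
Definition is_outcome (P : term) (k : K) : Prop :=
  exists reps : seq (seq label * term),
    (forall r, List.In r reps -> exec P r.1 r.2 /\ stuck r.2) /\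
    (forall i j, (i < j < size reps)%N ->
       ~ homot (nth ([::], TConst 0) reps i).1 (nth ([::], TConst 0) reps j).1) /\
    (forall l E, exec P l E -> stuck E ->
       exists r, List.In r reps /\ homot l r.1) /\
    k = \sum_(r <- reps) state r.2.

Definition obs_equiv (P Q : term) : Prop :=
  forall R k, is_outcome (TPar P R) k <-> is_outcome (TPar Q R) k.

Definition fresh (l : seq name) : name := (foldr maxn 0 l).+1.

Definition pre (u : name) (e : pol) (P : term) : term :=
  TAct u e (fresh (u :: allnames P)) P.

Definition oplus (P Q : term) : term :=
  let u := fresh (allnames P ++ allnames Q) in
  TNu u (TPar (TPar (pre u true P) (pre u true Q)) (pre u false (TConst 1))).

Definition scale (k : K) (P : term) : term := TPar (TConst k) P.

Fixpoint bigoplus (l : seq term) : term :=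
  match l with
  | [::] => TConst 0
  | [:: P] => P
  | P :: l => oplus P (bigoplus l)
  end.

Definition lin (u : name) (e : pol) (x : name) (P : term) : term :=
  let w := fresh (u :: x :: allnames P) in
  TNu w (TPar (TAct u e x (TPar P (pre w true (TConst 1))))
              (TPar (pre w true (TConst 0)) (pre w false (TConst 1)))).

Definition lin0 (u : name) (e : pol) (P : term) : term :=
  lin u e (fresh (u :: allnames P)) P.

Fixpoint bigpar (l : seq term) : term :=
  match l with
  | [::] => TConst 1
  | [:: P] => P
  | P :: l => TPPar P (bigpar l)
  end.

End Terms.

Record trace : Type := Trace {
  tn : nat;
  tpol : 'I_tn -> pol;
  tsrc : 'I_tn -> name + 'I_tn;
  tle : rel 'I_tn;
  tN : seq (pol * (name + 'I_tn))
}.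
Arguments tpol : clear implicits.
Arguments tsrc : clear implicits.
Arguments tle : clear implicits.
Arguments tN : clear implicits.

Definition tlt (T : trace) (a b : 'I_(tn T)) : bool := tle T a b && (a != b).

Definition is_trace (T : trace) : Prop :=
  (forall a, tle T a a) /\
  (forall a b, tle T a b -> tle T b a -> a = b) /\
  (forall a b c, tle T a b -> tle T b c -> tle T a c) /\
  (forall a b, tsrc T b = inr a -> tlt a b) /\
  uniq (tN T).

Definition total_trace (T : trace) : Prop :=
  forall a b : 'I_(tn T), tle T a b || tle T b a.

Section Impl.
Variable K : comPzSemiRingType.
Variable T : trace.
Local Notation n := (tn T).
Local Notation ev := 'I_(tn T).

Definition is_inl (X Y : Type) (s : X + Y) : bool := if s is inl _ then true else false.

Definition tnames : seq name :=
  [seq (if tsrc T a is inl u then u else 0%N) | a <- enum 'I_n] ++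
  [seq (if p.2 is inl u then u else 0%N) | p <- tN T].

Definition tbase : name := fresh tnames.
Definition zn (a : ev) : name := (tbase + a)%N.
Definition xn (a b : ev) : name := (tbase + n + a * n + b)%N.
Definition yn (a b : ev) : name := (tbase + n + n * n + a * n + b)%N.

Definition subj (a : ev) : name :=
  match tsrc T a with inl u => u | inr c => zn c end.

Fixpoint A (fuel : nat) (a : ev) : term K :=
  match fuel with
  | 0 => TConst 0
  | f.+1 =>
    let cont :=
      TPPar (bigpar [seq lin0 (yn a c) false (TConst 1)
                    | c <- enum 'I_n & tlt a c])
            (TPPar (bigpar [seq A f c | c <- enum 'I_n & tsrc T c == inr a])
                   (bigpar [seq pre (zn a) p.1 (TConst 0)
                           | p <- tN T & p.2 == inr a])) in
    foldr (fun b P => lin0 (xn b a) true P)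
          (lin (subj a) (tpol T a) (zn a) cont)
          [seq b <- enum 'I_n | tlt b a]
  end.

Definition impl : term K :=
  TPPar
    (foldr (@TNu K)
       (TPar (bigpar [seq A n a | a <- enum 'I_n & is_inl (tsrc T a)])
             (bigpar (flatten [seq [seq lin0 (yn a b) true
                                          (lin0 (xn a b) false (TConst 1))
                                   | b <- enum 'I_n & tlt a b]
                              | a <- enum 'I_n])))
       (flatten [seq flatten [seq [:: xn a b; yn a b] | b <- enum 'I_n]
                | a <- enum 'I_n]))
    (bigpar [seq pre (if p.2 is inl u then u else 0%N) p.1 (TConst 0)
            | p <- tN T & is_inl p.2]).

End Impl.

(* Main.v *)
(* Since [K] is idempotent, [is_outcome P k] says that [k] is the join of the
   states of the stuck terms reachable from [P]: the state reached by a run only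
   depends on the positions it fires, hence on its homotopy class, so counting
   classes plays no role.  It remains to compare reachable states.

   Terms are interpreted as nameless processes, where binders are functions and
   each active restriction is a channel of its own, and the transitions of a
   term are shown to be those of its process.  A maximal run of [P | R] is then a
   pair of dual visible words, one of [P] and one of [R], ending in stuck
   processes whose offers do not match.  A term has finitely many words [t]
   (ending in a process [q]), and each gives a totally ordered trace [T]: its
   events are the letters of [t] and its inactions are the offers of [q].  Up to
   runs of state [0], which are neutral for the join, the only word of [{T}] is
   [t], with the offers of [q] and state [1]; hence [P] is the sum of the
   [pval q . {T}]. *)
Require Import Defs.
From Stdlib Require List.
From Stdlib Require Import Classical FunctionalExtensionality.
From mathcomp Require Import all_boot all_algebra.
From mathcomp Require Import zify.
Set Implicit Arguments.
Unset Strict Implicit.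
Unset Printing Implicit Defensive.
Import GRing.Theory.
Local Open Scope ring_scope.

(** Objects are always bound, so a communication never passes an existing name: it creates a
    channel. The n-th channel shared by [P] and [R] can therefore be called [Ev n] by each side on
    its own, and [R] sees nothing of [P] but a word and the offers left at its end. This is why one
    summand per word is enough.

    An offer left at the end becomes an inaction [u.0]: if [R] takes it, the run of the
    implementation ends in state 0, while what [P] does in that case belongs to another word.

    The difficulty is to exclude proper prefixes of the word and other orders of its letters.
    Prefixes are excluded by linear actions. Until [u] fires, the signal [w] can only be received by
    [w.0], so a pending action is never stuck: any run that stops without firing all events has
    exposed a constant 0. The order is enforced by the relays [y_ab.x_ab], whose tokens are counted.
    Since the order is total, events are numbered so that [tle] is the order of the ordinals, and
    stage [k] means that exactly the events below [k] have fired. *)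

(** * Runs, homotopy and outcomes *)

Section Outcomes.
Variable K : comPzSemiRingType.
Implicit Types P Q R E : term K.

Fixpoint poss P : seq position :=
  match P with
  | TConst _ => [::]
  | TAct _ _ _ P => [::] :: map (cons 1%N) (poss P)
  | TDia P => map (cons 1%N) (poss P)
  | TPar P Q | TPPar P Q => map (cons 1%N) (poss P) ++ map (cons 2) (poss Q)
  | TNu _ P => poss P
  end.

Lemma poss_swap x y P : poss (swap x y P) = poss P.
Proof. by elim: P => //= [u e z P ->|P ->|P -> Q ->|P -> Q ->]. Qed.

Lemma poss_subst x y P : poss (subst x y P) = poss P.
Proof.
by elim: P => //= [u e z P IH|P ->|P -> Q ->|P -> Q ->|z P IH] //; case: ifP => _ //; rewrite IH.
Qed.

Lemma poss_aeq P Q : aeq P Q -> poss P = poss Q.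
Proof.
elim=> //=.
- by move=> P1 P2 P3 _ -> _ ->.
- by move=> u e x P1 P2 _ ->.
- by move=> P1 P2 _ ->.
- by move=> P1 P2 Q1 Q2 _ -> _ ->.
- by move=> P1 P2 Q1 Q2 _ -> _ ->.
- by move=> u e x y P1 _; rewrite poss_swap.
- by move=> x y P1 _; rewrite poss_swap.
Qed.

Lemma lpos_lpush k a : lpos (lpush k a) = map (cons k) (lpos a).
Proof. by case: a. Qed.

(** A fired prefix leaves a diamond behind, so the other prefixes keep their positions and a step
    only deletes those of its label. This bounds the length and the labels of every execution. *)
Lemma step_poss P a P' : step P a P' -> perm_eq (poss P) (lpos a ++ poss P').
Proof.
elim=> {P a P'} /=.
- by move=> u e x P _ /=.
- by move=> P a P' _ IH; rewrite lpos_lpush -map_cat perm_map.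
- by move=> P Q a P' _ IH _; rewrite lpos_lpush catA -map_cat perm_cat2r perm_map.
- move=> P Q a P' _ IH _; rewrite lpos_lpush perm_sym perm_catCA perm_cat2l -map_cat.
  by rewrite perm_map // perm_sym.
- by move=> P Q a P' _ IH _; rewrite lpos_lpush catA -map_cat perm_cat2r perm_map.
- move=> P Q a P' _ IH _; rewrite lpos_lpush perm_sym perm_catCA perm_cat2l -map_cat.
  by rewrite perm_map // perm_sym.
- by [].
- move=> P Q P' Q' u e x y i j _ IHP _ IHQ _ _; rewrite poss_subst.
  move: (perm_map (cons 1%N) IHP) (perm_map (cons 2) IHQ) => /= h1 h2.
  apply: (perm_trans (perm_cat h1 h2)).
  rewrite /= perm_cons -[(2 :: j) :: (_ ++ _)]/([:: 2 :: j] ++ (_ ++ _)).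
  by rewrite -[(2 :: j) :: map _ _]/([:: 2 :: j] ++ _) perm_catCA.
- by move=> P P0 a P1 P' /poss_aeq -> _ IH /poss_aeq <-.
Qed.

(* [stc P C] is the state of the residual of [P] once exactly the prefixes at
   the positions in [C] have fired; it shows that the state reached by a run
   depends on its homotopy class only. *)
Fixpoint stc P (C : pred position) : K :=
  match P with
  | TConst k => k
  | TAct _ _ _ P => if C [::] then stc P (fun p => C (1%N :: p)) else 1
  | TDia P => stc P (fun p => C (1%N :: p))
  | TPar P Q | TPPar P Q => stc P (fun p => C (1%N :: p)) * stc Q (fun p => C (2 :: p))
  | TNu _ P => stc P C
  end.

Lemma stc_ext P C C' : C =1 C' -> stc P C = stc P C'.
Proof.
elim: P C C' => //= [u e x P IH|P IH|P IHP Q IHQ|P IHP Q IHQ] C C' h.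
- by rewrite h (IH _ (fun p => C' (1%N :: p))).
- exact: IH.
- by rewrite (IHP _ (fun p => C' (1%N :: p))) ?(IHQ _ (fun p => C' (2 :: p))).
- by rewrite (IHP _ (fun p => C' (1%N :: p))) ?(IHQ _ (fun p => C' (2 :: p))).
Qed.

Lemma stc_swap x y P C : stc (swap x y P) C = stc P C.
Proof. by elim: P C => //= [u e z P IH|P IH Q IHQ|P IH Q IHQ] C; rewrite IH // IHQ. Qed.

Lemma stc_subst x y P C : stc (subst x y P) C = stc P C.
Proof.
by elim: P C => //= [u e z P IH|P IH Q IHQ|P IH Q IHQ|z P IH] C; rewrite ?IH ?IHQ //; case: (z == x); rewrite ?IH.
Qed.

Lemma stc_aeq P Q : aeq P Q -> stc P =1 stc Q.
Proof.
elim=> //=.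
- by move=> P1 P2 _ h C; rewrite h.
- by move=> P1 P2 P3 _ h _ h' C; rewrite h h'.
- by move=> u e x P1 P2 _ h C; rewrite h.
- by move=> P1 P2 _ h C; rewrite h.
- by move=> P1 P2 Q1 Q2 _ h _ h' C; rewrite h h'.
- by move=> P1 P2 Q1 Q2 _ h _ h' C; rewrite h h'.
- by move=> u e x y P1 _ C; rewrite stc_swap.
- by move=> x y P1 _ C; rewrite stc_swap.
Qed.

Lemma state_stc P : state P = stc P pred0.
Proof.
by elim: P => //= [P -> Q ->|P -> Q ->].
Qed.

Lemma mem_lpush1 k k' a p :
  (k :: p \in lpos (lpush k' a)) = (k == k') && (p \in lpos a).
Proof.
by case: a => [u e x i|i j] /=; rewrite !inE !eqseq_cons; case: eqP.
Qed.

Lemma step_stc P a P' : step P a P' ->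
  forall C, stc P' C = stc P (fun p => (p \in lpos a) || C p).
Proof.
elim=> {P a P'} /=.
- by [].
- by move=> P a P' _ IH C; rewrite IH; apply: stc_ext => p; rewrite mem_lpush1.
- move=> P Q a P' _ IH _ C; rewrite IH; congr (_ * _); apply: stc_ext => p;
  by rewrite mem_lpush1.
- move=> P Q a P' _ IH _ C; rewrite IH; congr (_ * _); apply: stc_ext => p;
  by rewrite mem_lpush1.
- move=> P Q a P' _ IH _ C; rewrite IH; congr (_ * _); apply: stc_ext => p;
  by rewrite mem_lpush1.
- move=> P Q a P' _ IH _ C; rewrite IH; congr (_ * _); apply: stc_ext => p;
  by rewrite mem_lpush1.
- by [].
- move=> P Q P' Q' u e x y i j _ IHP _ IHQ _ _ C; rewrite stc_subst IHP IHQ.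
  by congr (_ * _); apply: stc_ext => p; rewrite !inE !eqseq_cons ?orbF.
- by move=> P P0 a P1 P' /stc_aeq h0 _ IH /stc_aeq h1 C; rewrite -h1 IH h0.
Qed.

Definition fired (l : seq label) : seq position := flatten (map lpos l).

Lemma exec_state P l E : exec P l E -> state E = stc P (mem (fired l)).
Proof.
rewrite state_stc => h.
(* The set [C] of positions fired later is generalised, so that the induction can push labels into
   it one at a time. *)
suff: forall C, stc E C = stc P (fun p => (p \in fired l) || C p).
  by move->; apply: stc_ext => p; rewrite orbF.
elim: h => {P l E} // P a P' l Q _ hs _ IH C.
rewrite IH (step_stc hs); apply: stc_ext => p.
by rewrite /fired /= mem_cat orbA.
Qed.

Lemma homot_fired l l' : homot l l' -> fired l =i fired l'.
Proof.
elim=> // {l l'}.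
- by move=> l1 l2 _ h p; rewrite h.
- by move=> l1 l2 l3 _ h _ h' p; rewrite h h'.
- move=> s t a b _ p; rewrite /fired !map_cat !flatten_cat /= !mem_cat.
  by congr (_ || _); rewrite orbCA.
Qed.

Lemma homot_state P l l' E E' :
  exec P l E -> exec P l' E' -> homot l l' -> state E = state E'.
Proof.
by move=> /exec_state -> /exec_state -> /homot_fired h; apply: stc_ext.
Qed.

Lemma exec_poss P l E : exec P l E -> perm_eq (poss P) (fired l ++ poss E).
Proof.
elim=> {P l E} // P a P' l Q _ /step_poss h _ IH; rewrite /fired /= -catA.
by apply: (perm_trans h); rewrite perm_cat2l.
Qed.

Lemma exec_int P l E a : exec P l E -> List.In a l -> is_int a.
Proof. by elim=> {P l E} //= P b P' l Q hb _ _ IH [<-|/IH]. Qed.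

Lemma finite_lists (A : Type) (als : seq A) n :
  exists Ls, forall l, (size l <= n)%N ->
    (forall a, List.In a l -> List.In a als) -> List.In l Ls.
Proof.
elim: n => [|n [Ls IH]].
  by exists [:: [::]] => -[|//] _ _; left.
exists ([::] :: List.flat_map (fun l => map (cons^~ l) als) Ls) => -[|a l] /= hn hl; first by left.
right; apply/List.in_flat_map; exists l; split.
  by apply: IH => // b hb; apply: hl; right.
by apply: List.in_map; apply: hl; left.
Qed.

Lemma In_mem (T : eqType) (x : T) s : (x \in s) <-> List.In x s.
Proof.
elim: s => //= y s IH; rewrite inE; split.
  by case/orP => [/eqP ->|/IH]; [left|right].
by case=> [->|/IH ->]; rewrite ?eqxx ?orbT.
Qed.

Lemma In_cat (T : Type) (x : T) s t : List.In x (s ++ t) <-> List.In x s \/ List.In x t.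
Proof. exact: List.in_app_iff. Qed.

Lemma finite_exec P : exists Ls, forall l E, exec P l E -> List.In l Ls.
Proof.
pose als := [seq LInt i j | i <- poss P, j <- poss P].
have [Ls hLs] := finite_lists als (size (poss P)).
exists Ls => l E h; have hp := exec_poss h; apply: hLs.
  move/perm_size: hp => ->; rewrite size_cat; apply: leq_trans (leq_addr _ _).
  elim: l {h} => //= a l IH; rewrite /fired /= size_cat -add1n.
  by apply: leq_add => //; case: a.
move=> a ha; have := exec_int h ha; case: a ha => // i j ha _.
have hsub p : p \in lpos (LInt i j) -> p \in poss P.
  rewrite (perm_mem hp) mem_cat => hp'; apply/orP; left.
  elim: l ha {h hp} => //= b l IH [->|/IH h]; rewrite /fired /=.
    by move: hp'; rewrite !inE => /orP[->|->]; rewrite ?orbT.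
  by rewrite mem_cat; apply/orP; right.
have hi : i \in poss P by apply: hsub; rewrite !inE eqxx.
have hj : j \in poss P by apply: hsub; rewrite !inE eqxx orbT.
rewrite /als; move/In_mem: hi; elim: {1 3}(poss P) => //= i' s IH [->|/IH ?].
  by apply/In_cat; left; apply: List.in_map; apply/In_mem.
by apply/In_cat; right.
Qed.

Definition reaches P (v : K) : Prop :=
  exists l E, exec P l E /\ stuck E /\ state E = v.

(* For an idempotent sum, [x + k = k] is the order of a join-semilattice. *)
Definition is_join (S : K -> Prop) (k : K) : Prop :=
  (forall v, S v -> v + k = k) /\
  (forall k', (forall v, S v -> v + k' = k') -> k + k' = k').

(** Representatives are collected greedily from a finite list of candidate sequences. A sequence is
    kept if it leads to a stuck term and is homotopic to none kept before; classical logic decides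
    both conditions. *)
Lemma exec_reps P : exists reps : seq (seq label * term K),
    (forall r, List.In r reps -> exec P r.1 r.2 /\ stuck r.2) /\
    (forall i j, (i < j < size reps)%N ->
       ~ homot (nth ([::], TConst 0) reps i).1 (nth ([::], TConst 0) reps j).1) /\
    (forall l E, exec P l E -> stuck E ->
       exists r, List.In r reps /\ homot l r.1).
Proof.
have [Ls hLs] := finite_exec P.
suff: exists reps : seq (seq label * term K),
    (forall r, List.In r reps -> exec P r.1 r.2 /\ stuck r.2) /\
    (forall i j, (i < j < size reps)%N ->
       ~ homot (nth ([::], TConst 0) reps i).1 (nth ([::], TConst 0) reps j).1) /\
    (forall l E, List.In l Ls -> exec P l E -> stuck E ->
       exists r, List.In r reps /\ homot l r.1).
  case=> reps [h1 [h2 h3]]; exists reps; split=> //; split=> // l E hl hE.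
  exact: h3 (hLs _ _ hl) hl hE.
elim: Ls {hLs} => [|l Ls [reps [h1 [h2 h3]]]]; first by exists [::]; split=> //; split=> // i j; rewrite andbF.
case: (classic ((exists E, exec P l E /\ stuck E) /\
                forall r, List.In r reps -> ~ homot l r.1)) => [[[E [hE hs]] hl]|hn].
- exists ((l, E) :: reps); split; last split.
  + by move=> r /= [<-|/h1].
  + move=> [|i] [|j] //= hij; last exact: h2.
    apply: hl; move: hij; rewrite ltnS => hj.
    by elim: reps j hj {h1 h2 h3} => //= r reps IH [|j] hj; [left|right; apply: IH].
  + move=> l' E' /= [<-|hin] hE' hs'.
      by exists (l, E); split; [left|exact: h_refl].
    by have [r [hr hh]] := h3 _ _ hin hE' hs'; exists r; split; [right|].
- exists reps; split=> //; split=> // l' E' /= [<-|]; last exact: h3.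
  move=> hE hs; apply: NNPP => hno; apply: hn; split; first by exists E'.
  by move=> r hr hh; apply: hno; exists r.
Qed.

Hypothesis Kidem : forall x : K, x + x = x.

Lemma idem_sum_ge (A : Type) (f : A -> K) (s : seq A) x :
  List.In x s -> f x + \sum_(r <- s) f r = \sum_(r <- s) f r.
Proof.
elim: s => //= y s IH [->|/IH h]; rewrite big_cons; first by rewrite addrA Kidem.
by rewrite addrCA h.
Qed.

Lemma idem_sum_le (A : Type) (f : A -> K) (s : seq A) k :
  (forall x, List.In x s -> f x + k = k) -> \sum_(r <- s) f r + k = k.
Proof.
elim: s => [|y s IH] h; first by rewrite big_nil add0r.
by rewrite big_cons -addrA IH ?h //=; [left|move=> x hx; apply: h; right].
Qed.

Lemma is_join_uniq S k k' : is_join S k -> is_join S k' -> k = k'.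
Proof.
by move=> [h1 h2] [h1' h2']; rewrite -(h2' _ h1) addrC h2.
Qed.

(** Every reached state occurs among the representatives, by invariance under homotopy, and a
    repeated state does not change an idempotent sum. The converse combines the existence of
    representatives with the uniqueness of joins. *)
Lemma is_outcomeP P k : is_outcome P k <-> is_join (reaches P) k.
Proof.
have join_reps (reps : seq (seq label * term K)) :
  (forall r, List.In r reps -> exec P r.1 r.2 /\ stuck r.2) ->
  (forall l E, exec P l E -> stuck E ->
       exists r, List.In r reps /\ homot l r.1) ->
  is_join (reaches P) (\sum_(r <- reps) state r.2).
  move=> h1 h3; split.
  - move=> v [l [E [hE [hs <-]]]]; have [r [hr hh]] := h3 _ _ hE hs.
    rewrite (homot_state hE (proj1 (h1 _ hr)) hh).
    exact: (idem_sum_ge (fun r => state r.2)).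
  - move=> k' hk'; apply: idem_sum_le => r hr; apply: hk'.
    by have [hE hs] := h1 _ hr; exists r.1, r.2.
split.
  by case=> reps [h1 [h2 [h3 ->]]]; apply: join_reps.
move=> hk; have [reps [h1 [h2 h3]]] := exec_reps P.
exists reps; split=> //; split=> //; split=> //.
exact: is_join_uniq hk (join_reps _ h1 h3).
Qed.

(** The asymmetry is what the implementation needs: its failed runs reach the extra state 0, which a
    join ignores. *)
Lemma obs_equiv_reaches P Q :
  (forall R v, reaches (TPar P R) v -> reaches (TPar Q R) v) ->
  (forall R v, reaches (TPar Q R) v -> v = 0 \/ reaches (TPar P R) v) ->
  obs_equiv P Q.
Proof.
move=> h1 h2 R k; rewrite !is_outcomeP; split=> -[hub hle]; split.
- by move=> v /h2 [->|/hub //]; rewrite add0r.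
- by move=> k' h; apply: hle => v /h1 /h.
- by move=> v /h1 /hub.
- by move=> k' h; apply: hle => v /h2 [->|/h //]; rewrite add0r.
Qed.

End Outcomes.

(** * Nameless processes *)

(* [Fr] are the free names, [Ev n] the object of the n-th visible action,
   [In b n] the object of the n-th internal communication on side [b], and
   [Pv s] the name restricted by the [nu] at path [s]. *)
Inductive chan : Type :=
| Fr of name
| Ev of nat
| In of bool & nat
| Pv of seq nat.

Definition upd (rho : name -> chan) (x : name) (c : chan) : name -> chan :=
  fun y => if y == x then c else rho y.

Lemma upd_same rho x c : upd rho x c x = c.
Proof. by rewrite /upd eqxx. Qed.

Lemma upd_other rho x c y : y != x -> upd rho x c y = rho y.
Proof. by rewrite /upd => /negbTE ->. Qed.

Lemma upd_upd rho x c d : upd (upd rho x c) x d = upd rho x d.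
Proof. by apply: functional_extensionality => y; rewrite /upd; case: eqP. Qed.

Lemma updC rho x y c d : x != y -> upd (upd rho x c) y d = upd (upd rho y d) x c.
Proof.
move=> hxy; apply: functional_extensionality => z; rewrite /upd.
by case: (z =P y) => // ->; rewrite eq_sym (negbTE hxy).
Qed.

Section Processes.
Variable K : comPzSemiRingType.

(* Nameless processes: binders are functions, restrictions are instantiated by
   private channels and consumed prefixes leave no trace.  The boolean of [PP]
   tells whether the two sides may communicate. *)
Inductive proc : Type :=
| PC of K
| PAct of chan & pol & (chan -> proc)
| PP of bool & proc & proc.

Fixpoint pval (p : proc) : K :=
  match p with
  | PC k => k
  | PAct _ _ _ => 1
  | PP _ p q => pval p * pval q
  end.

(** Here and in [tau] the residual is a function of the object, so that one derivation serves every
    choice of channel. Freshness is imposed only when the result is read back as a term. *)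
Inductive vis : proc -> chan -> pol -> (chan -> proc) -> Prop :=
| vis_act u e f : vis (PAct u e f) u e f
| vis_l b p q u e g : vis p u e g -> vis (PP b p q) u e (fun c => PP b (g c) q)
| vis_r b p q u e g : vis q u e g -> vis (PP b p q) u e (fun c => PP b p (g c)).

Inductive tau : proc -> (chan -> proc) -> Prop :=
| tau_l b p q g : tau p g -> tau (PP b p q) (fun c => PP b (g c) q)
| tau_r b p q g : tau q g -> tau (PP b p q) (fun c => PP b p (g c))
| tau_c p q u e g h : vis p u e g -> vis q u (~~ e) h ->
    tau (PP true p q) (fun c => PP true (g c) (h c)).

Lemma vis_PC k u e g : ~ vis (PC k) u e g.
Proof. by move=> h; inversion h. Qed.

Lemma vis_PAct u e f v d g : vis (PAct u e f) v d g -> [/\ v = u, d = e & g = f].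
Proof. by move=> h; inversion h. Qed.

Lemma vis_PP b p q u e g : vis (PP b p q) u e g ->
  (exists2 h, vis p u e h & g = fun c => PP b (h c) q) \/
  (exists2 h, vis q u e h & g = fun c => PP b p (h c)).
Proof. by move=> h; inversion h; subst; [left|right]; eexists; eauto. Qed.

Lemma tau_PC k g : ~ tau (PC k) g.
Proof. by move=> h; inversion h. Qed.

Lemma tau_PAct u e f g : ~ tau (PAct u e f) g.
Proof. by move=> h; inversion h. Qed.

Lemma tau_PP b p q g : tau (PP b p q) g ->
  [\/ exists2 h, tau p h & g = fun c => PP b (h c) q,
      exists2 h, tau q h & g = fun c => PP b p (h c) |
      b /\ exists u e g1 g2, [/\ vis p u e g1, vis q u (~~ e) g2 &
         g = fun c => PP b (g1 c) (g2 c)]].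
Proof.
move=> h; inversion h; subst.
- by apply: Or31; eexists; eauto.
- by apply: Or32; eexists; eauto.
- by apply: Or33; split=> //; do 4!eexists; split; eauto.
Qed.

(** The path [s] is the address of the subterm, innermost step first. Hence distinct restrictions
    get distinct channels [Pv s], and the channels of a subterm are those whose path ends with its
    own. *)
Fixpoint den (P : term K) (rho : name -> chan) (s : seq nat) : proc :=
  match P with
  | TConst k => PC k
  | TAct u e x P => PAct (rho u) e (fun c => den P (upd rho x c) (1%N :: s))
  | TDia P => den P rho s
  | TPar P Q => PP true (den P rho (1%N :: s)) (den Q rho (2 :: s))
  | TPPar P Q => PP false (den P rho (1%N :: s)) (den Q rho (2 :: s))
  | TNu x P => den P (upd rho x (Pv s)) (1%N :: s)
  end.

Lemma den_fn P rho rho' s : {in fn P, rho =1 rho'} -> den P rho s = den P rho' s.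
Proof.
elim: P rho rho' s => //= [u e x P IH|P IH Q IHQ|P IH Q IHQ|x P IH] rho rho' s h.
- rewrite h ?inE ?eqxx //; congr PAct; apply: functional_extensionality => c.
  apply: IH => y hy; rewrite /upd; case: eqP => // /eqP hyx.
  by apply: h; rewrite inE mem_filter hyx hy orbT.
- by congr PP; [apply: IH|apply: IHQ] => y hy; apply: h; rewrite mem_cat hy ?orbT.
- by congr PP; [apply: IH|apply: IHQ] => y hy; apply: h; rewrite mem_cat hy ?orbT.
- apply: IH => y hy; rewrite /upd; case: eqP => // /eqP hyx.
  by apply: h; rewrite mem_filter hyx hy.
Qed.

(* [denotes P rho p V]: [p] is [P] with the names read through [rho] and each active
   restriction instantiated by a distinct channel of [V]. *)
Fixpoint denotes (P : term K) (rho : name -> chan) (p : proc) (V : chan -> Prop) : Prop :=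
  match P with
  | TConst k => p = PC k
  | TAct u e x P => exists f, p = PAct (rho u) e f /\ forall c, denotes P (upd rho x c) (f c) V
  | TDia P => denotes P rho p V
  | TPar P Q => exists p1 p2 V1 V2, p = PP true p1 p2 /\
      (forall c, V1 c -> V c) /\ (forall c, V2 c -> V c) /\ (forall c, V1 c -> ~ V2 c) /\
      denotes P rho p1 V1 /\ denotes Q rho p2 V2
  | TPPar P Q => exists p1 p2 V1 V2, p = PP false p1 p2 /\
      (forall c, V1 c -> V c) /\ (forall c, V2 c -> V c) /\ (forall c, V1 c -> ~ V2 c) /\
      denotes P rho p1 V1 /\ denotes Q rho p2 V2
  | TNu x P => exists c V', V c /\ (forall d, V' d -> V d) /\ ~ V' c /\
      denotes P (upd rho x c) p V'
  end.

Definition zone (s : seq nat) : chan -> Prop :=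
  fun c => exists t, c = Pv (t ++ s).

Lemma zone_cons k s c : zone (k :: s) c -> zone s c.
Proof. by case=> t ->; exists (t ++ [:: k]); rewrite -catA. Qed.

Lemma zone_self s : zone s (Pv s).
Proof. by exists [::]. Qed.

Lemma zone_strict k s : ~ zone (k :: s) (Pv s).
Proof. by case=> t [] /(congr1 size); rewrite size_cat /=; lia. Qed.

Lemma zone_disj s c : zone (1%N :: s) c -> ~ zone (2 :: s) c.
Proof.
case=> t -> [t' []]; rewrite -!cat_rcons => h.
have hsz : size (rcons t 1%N) = size (rcons t' 2).
  by have := congr1 size h; rewrite !size_cat => /addIn.
by move/eqP: h; rewrite eqseq_cat // eqseq_rcons andbF.
Qed.

Lemma denotes_mono P rho p V V' : (forall c, V c -> V' c) -> denotes P rho p V -> denotes P rho p V'.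
Proof.
elim: P rho p V V' => //= [u e x P IH|P IH Q IHQ|P IH Q IHQ|x P IH] rho p V V' hV.
- by move=> [f [-> h]]; exists f; split=> // c; apply: IH (h c).
- move=> [p1 [p2 [V1 [V2 [-> [h1 [h2 h]]]]]]]; exists p1, p2, V1, V2; split=> //.
  by split; [move=> c /h1 /hV|split=> // c /h2 /hV].
- move=> [p1 [p2 [V1 [V2 [-> [h1 [h2 h]]]]]]]; exists p1, p2, V1, V2; split=> //.
  by split; [move=> c /h1 /hV|split=> // c /h2 /hV].
- move=> [c [W [h1 [h2 h]]]]; exists c, W; split; first exact: hV.
  by split=> // d /h2 /hV.
Qed.

(** [den] supplies the initial reading only. After a communication the new restriction stands for
    the object exchanged and not for a path, which is why adequacy is stated with the laxer relation
    [denotes]. *)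
Lemma denotes_den P rho s : denotes P rho (den P rho s) (zone s).
Proof.
elim: P rho s => //= [u e x P IH|P IH Q IHQ|P IH Q IHQ|x P IH] rho s.
- eexists; split=> // c; apply: denotes_mono (IH _ _) => d; exact: zone_cons.
- exists (den P rho (1%N :: s)), (den Q rho (2 :: s)), (zone (1%N :: s)), (zone (2 :: s)).
  by split=> //; do 2!(split; first by move=> c; apply: zone_cons); split=> // c /zone_disj.
- exists (den P rho (1%N :: s)), (den Q rho (2 :: s)), (zone (1%N :: s)), (zone (2 :: s)).
  by split=> //; do 2!(split; first by move=> c; apply: zone_cons); split=> // c /zone_disj.
- exists (Pv s), (zone (1%N :: s)); split; first exact: zone_self.
  by split; [move=> d; apply: zone_cons|split; [apply: zone_strict|]].
Qed.

Lemma denotes_fn P rho rho' p V : {in fn P, rho =1 rho'} -> denotes P rho p V -> denotes P rho' p V.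
Proof.
elim: P rho rho' p V => //= [u e x P IH|P IH Q IHQ|P IH Q IHQ|x P IH] rho rho' p V h.
- move=> [f [-> hf]]; exists f; rewrite h ?inE ?eqxx //; split=> // c.
  apply: IH (hf c) => y hy; rewrite /upd; case: eqP => // /eqP hyx.
  by apply: h; rewrite inE mem_filter hyx hy orbT.
- move=> [p1 [p2 [V1 [V2 [-> [h1 [h2 [h3 [h4 h5]]]]]]]]]; exists p1, p2, V1, V2.
  do 4!split=> //; split; [apply: IH h4|apply: IHQ h5] => y hy;
  by apply: h; rewrite mem_cat hy ?orbT.
- move=> [p1 [p2 [V1 [V2 [-> [h1 [h2 [h3 [h4 h5]]]]]]]]]; exists p1, p2, V1, V2.
  do 4!split=> //; split; [apply: IH h4|apply: IHQ h5] => y hy;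
  by apply: h; rewrite mem_cat hy ?orbT.
- move=> [c [W [h1 [h2 [h3 h4]]]]]; exists c, W; do 3!split=> //.
  apply: IH h4 => y hy; rewrite /upd; case: eqP => // /eqP hyx.
  by apply: h; rewrite mem_filter hyx hy.
Qed.

(** * Invariance of the interpretation under renaming and commutation of restrictions *)

Lemma swapnK a b : involutive (swapn a b).
Proof.
move=> c; rewrite /swapn; case: (c =P a) => [->|ha].
  by case: (b =P a) => [->|] //; rewrite eqxx.
case: (c =P b) => [->|hb]; first by rewrite eqxx.
by rewrite (negbTE (introN eqP ha)) (negbTE (introN eqP hb)).
Qed.

Lemma swapn_inj a b : injective (swapn a b).
Proof. exact: inv_inj (swapnK a b). Qed.

Lemma fn_swap a b (P : term K) : fn (swap a b P) = map (swapn a b) (fn P).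
Proof.
have hf x s : [seq y <- map (swapn a b) s | y != swapn a b x]
            = map (swapn a b) [seq y <- s | y != x].
  rewrite filter_map; congr map; apply: eq_filter => y /=.
  by rewrite (inj_eq (@swapn_inj a b)).
by elim: P => //= [u e x P ->|P -> Q ->|P -> Q ->|x P ->]; rewrite ?hf ?map_cat.
Qed.

Lemma bn_swap a b (P : term K) : bn (swap a b P) = map (swapn a b) (bn P).
Proof.
by elim: P => //= [u e x P ->|P -> Q ->|P -> Q ->|x P ->]; rewrite ?map_cat.
Qed.

Lemma upd_swap rho a b x c :
  upd (rho \o swapn a b) (swapn a b x) c = upd rho x c \o swapn a b.
Proof.
apply: functional_extensionality => y; rewrite /upd /=.
by rewrite -{2}[x](swapnK a b) (inj_eq (@swapn_inj a b)).
Qed.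

Lemma denotes_swap a b P rho p V :
  denotes P rho p V -> denotes (swap a b P) (rho \o swapn a b) p V.
Proof.
elim: P rho p V => //= [u e x P IH|P IH Q IHQ|P IH Q IHQ|x P IH] rho p V.
- move=> [f [-> h]]; exists f; rewrite swapnK; split=> // c.
  by rewrite upd_swap; apply: IH.
- move=> [p1 [p2 [V1 [V2 [-> [h1 [h2 [h3 [h4 h5]]]]]]]]]; exists p1, p2, V1, V2.
  by do 4!split=> //; split; [apply: IH|apply: IHQ].
- move=> [p1 [p2 [V1 [V2 [-> [h1 [h2 [h3 [h4 h5]]]]]]]]]; exists p1, p2, V1, V2.
  by do 4!split=> //; split; [apply: IH|apply: IHQ].
- move=> [c [W [h1 [h2 [h3 h4]]]]]; exists c, W; do 3!split=> //.
  by rewrite upd_swap; apply: IH.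
Qed.

Lemma swapK a b : involutive (@swap K a b).
Proof.
by elim=> //= [u e x P ->|P ->|P -> Q ->|P -> Q ->|x P ->]; rewrite ?swapnK.
Qed.

Lemma upd_alpha x y rho c (P : term K) : y \notin fn P ->
  {in fn P, upd rho x c =1 upd rho y c \o swapn x y}.
Proof.
move=> hy z hz; rewrite /upd /= /swapn; case: (z =P x) => [_|hx].
  by rewrite eqxx.
have hzy : z == y = false by apply: contraNF hy => /eqP <-.
by rewrite hzy hzy.
Qed.

Lemma denotes_alpha x y (P : term K) rho c p V : y \notin fn P ->
  denotes P (upd rho x c) p V <-> denotes (swap x y P) (upd rho y c) p V.
Proof.
move=> hy; split=> h.
- have := denotes_swap x y (denotes_fn (upd_alpha x rho c hy) h).
  congr denotes; apply: functional_extensionality => z /=; by rewrite swapnK.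
- have := denotes_swap x y h; rewrite swapK; apply: denotes_fn => z hz.
  by rewrite (upd_alpha x rho c hy).
Qed.

Lemma denotes_aeq P Q : aeq P Q -> forall rho p V, denotes P rho p V <-> denotes Q rho p V.
Proof.
elim=> {P Q} /=.
- by [].
- by move=> P Q _ h rho p V; rewrite h.
- by move=> P Q R _ h _ h' rho p V; rewrite h h'.
- move=> u e x P Q _ h rho p V; split=> -[f [-> hf]]; exists f; split=> // c;
  exact/h.
- by move=> P Q _ h rho p V.
- move=> P P' Q Q' _ h _ h' rho p V.
  by split=> -[p1 [p2 [V1 [V2 [-> [h1 [h2 [h3 [h4 h5]]]]]]]]]; exists p1, p2, V1, V2; do 4!split=> //; (split; [apply/h|apply/h']).
- move=> P P' Q Q' _ h _ h' rho p V.
  by split=> -[p1 [p2 [V1 [V2 [-> [h1 [h2 [h3 [h4 h5]]]]]]]]]; exists p1, p2, V1, V2; do 4!split=> //; (split; [apply/h|apply/h']).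
- by move=> x P Q _ h rho p V; split=> -[c [W [h1 [h2 [h3 /h h4]]]]]; exists c, W.
- move=> u e x y P hy rho p V.
  by split=> -[f [-> hf]]; exists f; split=> // c; apply/(denotes_alpha x rho c (f c) V hy).
- move=> x y P hy rho p V.
  by split=> -[c [W [h1 [h2 [h3 h4]]]]]; exists c, W; do 3!split=> //; apply/(denotes_alpha x rho c p W hy).
- suff h x y P rho p V : denotes (TNu x (TNu y P)) rho p V -> denotes (TNu y (TNu x P)) rho p V.
    by move=> x y P rho p V; split=> /h.
  move=> [c [W [h1 [h2 [h3 [d [W' [h4 [h5 [h6 h7]]]]]]]]]].
  case: (eqVneq x y) h7 => [->|hxy] h7.
    exists c, W; do 3!split=> //; exists d, W'; do 3!split=> //.
  (* The two restrictions trade places: the outer one now takes [d], and [c] is handed over to the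
     channels available to the inner one. *)
  exists d, (fun z => W' z \/ z = c); split; first exact: h2.
  split; first by move=> z [/h5 /h2|->].
  split; first by move=> [//|hcd]; apply: h3; rewrite -hcd.
  exists c, W'; split; first by right.
  split; first by move=> z; left.
  by split; [move=> /h5|rewrite updC // eq_sym].
Qed.

Lemma denotes_state P rho p V : denotes P rho p V -> state P = pval p.
Proof.
elim: P rho p V => //= [k|u e x P IH|P IH Q IHQ|P IH Q IHQ|x P IH] rho p V.
- by move=> ->.
- by move=> [f [-> _]].
- by move=> [p1 [p2 [V1 [V2 [-> [h1 [h2 [h3 [/IH -> /IHQ ->]]]]]]]]].
- by move=> [p1 [p2 [V1 [V2 [-> [h1 [h2 [h3 [/IH -> /IHQ ->]]]]]]]]].
- by move=> [c [W [h1 [h2 [h3 /IH ->]]]]].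
Qed.

Lemma denotes_subst x y P rho p V : x \notin bn P ->
  denotes P (upd rho y (rho x)) p V -> denotes (subst y x P) rho p V.
Proof.
elim: P rho p V => //= [u e z P IH|P IH Q IHQ|P IH Q IHQ|z P IH] rho p V.
- rewrite inE negb_or => /andP[hz hx] [f [-> hf]]; exists f; split.
    by rewrite /upd; case: eqP.
  move=> c; case: ifP (hf c) => [/eqP ->|hzy]; first by rewrite upd_upd.
  rewrite updC 1?eq_sym ?hzy // => h; apply: IH => //.
  by rewrite upd_other.
- rewrite mem_cat negb_or => /andP[hx hx'].
  move=> [p1 [p2 [V1 [V2 [-> [h1 [h2 [h3 [h4 h5]]]]]]]]]; exists p1, p2, V1, V2.
  by do 4!split=> //; split; [apply: IH|apply: IHQ].
- rewrite mem_cat negb_or => /andP[hx hx'].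
  move=> [p1 [p2 [V1 [V2 [-> [h1 [h2 [h3 [h4 h5]]]]]]]]]; exists p1, p2, V1, V2.
  by do 4!split=> //; split; [apply: IH|apply: IHQ].
- rewrite inE negb_or => /andP[hz hx] [c [W [h1 [h2 [h3 h4]]]]].
  exists c, W; do 3!split=> //.
  case: ifP h4 => [/eqP ->|hzy]; first by rewrite upd_upd.
  rewrite updC 1?eq_sym ?hzy // => h; apply: IH => //.
  by rewrite upd_other.
Qed.
End Processes.

(** * Adequacy of the interpretation *)

Section Adequacy.
Variable K : comPzSemiRingType.
Implicit Types P Q R E : term K.
Implicit Types p q r : proc K.
Definition lobj (a : label) : seq name :=
  match a with LVis _ _ x _ => [:: x] | LInt _ _ => [::] end.

Lemma lobj_lpush k a : lobj (lpush k a) = lobj a.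
Proof. by case: a. Qed.

Lemma fn_aeq P Q : aeq P Q -> fn P =i fn Q.
Proof.
have ha x y (s : seq name) : y \notin s ->
    [seq z <- map (swapn x y) s | z != y] = [seq z <- s | z != x].
  elim: s => //= z s IH; rewrite inE negb_or => /andP[hyz /IH ->].
  rewrite /swapn; case: (z =P x) => [->|hx]; first by rewrite eqxx.
  by rewrite [z == y]eq_sym (negbTE hyz) eq_sym hyz.
elim=> {P Q} //=.
- by move=> P Q _ h z; rewrite h.
- by move=> P Q R _ h _ h' z; rewrite h h'.
- by move=> u e x P Q _ h z; rewrite !inE !mem_filter h.
- by move=> P P' Q Q' _ h _ h' z; rewrite !mem_cat h h'.
- by move=> P P' Q Q' _ h _ h' z; rewrite !mem_cat h h'.
- by move=> x P Q _ h z; rewrite !mem_filter h.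
- by move=> u e x y P hy z; rewrite !inE fn_swap ha.
- by move=> x y P hy z; rewrite fn_swap ha.
- by move=> x y P z; rewrite !mem_filter andbCA.
Qed.

Lemma fn_subst x y P z : z \in fn (subst y x P) -> z = x \/ z \in fn P /\ z != y.
Proof.
elim: P => //= [u e v P IH|P IH Q IHQ|P IH Q IHQ|v P IH].
- rewrite !inE !mem_filter; case: (u =P y) => [_|/eqP hu] /orP[/eqP ->|].
  + by left.
  + case: ifP => [/eqP ->|hv] /andP[hz hzP]; first by right; rewrite hz hzP orbT.
    by have [|[-> ->]] := IH hzP; [left|right; rewrite hz orbT].
  + by right; rewrite eqxx hu.
  + case: ifP => [/eqP ->|hv] /andP[hz hzP]; first by right; rewrite hz hzP orbT.
    by have [|[-> ->]] := IH hzP; [left|right; rewrite hz orbT].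
- by rewrite !mem_cat => /orP[/IH|/IHQ] [|[-> ->]]; rewrite ?orbT; [left|right|left|right].
- by rewrite !mem_cat => /orP[/IH|/IHQ] [|[-> ->]]; rewrite ?orbT; [left|right|left|right].
- rewrite !mem_filter; case: ifP => [/eqP ->|hv] /andP[hz hzP]; first by right; rewrite hz hzP.
  by have [|[-> ->]] := IH hzP; [left|right; rewrite hz].
Qed.

Lemma fn_step P a P' : step P a P' -> {subset fn P' <= lobj a ++ fn P}.
Proof.
elim=> {P a P'} /=.
- move=> u e x P _ z hz; rewrite !inE mem_filter hz andbT.
  by case: (z =P x); rewrite ?orbT.
- by move=> P a P' _ IH; rewrite lobj_lpush.
- move=> P Q a P' _ IH _ z; rewrite lobj_lpush !mem_cat => /orP[/IH|->]; last by rewrite !orbT.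
  by rewrite mem_cat => /orP[->|->]; rewrite ?orbT.
- move=> P Q a P' _ IH _ z; rewrite lobj_lpush !mem_cat => /orP[->|/IH]; first by rewrite !orbT.
  by rewrite mem_cat => /orP[->|->]; rewrite ?orbT.
- move=> P Q a P' _ IH _ z; rewrite lobj_lpush !mem_cat => /orP[/IH|->]; last by rewrite !orbT.
  by rewrite mem_cat => /orP[->|->]; rewrite ?orbT.
- move=> P Q a P' _ IH _ z; rewrite lobj_lpush !mem_cat => /orP[->|/IH]; first by rewrite !orbT.
  by rewrite mem_cat => /orP[->|->]; rewrite ?orbT.
- move=> x P a P' _ IH _ z; rewrite mem_filter => /andP[hz /IH].
  by rewrite !mem_cat mem_filter hz.
- move=> P Q P' Q' u e x y i j _ IHP _ IHQ _ _ z.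
  rewrite mem_filter !mem_cat => /andP[hz /orP[/IHP|/fn_subst [hzx|[/IHQ]]]].
  + by rewrite inE (negbTE hz) /= => ->.
  + by rewrite hzx eqxx in hz.
  + by rewrite inE => /orP[/eqP ->|->]; rewrite ?eqxx ?orbT.
- move=> P P0 a P1 P' /fn_aeq h0 _ IH /fn_aeq h1 z; rewrite -h1 => /IH.
  by rewrite !mem_cat h0.
Qed.

Lemma ltn_fresh x (l : seq name) : x \in l -> (x < fresh l)%N.
Proof.
rewrite /fresh ltnS; elim: l => //= y l IH; rewrite inE leq_max.
by case/orP => [/eqP ->|/IH ->]; rewrite ?leqnn ?orbT.
Qed.

Lemma fresh_notin (l : seq name) : fresh l \notin l.
Proof. by apply/negP => /ltn_fresh; rewrite ltnn. Qed.

(** The substitution in [s_comm] is only sound when the new name is not bound in the receiving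
    residual; this lemma provides a residual that satisfies the side condition. *)
Lemma aeq_avoid (A : seq name) P :
  exists P', aeq P P' /\ forall x, x \in A -> x \notin bn P'.
Proof.
elim: P => [k|u e x P [P' [h1 h2]]|P [P' [h1 h2]]|P [P' [h1 h2]] Q [Q' [h3 h4]]
  |P [P' [h1 h2]] Q [Q' [h3 h4]]|x P [P' [h1 h2]]].
- by exists (TConst k); split; [apply: aeq_refl|].
- pose y := fresh (A ++ allnames P').
  have := fresh_notin (A ++ allnames P'); rewrite -/y !mem_cat !negb_or => /and3P[hA hf hb].
  exists (TAct u e y (swap x y P')); split.
    exact: aeq_trans (aeq_act _ _ _ h1) (aeq_alpha_act _ _ _ hf).
  move=> z hz /=; rewrite inE negb_or; apply/andP; split.
    by apply: contraNneq hA => <-.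
  rewrite bn_swap; apply: (contra _ (h2 _ hz)) => /mapP[w hw].
  rewrite /swapn; case: (w =P x) => [_ hzy|_]; first by rewrite hzy (negbTE hA) in hz.
  by case: (w =P y) => [hwy|_ -> //]; rewrite hwy (negbTE hb) in hw.
- by exists (TDia P'); split; [apply: aeq_dia|].
- exists (TPar P' Q'); split; first exact: aeq_par.
  by move=> x hx; rewrite /= mem_cat negb_or h2 ?h4.
- exists (TPPar P' Q'); split; first exact: aeq_ppar.
  by move=> x hx; rewrite /= mem_cat negb_or h2 ?h4.
- pose y := fresh (A ++ allnames P').
  have := fresh_notin (A ++ allnames P'); rewrite -/y !mem_cat !negb_or => /and3P[hA hf hb].
  exists (TNu y (swap x y P')); split.
    exact: aeq_trans (aeq_nu _ h1) (aeq_alpha_nu _ hf).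
  move=> z hz /=; rewrite inE negb_or; apply/andP; split.
    by apply: contraNneq hA => <-.
  rewrite bn_swap; apply: (contra _ (h2 _ hz)) => /mapP[w hw].
  rewrite /swapn; case: (w =P x) => [_ hzy|_]; first by rewrite hzy (negbTE hA) in hz.
  by case: (w =P y) => [hwy|_ -> //]; rewrite hwy (negbTE hb) in hw.
Qed.

Definition addc (V : chan -> Prop) (c : chan) : chan -> Prop := fun d => V d \/ d = c.

(** An internal step adds one restriction, whose channel is the argument [c] of the residual; so [c]
    must be new to [V] and joins it. A visible step binds its object to [c] in the environment
    instead, and [bnd_ok] keeps the sibling blind to it. *)
Lemma step_sound P a P' : step P a P' -> forall rho p V, denotes P rho p V ->
  match a with
  | LVis u e x _ => exists g, vis p (rho u) e g /\ forall c, denotes P' (upd rho x c) (g c) V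
  | LInt _ _ => exists g, tau p g /\ forall c, ~ V c -> denotes P' rho (g c) (addc V c)
  end.
Proof.
have relw Q rho x c q V : x \notin fn Q -> denotes Q rho q V -> denotes Q (upd rho x c) q V.
  move=> hx; apply: denotes_fn => y hy; rewrite upd_other //.
  by apply: contraNneq hx => <-.
elim=> {P a P'} /=.
- move=> u e x P _ rho p V [f [-> hf]]; exists f; split=> //; exact: vis_act.
- by move=> P a P' _ IH rho p V /IH {IH}; case: a.
- move=> P Q a P' _ IH hb rho p V [p1 [p2 [V1 [V2 [-> [h1 [h2 [h3 [/IH hI h5]]]]]]]]].
  clear IH; case: a hI hb => [u e x i|i j] /= [g [hg hr]] hb; eexists.
    split; first exact: vis_l hg.
    by move=> c; exists (g c), p2, V1, V2; do 4!split=> //; split; [|apply: relw].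
  split; first exact: tau_l hg.
  move=> c hc; exists (g c), p2, (addc V1 c), V2; split=> //.
  split; first by move=> d [/h1|]; [left|right].
  split; first by move=> d /h2; left.
  split; first by move=> d [/h3 //|->] /h2.
  by split=> //; apply: hr => /h1.
- move=> P Q a Q' _ IH hb rho p V [p1 [p2 [V1 [V2 [-> [h1 [h2 [h3 [h5 /IH hI]]]]]]]]].
  clear IH; case: a hI hb => [u e x i|i j] /= [g [hg hr]] hb; eexists.
    split; first exact: vis_r hg.
    by move=> c; exists p1, (g c), V1, V2; do 4!split=> //; split; [apply: relw|].
  split; first exact: tau_r hg.
  move=> c hc; exists p1, (g c), V1, (addc V2 c); split=> //.
  split; first by move=> d /h1; left.
  split; first by move=> d [/h2|]; [left|right].
  split; first by move=> d hd [/h3|hdc]; [apply|apply: hc; rewrite -hdc; apply: h1].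
  by split=> //; apply: hr => /h2.
- move=> P Q a P' _ IH hb rho p V [p1 [p2 [V1 [V2 [-> [h1 [h2 [h3 [/IH hI h5]]]]]]]]].
  clear IH; case: a hI hb => [u e x i|i j] /= [g [hg hr]] hb; eexists.
    split; first exact: vis_l hg.
    by move=> c; exists (g c), p2, V1, V2; do 4!split=> //; split; [|apply: relw].
  split; first exact: tau_l hg.
  move=> c hc; exists (g c), p2, (addc V1 c), V2; split=> //.
  split; first by move=> d [/h1|]; [left|right].
  split; first by move=> d /h2; left.
  split; first by move=> d [/h3 //|->] /h2.
  by split=> //; apply: hr => /h1.
- move=> P Q a Q' _ IH hb rho p V [p1 [p2 [V1 [V2 [-> [h1 [h2 [h3 [h5 /IH hI]]]]]]]]].
  clear IH; case: a hI hb => [u e x i|i j] /= [g [hg hr]] hb; eexists.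
    split; first exact: vis_r hg.
    by move=> c; exists p1, (g c), V1, V2; do 4!split=> //; split; [apply: relw|].
  split; first exact: tau_r hg.
  move=> c hc; exists p1, (g c), V1, (addc V2 c); split=> //.
  split; first by move=> d /h1; left.
  split; first by move=> d [/h2|]; [left|right].
  split; first by move=> d hd [/h3|hdc]; [apply|apply: hc; rewrite -hdc; apply: h1].
  by split=> //; apply: hr => /h2.
- move=> z P a P' _ IH hz rho p V [c0 [W [h1 [h2 [h3 /IH hI]]]]].
  clear IH; case: a hI hz => [u e x i|i j] /= [g [hg hr]].
    rewrite !inE negb_or => /andP[hzu hzx]; exists g; split.
      by rewrite upd_other 1?eq_sym // in hg.
    move=> c; exists c0, W; do 3!split=> //.
    by rewrite updC 1?eq_sym.
  move=> _; exists g; split=> // c hc; exists c0, (addc W c).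
  split; first by left.
  split; first by move=> d [/h2|]; [left|right].
  split; first by move=> [//|hcc]; apply: hc; rewrite -hcc.
  by apply: hr => /h2.
- move=> P Q P' Q' u e x y i j _ IHP hQ IHQ hxQ hxQ' rho p V.
  move=> [p1 [p2 [V1 [V2 [-> [h1 [h2 [h3 [/IHP [g [hg hrg]] /IHQ [h [hh hrh]]]]]]]]]]].
  exists (fun c => PP true (g c) (h c)); split; first exact: tau_c hg hh.
  move=> c hc; exists c, V; split; first by right.
  split; first by move=> d; left.
  split=> //; exists (g c), (h c), V1, V2; do 4!split=> //; split=> //.
  apply: denotes_subst => //; rewrite upd_same.
  (* If the names differ, [x] is not free in the residual of [Q]: it is not free in [Q], and a step
     adds no free name but its own object [y]. *)
  case: (eqVneq x y) => [->|hxy]; first by rewrite upd_upd.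
  rewrite updC //; apply: relw => //.
  by apply: contra hxQ => /(fn_step hQ); rewrite inE (negbTE hxy).
- move=> P P0 a P1 P' /denotes_aeq h0 _ IH /denotes_aeq h1 rho p V /h0 /IH.
  case: a {IH} => [u e x i|i j] [g [hg hr]]; exists g; split=> // c; first exact/h1.
  by move=> hc; apply/h1/hr.
Qed.

(** Without these conditions a process could communicate where the term cannot: through two names
    read as one channel, or through a name read as a restricted channel. *)
Definition good (rho : name -> chan) (V : chan -> Prop) : Prop :=
  injective rho /\ forall u, ~ V (rho u).

Lemma good_sub rho (V W : chan -> Prop) : (forall c, W c -> V c) -> good rho V -> good rho W.
Proof. by move=> h [h1 h2]; split=> // u /h /h2. Qed.

Lemma good_upd rho V W x c : good rho V -> V c -> (forall d, W d -> V d) -> ~ W c ->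
  good (upd rho x c) W.
Proof.
move=> [h1 h2] hc hW hcW; split=> [u v|u]; rewrite /upd.
  case: (u =P x) => [->|_]; case: (v =P x) => [->|_] //; last exact: h1.
    by move=> hcv; case: (h2 v); rewrite -hcv.
  by move=> hcv; case: (h2 u); rewrite hcv.
by case: eqP => // _ /hW /h2.
Qed.

(** A subject in [V] is restricted in the term, which then cannot show the action. Otherwise any
    object new to the whole term passes the side conditions of all the rules on the way up. *)
Lemma vis_complete P : forall rho p V kappa e g, denotes P rho p V -> good rho V ->
  vis p kappa e g ->
  V kappa \/ exists u, rho u = kappa /\ u \in fn P /\
    forall x, x \notin allnames P -> exists i P', step P (LVis u e x i) P' /\
      forall c, denotes P' (upd rho x c) (g c) V.
Proof.
elim: P => [k|u e x P IH|P IH|P IH Q IHQ|P IH Q IHQ|z P IH] rho p V kappa e' g /=.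
- by move=> -> _ /vis_PC.
- move=> [f [-> hf]] hg /vis_PAct [-> -> ->]; right; exists u; split=> //.
  split; first by rewrite inE eqxx.
  move=> y hy; exists [::], (TDia (swap x y P)).
  have [hyu [hyx hyP]] : y != u /\ y != x /\ y \notin fn P.
    move: hy; rewrite /allnames /= !inE !mem_cat !inE !negb_or mem_filter negb_and negbK.
    case/and3P => -> /orP[/eqP hyx|->] /andP[hyx' _] //; by rewrite hyx eqxx in hyx'.
  split.
    apply: s_alpha (s_act _ _ _) (aeq_refl _); last exact: hyu.
    exact: aeq_alpha_act.
  by move=> c /=; apply/(denotes_alpha x rho c (f c) V hyP).
- move=> hr hg /(IH _ _ _ _ _ _ hr hg) [|[u [h1 [h0 h2]]]]; [by left|right].
  exists u; do 2!split=> //; move=> x hx; have [i [P' [h3 h4]]] := h2 x hx.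
  by exists (1%N :: i), (TDia P'); split=> //; apply: (s_dia h3).
- move=> [p1 [p2 [V1 [V2 [-> [h1 [h2 [h3 [h4 h5]]]]]]]]] hg /vis_PP [[h hh ->]|[h hh ->]].
    have [/h1|[u [hu [hu' hx]]]] := IH _ _ _ _ _ _ h4 (good_sub h1 hg) hh; [by left|right].
    exists u; split=> //; split; first by rewrite mem_cat hu'.
    move=> x; rewrite /allnames /= !mem_cat !negb_or => /andP[/andP[hxP hxQ] /andP[hxP' _]].
    have [|i [P' [hs hr]]] := hx x; first by rewrite mem_cat negb_or hxP.
    exists (1%N :: i), (TPar P' Q); split; first exact: (s_par1 hs).
    move=> c; exists (h c), p2, V1, V2; do 4!split=> //; split=> //.
    apply: denotes_fn h5 => y hy; rewrite upd_other //.
    by apply: contraNneq hxQ => <-.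
  have [/h2|[u [hu [hu' hx]]]] := IHQ _ _ _ _ _ _ h5 (good_sub h2 hg) hh; [by left|right].
  exists u; split=> //; split; first by rewrite mem_cat hu' orbT.
  move=> x; rewrite /allnames /= !mem_cat !negb_or => /andP[/andP[hxP hxQ] /andP[_ hxQ']].
  have [|i [Q' [hs hr]]] := hx x; first by rewrite mem_cat negb_or hxQ.
  exists (2 :: i), (TPar P Q'); split; first exact: (s_par2 hs).
  move=> c; exists p1, (h c), V1, V2; do 4!split=> //; split=> //.
  apply: denotes_fn h4 => y hy; rewrite upd_other //.
  by apply: contraNneq hxP => <-.
- move=> [p1 [p2 [V1 [V2 [-> [h1 [h2 [h3 [h4 h5]]]]]]]]] hg /vis_PP [[h hh ->]|[h hh ->]].
    have [/h1|[u [hu [hu' hx]]]] := IH _ _ _ _ _ _ h4 (good_sub h1 hg) hh; [by left|right].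
    exists u; split=> //; split; first by rewrite mem_cat hu'.
    move=> x; rewrite /allnames /= !mem_cat !negb_or => /andP[/andP[hxP hxQ] /andP[hxP' _]].
    have [|i [P' [hs hr]]] := hx x; first by rewrite mem_cat negb_or hxP.
    exists (1%N :: i), (TPPar P' Q); split; first exact: (s_ppar1 hs).
    move=> c; exists (h c), p2, V1, V2; do 4!split=> //; split=> //.
    apply: denotes_fn h5 => y hy; rewrite upd_other //.
    by apply: contraNneq hxQ => <-.
  have [/h2|[u [hu [hu' hx]]]] := IHQ _ _ _ _ _ _ h5 (good_sub h2 hg) hh; [by left|right].
  exists u; split=> //; split; first by rewrite mem_cat hu' orbT.
  move=> x; rewrite /allnames /= !mem_cat !negb_or => /andP[/andP[hxP hxQ] /andP[_ hxQ']].
  have [|i [Q' [hs hr]]] := hx x; first by rewrite mem_cat negb_or hxQ.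
  exists (2 :: i), (TPPar P Q'); split; first exact: (s_ppar2 hs).
  move=> c; exists p1, (h c), V1, V2; do 4!split=> //; split=> //.
  apply: denotes_fn h4 => y hy; rewrite upd_other //.
  by apply: contraNneq hxP => <-.
- move=> [c0 [W [h1 [h2 [h3 h4]]]]] hg hv.
  have [/h2|[u [hu [hu' hx]]]] := IH _ _ _ _ _ _ h4 (good_upd z hg h1 h2 h3) hv; first by left.
  move: hu; rewrite /upd; case: (u =P z) => [_ <-|/eqP huz hu]; [by left|right].
  exists u; split=> //; split; first by rewrite mem_filter huz.
  move=> x; rewrite /allnames /= !mem_cat !inE !negb_or mem_filter negb_and negbK.
  case/andP => hxz /andP[hxz' hxb].
  have hxP : x \notin fn P by case/orP: hxz => // /eqP hxe; rewrite hxe eqxx in hxz'.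
  have [|i [P' [hs hr]]] := hx x; first by rewrite mem_cat negb_or hxP.
  exists i, (TNu z P'); split.
    by apply: (s_nu hs); rewrite /= !inE negb_or [z == u]eq_sym huz [z == x]eq_sym hxz'.
  by move=> c; exists c0, W; do 3!split=> //; rewrite updC // eq_sym.
Qed.

Lemma tau_complete P : forall rho p V g, denotes P rho p V -> good rho V -> tau p g ->
  exists i j P', step P (LInt i j) P' /\
    forall c, ~ V c -> denotes P' rho (g c) (addc V c).
Proof.
elim: P => [k|u e x P IH|P IH|P IH Q IHQ|P IH Q IHQ|z P IH] rho p V g /=.
- by move=> -> _ /tau_PC.
- by move=> [f [-> _]] _ /tau_PAct.
- move=> hr hg /(IH _ _ _ _ hr hg) [i [j [P' [hs h]]]].
  by exists (1%N :: i), (1%N :: j), (TDia P'); split; [apply: (s_dia hs)|].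
- move=> [p1 [p2 [V1 [V2 [-> [h1 [h2 [h3 [h4 h5]]]]]]]]] hg /tau_PP [[h hh ->]|[h hh ->]|].
  + have [i [j [P' [hs hr]]]] := IH _ _ _ _ h4 (good_sub h1 hg) hh.
    exists (1%N :: i), (1%N :: j), (TPar P' Q); split; first exact: (s_par1 hs).
    move=> c hc; exists (h c), p2, (addc V1 c), V2; split=> //.
    split; first by move=> d [/h1|]; [left|right].
    split; first by move=> d /h2; left.
    split; first by move=> d [/h3 //|->] /h2.
    by split=> //; apply: hr => /h1.
  + have [i [j [Q' [hs hr]]]] := IHQ _ _ _ _ h5 (good_sub h2 hg) hh.
    exists (2 :: i), (2 :: j), (TPar P Q'); split; first exact: (s_par2 hs).
    move=> c hc; exists p1, (h c), V1, (addc V2 c); split=> //.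
    split; first by move=> d /h1; left.
    split; first by move=> d [/h2|]; [left|right].
    split; first by move=> d hd [/h3|hdc]; [apply|apply: hc; rewrite -hdc; apply: h1].
    by split=> //; apply: hr => /h2.
  + move=> [_ [kappa [e [g1 [g2 [hv1 hv2 ->]]]]]].
    have hV u : rho u = kappa -> ~ V kappa by move=> <-; apply: (proj2 hg).
    (* The subject is restricted on neither side: not on both, since [V1] and [V2] are disjoint; not
       on one only, since the other side reads it from a free name, which [good] keeps out of
       [V]. *)
    have [hk1|[u [hu [hu' hx]]]] := vis_complete h4 (good_sub h1 hg) hv1;
    have [hk2|[v [hv [hv' hy]]]] := vis_complete h5 (good_sub h2 hg) hv2.
    * by case: (h3 _ hk1).
    * by case: (hV _ hv); apply: h1.
    * by case: (hV _ hu); apply: h2.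
    have huv : u = v by apply: (proj1 hg); rewrite hu hv.
    rewrite -huv in hy.
    pose x := fresh (allnames P ++ allnames Q).
    have := fresh_notin (allnames P ++ allnames Q); rewrite -/x mem_cat negb_or => /andP[hxP hxQ].
    have [i [P' [hs hr]]] := hx x hxP; have [j [Q0 [hs' hr']]] := hy x hxQ.
    have [Q' [haq hav]] := aeq_avoid [:: x] Q0.
    have hs2 : step Q (LVis u (~~ e) x j) Q' by apply: s_alpha (aeq_refl _) hs' haq.
    (* Both sides perform their action with the same object [x], new to both, so the rule
       substitutes [x] for itself. *)
    exists (1%N :: i), (2 :: j), (TNu x (TPar P' (subst x x Q'))); split.
      apply: s_comm hs hs2 _ _; last by apply: hav; rewrite inE.
      by apply: contra hxQ; rewrite /allnames mem_cat => ->.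
    move=> c hc; exists c, V; split; first by right.
    split; first by move=> d; left.
    split=> //; exists (g1 c), (g2 c), V1, V2; do 4!split=> //; split=> //.
    apply: denotes_subst; first by apply: hav; rewrite inE.
    by rewrite upd_same upd_upd; apply/(denotes_aeq haq).
- move=> [p1 [p2 [V1 [V2 [-> [h1 [h2 [h3 [h4 h5]]]]]]]]] hg /tau_PP [[h hh ->]|[h hh ->]|].
  + have [i [j [P' [hs hr]]]] := IH _ _ _ _ h4 (good_sub h1 hg) hh.
    exists (1%N :: i), (1%N :: j), (TPPar P' Q); split; first exact: (s_ppar1 hs).
    move=> c hc; exists (h c), p2, (addc V1 c), V2; split=> //.
    split; first by move=> d [/h1|]; [left|right].
    split; first by move=> d /h2; left.
    split; first by move=> d [/h3 //|->] /h2.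
    by split=> //; apply: hr => /h1.
  + have [i [j [Q' [hs hr]]]] := IHQ _ _ _ _ h5 (good_sub h2 hg) hh.
    exists (2 :: i), (2 :: j), (TPPar P Q'); split; first exact: (s_ppar2 hs).
    move=> c hc; exists p1, (h c), V1, (addc V2 c); split=> //.
    split; first by move=> d /h1; left.
    split; first by move=> d [/h2|]; [left|right].
    split; first by move=> d hd [/h3|hdc]; [apply|apply: hc; rewrite -hdc; apply: h1].
    by split=> //; apply: hr => /h2.
  + by case.
- move=> [c0 [W [h1 [h2 [h3 h4]]]]] hg ht.
  have [i [j [P' [hs hr]]]] := IH _ _ _ _ h4 (good_upd z hg h1 h2 h3) ht.
  exists i, j, (TNu z P'); split; first exact: (s_nu hs).
  move=> c hc; exists c0, (addc W c); split; first by left.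
  split; first by move=> d [/h2|]; [left|right].
  split; first by move=> [//|hcc]; apply: hc; rewrite -hcc.
  by apply: hr => /h2.
Qed.

Definition stuckp p : Prop := forall g, ~ tau p g.

Lemma stuck_denotes E rho p V : denotes E rho p V -> good rho V -> stuck E <-> stuckp p.
Proof.
move=> hr hg; split=> [h g ht|h [//|i j] E' _ hs].
  have [i [j [E' [hs _]]]] := tau_complete hr hg ht; exact: h hs.
by have [g [ht _]] := step_sound hs hr; apply: h ht.
Qed.
End Adequacy.

(** * Words and interaction *)

Section Runs.
Variable K : comPzSemiRingType.
Implicit Types P Q R E : term K.
Implicit Types p q r : proc K.
(** Only objects taken in [S] are followed, so the property survives every transition whose object
    lies in [S]. *)
Fixpoint only (S : chan -> Prop) p : Prop :=
  match p with
  | PC _ => True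
  | PAct u _ f => S u /\ forall c, S c -> only S (f c)
  | PP _ p q => only S p /\ only S q
  end.

Lemma only_vis S p u e g : only S p -> vis p u e g -> S u /\ forall c, S c -> only S (g c).
Proof.
move=> h hv; elim: hv h => {p u e g} //=.
- by move=> b p q u e g _ IH [/IH [h1 h2] h]; split=> // c /h2.
- by move=> b p q u e g _ IH [h /IH [h1 h2]]; split=> // c /h2.
Qed.

Lemma only_tau S p g : only S p -> tau p g -> forall c, S c -> only S (g c).
Proof.
move=> h ht; elim: ht h => {p g} //=.
- by move=> b p q g _ IH [/IH h1 h2] c /h1.
- by move=> b p q g _ IH [h1 /IH h2] c /h2.
- by move=> p q u e g h /only_vis hg /only_vis hh [/hg [_ h1] /hh [_ h2]] c hc; split; auto.
Qed.

Lemma only_den (S : chan -> Prop) P rho s : (forall u, u \in fn P -> S (rho u)) ->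
  (forall c, zone s c -> S c) -> only S (den P rho s).
Proof.
elim: P rho s => //= [u e x P IH|P IH Q IHQ|P IH Q IHQ|x P IH] rho s h hz.
- split; first by apply: h; rewrite inE eqxx.
  move=> c hc; apply: IH => [y hy|d /zone_cons /hz //].
  rewrite /upd; case: (y =P x) => // /eqP hyx.
  by apply: h; rewrite inE mem_filter hyx hy orbT.
- split; [apply: IH|apply: IHQ]; try by move=> c /zone_cons /hz.
    by move=> u hu; apply: h; rewrite mem_cat hu.
  by move=> u hu; apply: h; rewrite mem_cat hu orbT.
- split; [apply: IH|apply: IHQ]; try by move=> c /zone_cons /hz.
    by move=> u hu; apply: h; rewrite mem_cat hu.
  by move=> u hu; apply: h; rewrite mem_cat hu orbT.
- apply: IH => [y hy|d /zone_cons /hz //].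
  rewrite /upd; case: (y =P x) => [_|/eqP hyx]; first exact: hz (zone_self _).
  by apply: h; rewrite mem_filter hyx hy.
Qed.

Definition pub (c : chan) : Prop :=
  match c with Fr _ | Ev _ => True | _ => False end.

(** These are the paths that [den] gives to the two components of a parallel composition at the
    root, so [side] collects what each component may know; both know public channels only. *)
Definition side_path (sd : bool) : seq nat := [:: if sd then 1 else 2]%N.

Definition side (sd : bool) (c : chan) : Prop :=
  match c with
  | Fr _ | Ev _ => True
  | In b _ => b = sd
  | Pv _ => zone (side_path sd) c
  end.

Lemma side_pub c : side true c -> side false c -> pub c.
Proof. by case: c => //= [b n -> //|s /zone_disj]. Qed.

Lemma only_side sd P : only (side sd) (den P Fr (side_path sd)).
Proof. by apply: only_den => // c [t ->]; exists t. Qed.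

(* A weak trace of one side: visible actions on public channels, with object
   [Ev n] for the n-th one, interleaved with internal communications. *)
Inductive wrun (sd : bool) :
  nat -> nat -> proc K -> seq (chan * pol) -> proc K -> Prop :=
| w_nil m n p : wrun sd m n p [::] p
| w_tau m n p g t q : tau p g -> wrun sd m.+1 n (g (In sd m)) t q -> wrun sd m n p t q
| w_vis m n p u e g t q : pub u -> vis p u e g -> wrun sd m n.+1 (g (Ev n)) t q ->
    wrun sd m n p ((u, e) :: t) q.

(** Internal steps of the left, internal steps of the right and communications are numbered by
    separate counters. The channels of one side then do not depend on how its steps interleave with
    those of the other, and a run splits into two words. *)
Inductive crun : nat -> nat -> nat -> proc K -> proc K -> proc K -> proc K -> Prop :=
| c_nil ml mr n p r : crun ml mr n p r p r
| c_l ml mr n p r g p' r' : tau p g -> crun ml.+1 mr n (g (In true ml)) r p' r' ->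
    crun ml mr n p r p' r'
| c_r ml mr n p r g p' r' : tau r g -> crun ml mr.+1 n p (g (In false mr)) p' r' ->
    crun ml mr n p r p' r'
| c_c ml mr n p r u e g h p' r' : vis p u e g -> vis r u (~~ e) h ->
    crun ml mr n.+1 (g (Ev n)) (h (Ev n)) p' r' -> crun ml mr n p r p' r'.

Definition dual (t : seq (chan * pol)) : seq (chan * pol) :=
  [seq (a.1, ~~ a.2) | a <- t].

Lemma crun_wrun ml mr n p r p' r' : crun ml mr n p r p' r' ->
  only (side true) p -> only (side false) r ->
  exists t, wrun true ml n p t p' /\ wrun false mr n r (dual t) r'.
Proof.
elim=> {ml mr n p r p' r'}.
- by move=> ml mr n p r _ _; exists [::]; split; apply: w_nil.
- move=> ml mr n p r g p' r' ht _ IH hp hr.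
  have [t [h1 h2]] := IH (only_tau hp ht (erefl : side true (In true ml))) hr.
  by exists t; split=> //; apply: w_tau ht h1.
- move=> ml mr n p r g p' r' ht _ IH hp hr.
  have [t [h1 h2]] := IH hp (only_tau hr ht (erefl : side false (In false mr))).
  by exists t; split=> //; apply: w_tau ht h2.
- move=> ml mr n p r u e g h p' r' hg hh _ IH hp hr.
  have [hu1 hp'] := only_vis hp hg; have [hu2 hr'] := only_vis hr hh.
  have [t [h1 h2]] := IH (hp' (Ev _) I) (hr' (Ev _) I).
  have hpub := side_pub hu1 hu2.
  by exists ((u, e) :: t); split; [apply: w_vis hpub hg h1|apply: w_vis hpub hh h2].
Qed.

(** The sides need to agree on visible actions only. In the interleaving built here, the right side
    delays its internal steps until the left reaches its next visible action or its end. *)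
Lemma wrun_crun ml mr n p r t p' r' :
  wrun true ml n p t p' -> wrun false mr n r (dual t) r' -> crun ml mr n p r p' r'.
Proof.
move=> h; elim: h mr r => {ml n p t p'}.
- move=> ml n p mr r; move ht: (dual [::]) => t h.
  elim: h ht => {mr n r t r'} //.
  + by move=> *; apply: c_nil.
  + by move=> mr n r g t r' hg _ IH /IH; apply: c_r hg.
- by move=> ml n p g t p' hg _ IH mr r /IH; apply: c_l hg.
- move=> ml n p u e g t p' _ hg _ IH mr r; move ht: (dual _) => t' h.
  elim: h IH ht hg => {mr n r t' r'} //.
  + by move=> mr n r h t' r' hh _ IH IH' ht hg; apply: c_r hh _; apply: IH.
  + move=> mr n r v d h t' r' _ hh hw _ IH [hv hd ht] hg; subst.
    by apply: c_c hg hh _; apply: IH.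
Qed.

Definition clean (V : chan -> Prop) (ml mr n : nat) : Prop :=
  (forall u, ~ V (Fr u)) /\ (forall i, (ml <= i)%N -> ~ V (In true i)) /\
  (forall i, (mr <= i)%N -> ~ V (In false i)) /\ (forall i, (n <= i)%N -> ~ V (Ev i)).

Lemma clean_good V ml mr n : clean V ml mr n -> good Fr V.
Proof. by case=> h _; split=> // u v []. Qed.

Lemma clean_l V ml mr n : clean V ml mr n -> clean (addc V (In true ml)) ml.+1 mr n.
Proof.
case=> h1 [h2 [h3 h4]]; split; first by move=> u [/h1|].
split; first by move=> i hi [/h2|[] hi']; [apply; apply: ltnW|rewrite hi' ltnn in hi].
by split=> i hi [|//]; [apply: h3|apply: h4].
Qed.

Lemma clean_r V ml mr n : clean V ml mr n -> clean (addc V (In false mr)) ml mr.+1 n.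
Proof.
case=> h1 [h2 [h3 h4]]; split; first by move=> u [/h1|].
split; first by move=> i hi [|//]; apply: h2.
split; last by move=> i hi [|//]; apply: h4.
by move=> i hi [/h3|[] hi']; [apply; apply: ltnW|rewrite hi' ltnn in hi].
Qed.

Lemma clean_c V ml mr n : clean V ml mr n -> clean (addc V (Ev n)) ml mr n.+1.
Proof.
case=> h1 [h2 [h3 h4]]; split; first by move=> u [/h1|].
split; first by move=> i hi [|//]; apply: h2.
split; first by move=> i hi [|//]; apply: h3.
by move=> i hi [/h4|[] hi']; [apply; apply: ltnW|rewrite hi' ltnn in hi].
Qed.

Lemma exec_crun E l E' : exec E l E' -> forall ml mr n p r V,
  denotes E Fr (PP true p r) V -> clean V ml mr n ->
  exists p' r' V', [/\ crun ml mr n p r p' r', denotes E' Fr (PP true p' r') V' & good Fr V'].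
Proof.
elim=> {E l E'}.
- move=> E ml mr n p r V hE hV; exists p, r, V; split=> //; first exact: c_nil.
  exact: clean_good hV.
- move=> E [//|i j] E1 l E2 _ hs _ IH ml mr n p r V hE hV.
  have [g [/tau_PP [[h hh ->]|[h hh ->]|[_ [u [e [g1 [g2 [h1 h2 ->]]]]]]] hr]] := step_sound hs hE.
  + have [p' [r' [V' [h1 h2 h3]]]] := IH _ _ _ _ _ _ (hr _ (proj1 (proj2 hV) ml (leqnn _))) (clean_l hV).
    by exists p', r', V'; split=> //; apply: c_l hh h1.
  + have [p' [r' [V' [h1 h2 h3]]]] := IH _ _ _ _ _ _ (hr _ (proj1 (proj2 (proj2 hV)) mr (leqnn _))) (clean_r hV).
    by exists p', r', V'; split=> //; apply: c_r hh h1.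
  + have [p' [r' [V' [h3 h4 h5]]]] := IH _ _ _ _ _ _ (hr _ (proj2 (proj2 (proj2 hV)) n (leqnn _))) (clean_c hV).
    by exists p', r', V'; split=> //; apply: c_c h1 h2 h3.
Qed.

Lemma crun_exec ml mr n p r p' r' : crun ml mr n p r p' r' -> forall E V,
  denotes E Fr (PP true p r) V -> clean V ml mr n ->
  exists l E' V', [/\ exec E l E', denotes E' Fr (PP true p' r') V' & good Fr V'].
Proof.
elim=> {ml mr n p r p' r'}.
- move=> ml mr n p r E V hE hV; exists [::], E, V; split=> //; first exact: e_nil.
  exact: clean_good hV.
- move=> ml mr n p r g p' r' ht _ IH E V hE hV.
  have [i [j [E1 [hs hr]]]] := tau_complete hE (clean_good hV) (tau_l _ _ ht).
  have [l [E' [V' [h1 h2 h3]]]] := IH _ _ (hr _ (proj1 (proj2 hV) ml (leqnn _))) (clean_l hV).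
  by exists (LInt i j :: l), E', V'; split=> //; apply: e_cons hs h1.
- move=> ml mr n p r g p' r' ht _ IH E V hE hV.
  have [i [j [E1 [hs hr]]]] := tau_complete hE (clean_good hV) (tau_r _ _ ht).
  have [l [E' [V' [h1 h2 h3]]]] := IH _ _ (hr _ (proj1 (proj2 (proj2 hV)) mr (leqnn _))) (clean_r hV).
  by exists (LInt i j :: l), E', V'; split=> //; apply: e_cons hs h1.
- move=> ml mr n p r u e g h p' r' hg hh _ IH E V hE hV.
  have [i [j [E1 [hs hr]]]] := tau_complete hE (clean_good hV) (tau_c hg hh).
  have [l [E' [V' [h1 h2 h3]]]] := IH _ _ (hr _ (proj2 (proj2 (proj2 hV)) n (leqnn _))) (clean_c hV).
  by exists (LInt i j :: l), E', V'; split=> //; apply: e_cons hs h1.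
Qed.

Definition offers p (u : chan) (e : pol) : Prop := exists g, vis p u e g.

Definition ends sd m p t q : Prop := wrun sd m 0 p t q /\ stuckp q.

Lemma wrun_only sd m n p t q : wrun sd m n p t q -> only (side sd) p -> only (side sd) q.
Proof.
elim=> {m n p t q} //.
- by move=> m n p g t q ht _ IH hp; apply: IH; apply: only_tau hp ht _ _.
- by move=> m n p u e g t q _ hg _ IH hp; apply: IH; apply: (only_vis hp hg).2.
Qed.

Lemma stuckp_PP q r : only (side true) q -> only (side false) r ->
  stuckp (PP true q r) <->
  [/\ stuckp q, stuckp r & forall u e, pub u -> offers q u e -> ~ offers r u (~~ e)].
Proof.
move=> hq hr; split=> [h|[h1 h2 h3] g /tau_PP [[h /h1 //]|[h /h2 //]|]].
- split=> [g hg|g hg|u e _ [g hg] [h' hh]].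
  + exact: h (tau_l _ _ hg).
  + exact: h (tau_r _ _ hg).
  + exact: h (tau_c hg hh).
- move=> [_ [u [e [g1 [g2 [hg1 hg2 _]]]]]].
  apply: (h3 u e); [|by exists g1|by exists g2].
  exact: side_pub (only_vis hq hg1).1 (only_vis hr hg2).1.
Qed.

Lemma clean_zone m m' : clean (zone [::]) m m' 0.
Proof. by split=> [u []//|]; split=> [i _ []//|]; split=> i _ []. Qed.

Lemma reaches_par_ends P R v : reaches (TPar P R) v ->
  exists t q r, [/\ ends true 0 (den P Fr (side_path true)) t q,
     ends false 0 (den R Fr (side_path false)) (dual t) r,
     (forall u e, pub u -> offers q u e -> ~ offers r u (~~ e)) & v = pval q * pval r].
Proof.
move=> [l [E [hex [hst <-]]]].
have [q [r [V' [hc hd hg]]]] := exec_crun hex (denotes_den (TPar P R) Fr [::]) (clean_zone 0 0).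
have [t [hw1 hw2]] := crun_wrun hc (only_side true P) (only_side false R).
move/(stuck_denotes hd hg): hst; rewrite stuckp_PP; last first.
- exact: wrun_only hw2 (only_side false R).
- exact: wrun_only hw1 (only_side true P).
- by case=> h1 h2 h3; exists t, q, r; split=> //; apply: denotes_state hd.
Qed.

Lemma ends_reaches_par P R m m' t q r :
  ends true m (den P Fr (side_path true)) t q ->
  ends false m' (den R Fr (side_path false)) (dual t) r ->
  (forall u e, pub u -> offers q u e -> ~ offers r u (~~ e)) ->
  reaches (TPar P R) (pval q * pval r).
Proof.
move=> [hw1 h1] [hw2 h2] h3.
have [l [E' [V' [hex hd hg]]]] :=
  crun_exec (wrun_crun hw1 hw2) (denotes_den (TPar P R) Fr [::]) (clean_zone m m').
exists l, E'; split=> //; split; last exact: denotes_state hd.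
apply/(stuck_denotes hd hg)/stuckp_PP; last by split.
- exact: wrun_only hw1 (only_side true P).
- exact: wrun_only hw2 (only_side false R).
Qed.

Definition seen (n : nat) (c : chan) : Prop := if c is Ev j then (j < n)%N else True.

(** The quantifier over all larger [S] matters: [only (seen n) p] alone would say nothing once [p]
    receives [Ev n], whereas here the set can grow with the channel received. *)
Definition fits n p : Prop := forall S, (forall c, seen n c -> S c) -> only S p.

Lemma seen_leq n m c : (n <= m)%N -> seen n c -> seen m c.
Proof. by case: c => //= j h1 h2; apply: leq_trans h2 h1. Qed.

Lemma fits_den P s : fits 0 (den P Fr s).
Proof. by move=> S h; apply: only_den => [u _|c [t ->]]; apply: h. Qed.

Lemma fits_offers n p u e : fits n p -> offers p u e -> seen n u.
Proof. by move=> h [g hg]; apply: (only_vis (h (seen n) _) hg).1. Qed.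

(** This is the causality of words: the subject of a letter is a free name or the object of an
    earlier letter. It makes the source of an event a predecessor in the trace built from the
    word. *)
Lemma wrun_fits sd m n p t q : wrun sd m n p t q -> fits n p ->
  fits (n + size t) q /\
  forall i d, (i < size t)%N -> seen (n + i) (nth d t i).1 /\ pub (nth d t i).1.
Proof.
elim=> {m n p t q}.
- by move=> m n p h; rewrite addn0.
- move=> m n p g t q ht _ IH hp; apply: IH => S hS.
  by apply: (only_tau (hp S hS) ht); apply: hS.
- move=> m n p u e g t q hu hg _ IH hp.
  have [|h1 h2] := IH.
    move=> S hS; apply: (only_vis (hp S _) hg).2; last by apply: hS => /=.
    by move=> c hc; apply: hS; apply: seen_leq hc.
  split; first by rewrite -addSnnS.
  move=> [|i] d /= hi; last by rewrite addnS -addSn; apply: h2.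
  rewrite addn0; split=> //; exact: (only_vis (hp (seen n) _) hg).1.
Qed.

(** * Finiteness of the set of words *)

Definition finite (A : Type) (S : A -> Prop) : Prop :=
  exists L, forall a, S a <-> List.In a L.

Lemma finite_iff (A : Type) (S S' : A -> Prop) :
  (forall a, S a <-> S' a) -> finite S -> finite S'.
Proof. by move=> h [L hL]; exists L => a; rewrite -h. Qed.

Lemma finite_sing (A : Type) (C : Prop) (x : A) : finite (fun a => C /\ a = x).
Proof.
case: (classic C) => hC; last by exists [::] => a; split=> // -[].
by exists [:: x] => a; split=> [[_ ->]|[<-|//]]; [left|].
Qed.

Lemma finite_or (A : Type) (S S' : A -> Prop) :
  finite S -> finite S' -> finite (fun a => S a \/ S' a).
Proof. by move=> [L h] [L' h']; exists (L ++ L') => a; rewrite In_cat h h'. Qed.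

Lemma finite_bind (A B : Type) (S : A -> Prop) (F : A -> B -> Prop) :
  finite S -> (forall a, S a -> finite (F a)) -> finite (fun b => exists2 a, S a & F a b).
Proof.
move=> [L hL] hF.
have {}hF a : List.In a L -> finite (F a) by move=> h; apply: hF; apply/hL.
suff: finite (fun b => exists2 a, List.In a L & F a b).
  by apply: finite_iff => b; split=> -[a ha hb]; exists a => //; apply/hL.
elim: L hF {hL} => [|a L IH] hF; first by exists [::] => b; split=> // -[].
have h1 := hF a (or_introl erefl).
have h2 := IH (fun a' h => hF a' (or_intror h)).
apply: finite_iff (finite_or h1 h2) => b; split.
  by case=> [h|[a' ha' hb]]; [exists a => //; left|exists a' => //; right].
by case=> a' [<-|ha'] hb; [left|right; exists a'].
Qed.

Lemma finite_map (A B : Type) (S : A -> Prop) (f : A -> B) :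
  finite S -> finite (fun b => exists2 a, S a & b = f a).
Proof.
move=> h; apply: finite_bind h _ => a _.
by apply: finite_iff (finite_sing True (f a)) => b; split=> [[]|].
Qed.

Lemma finite_vis p : finite (fun x => vis p x.1.1 x.1.2 x.2).
Proof.
elim: p => [k|u e f _|b p IHp q IHq].
- by exists [::] => -[[u e] g]; split=> // /vis_PC.
- apply: finite_iff (finite_sing True (u, e, f)) => -[[v d] g] /=; split.
    by move=> [_ [-> -> ->]]; apply: vis_act.
  by move=> /vis_PAct [-> -> ->].
- have h1 := finite_map (fun x => (x.1, fun c => PP b (x.2 c) q)) IHp.
  have h2 := finite_map (fun x => (x.1, fun c => PP b p (x.2 c))) IHq.
  apply: finite_iff (finite_or h1 h2) => -[[v d] g] /=; split.
    case=> -[[[v' d'] g'] /= h [-> -> ->]]; [exact: vis_l|exact: vis_r].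
  by case/vis_PP => -[h hh ->]; [left|right]; exists (v, d, h).
Qed.

Lemma finite_tau p : finite (tau p).
Proof.
elim: p => [k|u e f _|b p IHp q IHq].
- by exists [::] => g; split=> // /tau_PC.
- by exists [::] => g; split=> // /tau_PAct.
- have h1 := finite_map (fun g c => PP b (g c) q) IHp.
  have h2 := finite_map (fun g c => PP b p (g c)) IHq.
  have h3 : finite (fun g => exists2 x, vis p x.1.1 x.1.2 x.2 &
      exists2 y, vis q y.1.1 y.1.2 y.2 &
      (b /\ x.1.1 = y.1.1 /\ y.1.2 = ~~ x.1.2) /\ g = fun c => PP b (x.2 c) (y.2 c)).
    apply: finite_bind (finite_vis p) _ => x _.
    apply: finite_bind (finite_vis q) _ => y _; exact: finite_sing.
  apply: finite_iff (finite_or h1 (finite_or h2 h3)) => g; split.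
    case=> [[h hh ->]|[[h hh ->]|]]; [exact: tau_l|exact: tau_r|].
    case=> [[[u e] g1] /= hg1] [[[v d] g2] /= hg2] [[hb [huv hd]] ->].
    rewrite -huv hd in hg2; rewrite hb; exact: tau_c hg1 hg2.
  case/tau_PP => [[h hh ->]|[h hh ->]|[hb [u [e [g1 [g2 [hg1 hg2 ->]]]]]]].
  + by left; exists h.
  + by right; left; exists h.
  + by right; right; exists (u, e, g1) => //; exists (u, ~~ e, g2).
Qed.

(** The number of prefixes, as a relation: a continuation is a function on infinitely many channels,
    and its size has to be the same for all of them. *)
Inductive proc_size : proc K -> nat -> Prop :=
| sz_PC k : proc_size (PC k) 0
| sz_PAct u e f n : (forall c, proc_size (f c) n) -> proc_size (PAct u e f) n.+1
| sz_PP b p q m n : proc_size p m -> proc_size q n -> proc_size (PP b p q) (m + n).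

Lemma proc_size_den P rho s : proc_size (den P rho s) (size (poss P)).
Proof.
elim: P rho s => //= [k|u e x P IH|P IH|P IH Q IHQ|P IH Q IHQ] rho s.
- exact: sz_PC.
- by rewrite size_map; apply: sz_PAct.
- by rewrite size_map.
- by rewrite size_cat !size_map; apply: sz_PP.
- by rewrite size_cat !size_map; apply: sz_PP.
Qed.

Lemma proc_size_vis p u e g n : vis p u e g -> proc_size p n ->
  exists2 m, n = m.+1 & forall c, proc_size (g c) m.
Proof.
move=> h; elim: h n => {p u e g}.
- by move=> u e f n hn; inversion hn; subst; eexists; eauto.
- move=> b p q u e g _ IH n hn; inversion hn; subst.
  have [m' -> h] := IH _ H3; exists (m' + n0)%N => // c; exact: sz_PP.
- move=> b p q u e g _ IH n hn; inversion hn; subst.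
  have [m' -> h] := IH _ H4; exists (m + m')%N => [|c]; [exact: addnS|exact: sz_PP].
Qed.

Lemma proc_size_tau p g n : tau p g -> proc_size p n ->
  exists2 m, (m < n)%N & forall c, proc_size (g c) m.
Proof.
move=> h; elim: h n => {p g}.
- move=> b p q g _ IH n hn; inversion hn; subst.
  have [m' hm h] := IH _ H3; exists (m' + n0)%N => [|c]; [by rewrite ltn_add2r|exact: sz_PP].
- move=> b p q g _ IH n hn; inversion hn; subst.
  have [m' hm h] := IH _ H4; exists (m + m')%N => [|c]; [by rewrite ltn_add2l|exact: sz_PP].
- move=> p q u e g h hg hh n hn; inversion hn; subst.
  have [m1 -> h1] := proc_size_vis hg H3; have [m2 -> h2] := proc_size_vis hh H4.
  exists (m1 + m2)%N => [|c]; [by rewrite addSn addnS ltnS leqnSn|exact: sz_PP].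
Qed.

Lemma finite_wrun sd m n p k : proc_size p k -> finite (fun x => wrun sd m n p x.1 x.2).
Proof.
have [N] := ubnP k; elim: N k m n p => // N IH k m n p hk hp.
have h1 := finite_sing True ([::] : seq (chan * pol), p).
have h2 : finite (fun x => exists2 g, tau p g & wrun sd m.+1 n (g (In sd m)) x.1 x.2).
  apply: finite_bind (finite_tau p) _ => g hg.
  have [k' hk' hs] := proc_size_tau hg hp.
  by apply: IH (hs _); rewrite ltnS in hk; apply: leq_trans hk' hk.
have h3 : finite (fun y => exists2 a, vis p a.1.1 a.1.2 a.2 &
    exists2 x, wrun sd m n.+1 (a.2 (Ev n)) x.1 x.2 & pub a.1.1 /\ y = (a.1 :: x.1, x.2)).
  apply: finite_bind (finite_vis p) _ => -[[u e] g] /= hg.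
  have [k' hk' hs] := proc_size_vis hg hp.
  apply: finite_bind (IH k' _ _ _ _ (hs _)) _; first by rewrite hk' ltnS in hk.
  by move=> x _; apply: finite_sing.
apply: finite_iff (finite_or h1 (finite_or h2 h3)) => -[t q] /=; split.
  case=> [[_ [-> ->]]|[[g hg hw]|[[[u e] g] /= hg [[t' q'] /= hw [hu [-> ->]]]]]].
  - exact: w_nil.
  - exact: w_tau hg hw.
  - exact: w_vis hu hg hw.
move=> hw; inversion hw; subst.
- by left.
- by right; left; exists g.
- by right; right; exists (u, e, g) => //; exists (t0, q).
Qed.
End Runs.

(** * Linear actions *)

Section Linear.
Variable K : comPzSemiRingType.
Implicit Types P Q R E : term K.
Implicit Types p q r : proc K.
(** The syntactic mark of failure: a constant 0 outside every prefix, which no later transition can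
    remove. *)
Fixpoint zero p : Prop :=
  match p with
  | PC k => k = 0
  | PAct _ _ _ => False
  | PP _ p q => zero p \/ zero q
  end.

Lemma zero_pval p : zero p -> pval p = 0.
Proof.
elim: p => //= b p IHp q IHq [/IHp ->|/IHq ->]; [exact: mul0r|exact: mulr0].
Qed.

Lemma zero_vis p u e g : zero p -> vis p u e g -> forall c, zero (g c).
Proof.
move=> h hv; elim: hv h => {p u e g} //=.
- by move=> b p q u e g _ IH [/IH h c|h c]; [left|right].
- by move=> b p q u e g _ IH [h c|/IH h c]; [left|right].
Qed.

Lemma zero_tau p g : zero p -> tau p g -> forall c, zero (g c).
Proof.
move=> h hv; elim: hv h => {p g} //=.
- by move=> b p q g _ IH [/IH h c|h c]; [left|right].
- by move=> b p q g _ IH [h c|/IH h c]; [left|right].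
- by move=> p q u e g h hg hh [h0|h0] c; [left; apply: zero_vis h0 hg c|right; apply: zero_vis h0 hh c].
Qed.

Lemma zero_wrun sd m n p t q : wrun sd m n p t q -> zero p -> zero q.
Proof.
elim=> {m n p t q} //.
- by move=> m n p g t q hg _ IH hp; apply: IH; apply: zero_tau hp hg _.
- by move=> m n p u e g t q _ hg _ IH hp; apply: IH; apply: zero_vis hp hg _.
Qed.

(* [Lin u e F] is a pending linear action and [Ina u e] an inaction [u^e.0]. *)
Inductive atom : Type :=
| Lin of chan & pol & (chan -> seq atom)
| Ina of chan & pol.

Definition is_ina (a : atom) : bool := if a is Ina _ _ then true else false.

Definition wait W (b : K) : proc K := PAct W true (fun=> PC b).

(* [impls D L p]: up to the private signals in [D], [p] is a [∥]-product of the
   atoms in [L]; the last three clauses are the stages of a linear action: not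
   fired, fired, and with its failure branch discarded. *)
Inductive impls (D : chan -> Prop) : seq atom -> proc K -> Prop :=
| im_nil : impls D [::] (PC 1)
| im_par L1 L2 p q : impls D L1 p -> impls D L2 q -> impls D (L1 ++ L2) (PP false p q)
| im_ina u e : impls D [:: Ina u e] (PAct u e (fun=> PC 0))
| im_lin u e F f W : D W -> u <> W ->
    (forall c, c <> W -> only (fun d => d <> W) (f c)) ->
    (forall c, ~ D c -> impls D (F c) (f c)) ->
    impls D [:: Lin u e F] (PP true (PAct u e (fun c => PP true (f c) (wait W 1)))
                                    (PP true (wait W 0) (PAct W false (fun=> PC 1))))
| im_fired L p W : D W -> only (fun d => d <> W) p -> impls D L p ->
    impls D L (PP true (PP true p (wait W 1)) (PP true (wait W 0) (PAct W false (fun=> PC 1))))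
| im_done L p W : D W -> only (fun d => d <> W) p -> impls D L p ->
    impls D L (PP true (PP true p (PC 1)) (PP true (wait W 0) (PC 1))).

Lemma vis_wait W k u e g : vis (wait W k) u e g -> u = W /\ e = true.
Proof. by move=> /vis_PAct [-> -> _]. Qed.

(** Atoms composed by [PP false] do not communicate, so the only communications are those on a
    signal [W], with its single emitter. If [wait W 0] answers, a 0 is exposed; if the action has
    fired and [wait W 1] answers, the stage becomes [im_done]. *)
Lemma impls_tau D L p g c : impls D L p -> tau p g -> ~ D c ->
  zero (g c) \/ impls D L (g c).
Proof.
move=> h ht hc; elim: h g ht => {L p}.
- by move=> g /tau_PC.
- move=> L1 L2 p q h1 IH1 h2 IH2 g /tau_PP [[h /IH1 [hz|hi] ->]|[h /IH2 [hz|hi] ->]|[//]].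
  + by left; left.
  + by right; apply: im_par.
  + by left; right.
  + by right; apply: im_par.
- by move=> u e g /tau_PAct.
- move=> u e F f W hW hu ho hf _ g /tau_PP [[h /tau_PAct //]|[h h' ->]|].
  + case/tau_PP: h' => [[h' /tau_PAct //]|[h' /tau_PAct //]|[_ [v [d [g1 [g2 [h1 h2 ->]]]]]]].
    by left; right; left; move/vis_PAct: h1 => [_ _ ->].
  + move=> [_ [v [d [g1 [g2 [/vis_PAct [hv hd _] h2 _]]]]]].
    by case/vis_PP: h2 => -[h /vis_PAct [hvW _ _] _]; case: hu; rewrite -hv -hvW.
- move=> L p W hW ho hi IH g /tau_PP [[h /tau_PP [[h' hh' ->] ->|[h' /tau_PAct //]|]]|[h h' ->]|].
  + case: (IH _ hh') => [hz|hi']; first by left; left; left.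
    right; apply: im_fired => //; apply: only_tau ho hh' _ _ => hcW.
    by apply: hc; rewrite hcW.
  + move=> [_ [v [d [g1 [g2 [h1 /vis_wait [hv _] _]]]]]] _.
    by case: (only_vis ho h1).
  + case/tau_PP: h' => [[h' /tau_PAct //]|[h' /tau_PAct //]|[_ [v [d [g1 [g2 [h1 h2 ->]]]]]]].
    by left; right; left; move/vis_PAct: h1 => [_ _ ->].
  + move=> [_ [v [d [g1 [g2 [h1 h2 ->]]]]]].
    have hvW : v = W by case/vis_PP: h2 => -[h /vis_PAct [-> _ _] _].
    case/vis_PP: h1 => [[h hh _]|[h hh ->]]; first by case: (only_vis ho hh).
    have [_ hd] := vis_wait hh; move/vis_PAct: hh => [_ _ ->].
    case/vis_PP: h2 => -[h' /vis_PAct [_ hd' ->] ->]; first by rewrite hd in hd'.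
    by right; apply: im_done.
- move=> L p W hW ho hi IH g /tau_PP [[h /tau_PP [[h' hh' ->] ->|[h' /tau_PC //]|]]|[h h' ->]|].
  + case: (IH _ hh') => [hz|hi']; first by left; left; left.
    right; apply: im_done => //; apply: only_tau ho hh' _ _ => hcW.
    by apply: hc; rewrite hcW.
  + by move=> [_ [v [d [g1 [g2 [_ /vis_PC //]]]]]].
  + case/tau_PP: h' => [[h' /tau_PAct //]|[h' /tau_PC //]|].
    by move=> [_ [v [d [g1 [g2 [_ /vis_PC //]]]]]].
  + move=> [_ [v [d [g1 [g2 [h1 h2 ->]]]]]].
    have hvW : v = W by case/vis_PP: h2 => -[h]; [move=> /vis_PAct [-> _ _]|move=> /vis_PC].
    case/vis_PP: h1 => [[h hh _]|[h /vis_PC //]].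
    by case: (only_vis ho hh).
Qed.

Lemma impls_vis D L p u e g : impls D L p -> vis p u e g ->
  [\/ D u,
      exists L1 L2 F, L = L1 ++ Lin u e F :: L2 /\
        forall c, ~ D c -> impls D (L1 ++ F c ++ L2) (g c) |
      exists L1 L2, L = L1 ++ Ina u e :: L2 /\ forall c, zero (g c)].
Proof.
move=> h; elim: h u e g => {L p}.
- by move=> u e g /vis_PC.
- move=> L1 L2 p q h1 IH1 h2 IH2 u e g /vis_PP [[h /IH1 hh ->]|[h /IH2 hh ->]].
  + case: hh => [hD|[M1 [M2 [F [-> hF]]]]|[M1 [M2 [-> hz]]]]; [exact: Or31|apply: Or32|apply: Or33].
      exists M1, (M2 ++ L2), F; split; first by rewrite -catA.
      by move=> c hc; rewrite !catA -(catA M1); apply: im_par (hF c hc) h2.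
    by exists M1, (M2 ++ L2); split=> [|c]; [rewrite -catA|left].
  + case: hh => [hD|[M1 [M2 [F [-> hF]]]]|[M1 [M2 [-> hz]]]]; [exact: Or31|apply: Or32|apply: Or33].
      exists (L1 ++ M1), M2, F; split; first by rewrite -catA.
      by move=> c hc; rewrite -catA; apply: im_par h1 (hF c hc).
    by exists (L1 ++ M1), M2; split=> [|c]; [rewrite -catA|right].
- move=> u e v d g /vis_PAct [-> -> ->]; apply: Or33.
  by exists [::], [::].
- move=> u e F f W hW hu ho hf _ v d g /vis_PP [[h /vis_PAct [-> -> ->] ->]|[h hh _]].
    apply: Or32; exists [::], [::], F; split=> // c hc; rewrite cats0.
    by apply: im_fired => //; [apply: ho => hcW; apply: hc; rewrite hcW|apply: hf].
  by apply: Or31; case/vis_PP: hh => -[h' /vis_PAct [-> _ _] _].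
- move=> L p W hW ho hi IH v d g /vis_PP [[h hh ->]|[h hh _]]; last first.
    by apply: Or31; case/vis_PP: hh => -[h' /vis_PAct [-> _ _] _].
  case/vis_PP: hh => [[h' hh ->]|[h' /vis_PAct [-> _ _] _]]; last exact: Or31.
  case: (IH _ _ _ hh) => [hD|[M1 [M2 [F [-> hF]]]]|[M1 [M2 [-> hz]]]]; [exact: Or31|apply: Or32|apply: Or33].
    exists M1, M2, F; split=> // c hc; apply: im_fired (hF c hc) => //.
    by apply: (only_vis ho hh).2 => hcW; apply: hc; rewrite hcW.
  by exists M1, M2; split=> // c; left; left.
- move=> L p W hW ho hi IH v d g /vis_PP [[h hh ->]|[h hh _]]; last first.
    by apply: Or31; case/vis_PP: hh => -[h' hh' _]; [case/vis_PAct: hh' => ->|case/vis_PC: hh'].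
  case/vis_PP: hh => [[h' hh ->]|[h' /vis_PC //]].
  case: (IH _ _ _ hh) => [hD|[M1 [M2 [F [-> hF]]]]|[M1 [M2 [-> hz]]]]; [exact: Or31|apply: Or32|apply: Or33].
    exists M1, M2, F; split=> // c hc; apply: im_done (hF c hc) => //.
    by apply: (only_vis ho hh).2 => hcW; apply: hc; rewrite hcW.
  by exists M1, M2; split=> // c; left; left.
Qed.

(** A linear action that has not fired, or whose signal is unspent, can always let its failure
    branch take the signal. So a stuck process has only inactions and spent signals left, all of
    state 1. *)
Lemma impls_stuck D L p : impls D L p -> stuckp p -> all is_ina L /\ pval p = 1.
Proof.
elim=> {L p}.
- by [].
- move=> L1 L2 p q _ IH1 _ IH2 h; rewrite all_cat /=.
  have [|-> ->] := IH1; first by move=> g hg; apply: h (tau_l _ _ hg).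
  have [|-> ->] := IH2; first by move=> g hg; apply: h (tau_r _ _ hg).
  by rewrite mulr1.
- by [].
- move=> u e F f W hW hu ho _ _ h; case: (h (fun c => PP true
     (PAct u e (fun c => PP true (f c) (wait W 1))) (PP true (PC 0) (PC 1)))).
  apply: tau_r; exact: tau_c (vis_act _ _ _) (vis_act _ _ _).
- move=> L p W hW ho hi IH h; case: (h (fun c => PP true
     (PP true p (wait W 1)) (PP true (PC 0) (PC 1)))).
  apply: tau_r; exact: tau_c (vis_act _ _ _) (vis_act _ _ _).
- move=> L p W hW ho hi IH h /=; rewrite !mulr1; apply: IH => g hg.
  by apply: h; apply: tau_l (tau_l _ _ hg).
Qed.

Lemma impls_lin_vis D L1 u e F L2 p : impls D (L1 ++ Lin u e F :: L2) p ->
  exists2 g, vis p u e g & forall c, ~ D c -> impls D (L1 ++ F c ++ L2) (g c).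
Proof.
move hL: (L1 ++ _) => L h; elim: h L1 L2 hL => {L p}.
- by case.
- move=> M1 M2 p q h1 IH1 h2 IH2 L1 L2 hL.
  have [[M hM]|[M hM]] : (exists M, M1 = L1 ++ Lin u e F :: M) \/ (exists M, L1 = M1 ++ M).
    elim: M1 L1 hL {h1 IH1} => [|a M1 IH] [|b L1] /=.
    + by move=> _; right; exists [::].
    + by move=> _; right; exists (b :: L1).
    + by case=> <- hL; left; exists M1.
    + by case=> -> /IH [[M ->]|[M ->]]; [left|right]; exists M.
  + have [g hg hi] := IH1 _ _ (esym hM).
    exists (fun c => PP false (g c) q); first exact: vis_l.
    move=> c hc; move: hL; rewrite hM -catA => /(congr1 (drop (size L1))).
    rewrite !drop_size_cat // => -[->].
    by rewrite !catA -(catA L1); apply: im_par (hi c hc) h2.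
  + move: hL; rewrite hM -catA => /(congr1 (drop (size M1))); rewrite !drop_size_cat // => hL.
    have [g hg hi] := IH2 _ _ hL.
    exists (fun c => PP false p (g c)); first exact: vis_r.
    by move=> c hc; rewrite -catA; apply: im_par h1 (hi c hc).
- by move=> v d [|? []].
- move=> v d F' f W hW hu ho hf _ [|? []] //= L2 [-> -> -> ->].
  eexists; first by apply: vis_l; apply: vis_act.
  move=> c hc; rewrite cats0; apply: im_fired => //; last exact: hf.
  by apply: ho => hcW; apply: hc; rewrite hcW.
- move=> L p W hW ho _ IH L1 L2 /IH [g hg hi].
  eexists; first by apply: vis_l; apply: vis_l hg.
  move=> c hc; apply: im_fired (hi c hc) => //.
  by apply: (only_vis ho hg).2 => hcW; apply: hc; rewrite hcW.
- move=> L p W hW ho _ IH L1 L2 /IH [g hg hi].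
  eexists; first by apply: vis_l; apply: vis_l hg.
  move=> c hc; apply: im_done (hi c hc) => //.
  by apply: (only_vis ho hg).2 => hcW; apply: hc; rewrite hcW.
Qed.

Lemma impls_ina_offers D L u e p : impls D L p -> List.In (Ina u e) L -> offers p u e.
Proof.
elim=> {L p} //=.
- move=> L1 L2 p q _ IH1 _ IH2 /In_cat [/IH1|/IH2] [g hg].
    by exists (fun c => PP false (g c) q); apply: vis_l.
  by exists (fun c => PP false p (g c)); apply: vis_r.
- by move=> v d [[-> ->]|//]; eexists; apply: vis_act.
- by move=> v d F f W _ _ _ _ _ [|].
- by move=> L p W _ _ _ IH /IH [g hg]; eexists; apply: vis_l; apply: vis_l hg.
- by move=> L p W _ _ _ IH /IH [g hg]; eexists; apply: vis_l; apply: vis_l hg.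
Qed.

(** When only inactions remain, each unspent signal can still be sent to its success branch, which
    keeps the process away from 0. *)
Lemma impls_progress D L p : impls D L p -> all is_ina L ->
  stuckp p \/ exists2 g, tau p g & forall c, ~ D c -> impls D L (g c).
Proof.
elim=> {L p}.
- by move=> _; left=> g /tau_PC.
- move=> L1 L2 p q h1 IH1 h2 IH2; rewrite all_cat => /andP[/IH1 hp /IH2 hq].
  case: hp => [hp|[g hg hi]]; last first.
    by right; eexists; [apply: tau_l hg|move=> c hc; apply: im_par (hi c hc) h2].
  case: hq => [hq|[g hg hi]]; last first.
    by right; eexists; [apply: tau_r hg|move=> c hc; apply: im_par h1 (hi c hc)].
  by left=> g /tau_PP [[h /hp]|[h /hq]|[]].
- by move=> u e _; left=> g /tau_PAct.
- by [].
- move=> L p W hW ho hi IH hL; right; eexists.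
    by apply: tau_c; [apply: vis_r; apply: vis_act|apply: vis_r; apply: vis_act].
  by move=> c hc; apply: im_done.
- move=> L p W hW ho hi IH /IH [hp|[g hg hi']]; last first.
    right; eexists; first by apply: tau_l; apply: tau_l hg.
    move=> c hc; apply: im_done (hi' c hc) => //.
    by apply: only_tau ho hg _ _ => hcW; apply: hc; rewrite hcW.
  left=> g /tau_PP [[h /tau_PP [[h' /hp //]|[h' /tau_PC //]|]]|[h h' _]|].
  + by move=> [_ [v [d [g1 [g2 [_ /vis_PC //]]]]]].
  + case/tau_PP: h' => [[h' /tau_PAct //]|[h' /tau_PC //]|].
    by move=> [_ [v [d [g1 [g2 [_ /vis_PC //]]]]]].
  + move=> [_ [v [d [g1 [g2 [h1 h2 _]]]]]].
    have hvW : v = W by case/vis_PP: h2 => -[h]; [move=> /vis_PAct [-> _ _]|move=> /vis_PC].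
    case/vis_PP: h1 => [[h hh _]|[h /vis_PC //]].
    by case: (only_vis ho hh).
Qed.
End Linear.

(** * Runs of the implementation of a totally ordered trace *)

Section Tokens.
Variable T : trace.
Local Notation n := (tn T).
Local Notation ev := 'I_(tn T).
Hypothesis hle : forall a b, tle T a b = (a <= b)%N.
Hypothesis hsrc : forall a b, tsrc T b = inr a -> (a < b)%N.

Variables X Y : ev -> ev -> chan.

Definition src_chan (b : ev) : chan :=
  match tsrc T b with inl u => Fr u | inr j => Ev j end.

Lemma tltE (a b : ev) : tlt a b = (a < b)%N.
Proof. by rewrite /tlt hle ltn_neqAle andbC. Qed.

Definition below (b : ev) : seq ev := [seq a <- enum 'I_n | tlt a b].

Definition receive (d : ev) (x : atom) (rs : seq ev) : atom :=
  foldr (fun a x => Lin (X a d) true (fun=> [:: x])) x rs.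

(** The fuel mirrors that of [A]. The value at fuel 0 is a dummy: [n <= f + b] holds wherever the
    function is used, and [b < n]. *)
Fixpoint act_atom (f : nat) (b : ev) (kappa : chan) : atom :=
  match f with
  | 0 => Ina kappa true
  | f.+1 => Lin kappa (tpol T b) (fun c =>
      [seq Lin (Y b d) false (fun=> [::]) | d <- enum 'I_n & tlt b d] ++
      [seq receive d (act_atom f d c) (below d) | d <- enum 'I_n & tsrc T d == inr b] ++
      [seq Ina c p.1 | p <- tN T & p.2 == inr b])
  end.

(* What is pending on the event side: [LT f b kappa rs] is the event [b] still
   waiting for the signals of [rs], [LY a d] the notification from [a] to [d],
   and [LI kappa e] an inaction. *)
Inductive ecode : Type :=
| LT of nat & ev & chan & seq ev
| LY of ev & ev
| LI of chan & pol.

(* The relay from [a] to [b] waits for [a] ([SY]) or is ready to release [b] ([SX]). *)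
Inductive scode : Type :=
| SY of ev & ev
| SX of ev & ev.

Definition eatom (x : ecode) : atom :=
  match x with
  | LT f b kappa rs => receive b (act_atom f b kappa) rs
  | LY a d => Lin (Y a d) false (fun=> [::])
  | LI kappa e => Ina kappa e
  end.

Definition satom (x : scode) : atom :=
  match x with
  | SY a b => Lin (Y a b) true (fun=> [:: Lin (X a b) false (fun=> [::])])
  | SX a b => Lin (X a b) false (fun=> [::])
  end.

Definition children (f : nat) (b : ev) (c : chan) : seq ecode :=
  [seq LY b d | d <- enum 'I_n & tlt b d] ++
  [seq LT f d c (below d) | d <- enum 'I_n & tsrc T d == inr b] ++
  [seq LI c p.1 | p <- tN T & p.2 == inr b].

Lemma act_atomS f b kappa :
  act_atom f.+1 b kappa = Lin kappa (tpol T b) (fun c => map eatom (children f b c)).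
Proof.
by rewrite /=; congr Lin; apply: functional_extensionality => c; rewrite !map_cat -!map_comp.
Qed.

(** Tokens of a pair [a], [b]: [cT] counts the exposed copies of [b], [cP] the signals from [a] that
    they still await, [cY] the notifications [a] has yet to deliver, [cSY] the relays waiting for
    [a], and [cSX] the relays ready to release [b]. *)
Definition cT (b : ev) (C : seq ecode) : nat :=
  sumn [seq if x is LT _ b' _ _ then (b' == b : nat) else 0%N | x <- C].
Definition cP (a b : ev) (C : seq ecode) : nat :=
  sumn [seq if x is LT _ b' _ rs then ((b' == b) * count_mem a rs)%N else 0%N | x <- C].
Definition cY (a d : ev) (C : seq ecode) : nat :=
  sumn [seq if x is LY a' d' then ((a' == a) && (d' == d) : nat) else 0%N | x <- C].
Definition cSY (a d : ev) (S : seq scode) : nat :=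
  sumn [seq if x is SY a' d' then ((a' == a) && (d' == d) : nat) else 0%N | x <- S].
Definition cSX (a d : ev) (S : seq scode) : nat :=
  sumn [seq if x is SX a' d' then ((a' == a) && (d' == d) : nat) else 0%N | x <- S].

(** An event with a source lies under the prefix of that source, so it is exposed only after the
    source has fired. *)
Definition enabled (k : nat) (b : ev) : bool :=
  match tsrc T b with inl _ => true | inr j => (j < k)%N end.

(* The first [k] events have happened.  Counting the tokens of each pair
   [a < b] makes causality and progress consequences of arithmetic. *)
Record token_inv (k : nat) (C : seq ecode) (S : seq scode) : Prop := Inv {
  inv_k : (k <= n)%N;
  inv_T : forall b, cT b C = (k <= b)%N && enabled k b;
  inv_Y : forall a b : ev, (a < b)%N -> cSY a b S = ((k <= a)%N + cY a b C)%N;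
  inv_P : forall a b : ev, (a < b)%N -> (cSY a b S + cSX a b S = cP a b C + ~~ enabled k b)%N;
  inv_LT : forall f b kappa rs, List.In (LT f b kappa rs) C ->
    (n <= f + b)%N /\ kappa = src_chan b /\ forall a, a \in rs -> (a < b)%N;
  inv_LY : forall a d, List.In (LY a d) C -> (a < d)%N;
  inv_S : forall x, List.In x S -> match x with SY a b | SX a b => (a < b)%N end;
  inv_LI : forall kappa e, List.In (LI kappa e) C <->
    exists j : ev, (e, inr j) \in tN T /\ (j < k)%N /\ kappa = Ev j
}.

Lemma cP_cT a b C : cT b C = 0%N -> cP a b C = 0%N.
Proof.
rewrite /cT /cP; elim: C => //= x C IH /eqP; rewrite addn_eq0 => /andP[/eqP hx /eqP /IH ->].
by rewrite addn0; case: x hx => //= f b' kappa rs; case: eqP.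
Qed.

Lemma sumn_filter_eq (s : seq ev) (P : pred ev) (g : ev -> nat) (b : ev) :
  uniq s -> b \in s -> (forall d, d != b -> g d = 0%N) ->
  sumn [seq g d | d <- s & P d] = (P b * g b)%N.
Proof.
move=> hu hb hg; elim: s hu hb => //= d s IH /andP[hd hu].
rewrite inE; case: (eqVneq b d) => [hbd _|hbd /= hb].
  rewrite -hbd in hd *; suff h0 : sumn [seq g d | d <- s & P d] = 0%N.
    by case: (P b) => /=; rewrite h0 ?addn0 ?mul1n.
  elim: s hd {IH hu} => //= c s IH; rewrite inE negb_or => /andP[hc /IH h].
  by case: (P c) => //=; rewrite h hg // eq_sym.
have hdb : d != b by rewrite eq_sym.
by case: (P d) => /=; rewrite IH // hg.
Qed.

Lemma sumn_const0 (A : Type) (s : seq A) (g : A -> nat) :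
  (forall x, g x = 0%N) -> sumn (map g s) = 0%N.
Proof. by move=> h; elim: s => //= x s ->; rewrite h. Qed.

Lemma cT_children b f b' c : cT b (children f b' c) = (tsrc T b == inr b').
Proof.
rewrite /cT /children !map_cat !sumn_cat -!map_comp.
rewrite [X in (X + _)%N](_ : _ = 0%N); last exact: sumn_const0.
rewrite [X in (_ + (_ + X))%N](_ : _ = 0%N); last exact: sumn_const0.
rewrite add0n addn0 (@sumn_filter_eq _ _ _ b) ?enum_uniq ?mem_enum //= ?eqxx ?muln1 //.
by move=> d /negbTE ->.
Qed.

Lemma below_uniq b : uniq (below b).
Proof. by rewrite filter_uniq ?enum_uniq. Qed.

Lemma mem_below a b : (a \in below b) = (a < b)%N.
Proof. by rewrite mem_filter mem_enum tltE andbT. Qed.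

Lemma cP_children (a b : ev) f b' c : (a < b)%N -> cP a b (children f b' c) = (tsrc T b == inr b').
Proof.
move=> hab; rewrite /cP /children !map_cat !sumn_cat -!map_comp.
rewrite [X in (X + _)%N](_ : _ = 0%N); last exact: sumn_const0.
rewrite [X in (_ + (_ + X))%N](_ : _ = 0%N); last exact: sumn_const0.
rewrite add0n addn0 (@sumn_filter_eq _ _ _ b) ?enum_uniq ?mem_enum //=.
  rewrite eqxx mul1n count_uniq_mem ?below_uniq //.
  by rewrite mem_below hab muln1.
by move=> d /negbTE ->.
Qed.

Lemma cY_children a d f b c : cY a d (children f b c) = (b == a) && (b < d)%N.
Proof.
rewrite /cY /children !map_cat !sumn_cat -!map_comp.
rewrite [X in (_ + (X + _))%N](_ : _ = 0%N); last exact: sumn_const0.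
rewrite [X in (_ + (_ + X))%N](_ : _ = 0%N); last exact: sumn_const0.
rewrite !addn0 (@sumn_filter_eq _ _ _ d) ?enum_uniq ?mem_enum //=.
  by rewrite eqxx andbT tltE; case: (b == a); case: (b < d)%N.
by move=> d' /negbTE ->; rewrite andbF.
Qed.

Lemma cT_cat b C1 C2 : cT b (C1 ++ C2) = (cT b C1 + cT b C2)%N.
Proof. by rewrite /cT map_cat sumn_cat. Qed.
Lemma cP_cat a b C1 C2 : cP a b (C1 ++ C2) = (cP a b C1 + cP a b C2)%N.
Proof. by rewrite /cP map_cat sumn_cat. Qed.
Lemma cY_cat a b C1 C2 : cY a b (C1 ++ C2) = (cY a b C1 + cY a b C2)%N.
Proof. by rewrite /cY map_cat sumn_cat. Qed.
Lemma cSY_cat a b C1 C2 : cSY a b (C1 ++ C2) = (cSY a b C1 + cSY a b C2)%N.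
Proof. by rewrite /cSY map_cat sumn_cat. Qed.
Lemma cSX_cat a b C1 C2 : cSX a b (C1 ++ C2) = (cSX a b C1 + cSX a b C2)%N.
Proof. by rewrite /cSX map_cat sumn_cat. Qed.

Lemma In_map_filter (A : eqType) (s : seq A) (P : pred A) (B : Type) (g : A -> B) y :
  List.In y [seq g x | x <- s & P x] <-> exists x, [/\ x \in s, P x & y = g x].
Proof.
elim: s => [|x s [IH1 IH2]] /=; first by split=> // -[x []].
split.
  case hx: (P x) => /=.
    case=> [<-|/IH1 [z [hz hz' ->]]]; first by exists x; rewrite mem_head.
    by exists z; rewrite inE hz orbT.
  by case/IH1 => z [hz hz' ->]; exists z; rewrite inE hz orbT.
move=> [z [hz hP hy]]; move: hz; rewrite inE => /orP[/eqP hzx|hz].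
  by rewrite -hzx hP; left.
have := IH2 (ex_intro _ z (And3 hz hP hy)).
by case: (P x) => //=; right.
Qed.

Lemma inv_fire k f b kappa C1 C2 S : token_inv k (C1 ++ LT f b kappa [::] :: C2) S ->
  exists f', [/\ f = f'.+1, b = k :> nat, kappa = src_chan b &
    token_inv k.+1 (C1 ++ children f' b (Ev k) ++ C2) S].
Proof.
move=> [hk hT hY hP hLT hLY hS hLI].
have [hf [hkap _]] : (n <= f + b)%N /\ kappa = src_chan b /\ forall a : ev, a \in [::] -> (a < b)%N.
  by apply: hLT; apply/In_cat; right; left.
have hTb := hT b; rewrite cT_cat /cT /= -/(cT b C2) -/(cT b C1) eqxx in hTb.
have hkb : (k <= b)%N by lia.
have hen : enabled k b by lia.
(* Suppose [k < b]. By [inv_Y] the relay from event [k] to [b] is still waiting, since [k] has not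
   fired. By [inv_P] no such relay is left, since [b] is exposed once and awaits nothing. *)
have hbk : b = k :> nat.
  apply/eqP; rewrite eqn_leq hkb andbT leqNgt; apply/negP => hlt.
  have hkn : (k < n)%N by apply: ltn_trans hlt (ltn_ord b).
  have h1 := hY (Ordinal hkn) b hlt; have h2 := hP (Ordinal hkn) b hlt.
  rewrite /= leqnn in h1; rewrite hen cP_cat /cP /= -/(cP _ b C2) -/(cP _ b C1) muln0 in h2.
  rewrite !cP_cT in h2; lia.
have hf0 : (0 < f)%N by have := ltn_ord b; lia.
exists f.-1; split=> //; first by rewrite prednK.
split.
- by rewrite -hbk.
- move=> b'; have := hT b'; rewrite !(cT_cat b' C1) (cT_cat b' (children _ _ _)) cT_children /cT /= -/(cT b' C2) -/(cT b' C1).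
  rewrite /enabled; case hs: (tsrc T b') => [u|j] /=.
    by rewrite -val_eqE /=; lia.
  have := hsrc hs; rewrite -val_eqE /= => hjb.
  have -> : (inr j == inr b :> name + ev) = (j == b :> nat) by [].
  lia.
- move=> a d had; have := hY a d had.
  rewrite !(cY_cat a d C1) (cY_cat a d (children _ _ _)) cY_children /cY /= -/(cY a d C2) -/(cY a d C1) -val_eqE /=; lia.
- move=> a d had; have := hP a d had.
  rewrite !(cP_cat a d C1) (cP_cat a d (children _ _ _)) cP_children // /cP /= -/(cP a d C2) -/(cP a d C1) muln0.
  rewrite /enabled; case hs: (tsrc T d) => [u|j] /=; first by lia.
  have -> : (inr j == inr b :> name + ev) = (j == b :> nat) by [].
  lia.
- move=> f0 b0 kap0 rs0 /In_cat [h|/In_cat [/In_cat [h|/In_cat [h|h]]|h]].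
  + by apply: hLT; apply/In_cat; left.
  + by case/In_map_filter: h => x [].
  + case/In_map_filter: h => d [_ /eqP hd [-> -> -> ->]]; split; first by have := hsrc hd; lia.
    split; first by rewrite /src_chan hd hbk.
    by move=> a; rewrite mem_below.
  + by case/In_map_filter: h => x [].
  + by apply: hLT; apply/In_cat; right; right.
- move=> a d /In_cat [h|/In_cat [/In_cat [h|/In_cat [h|h]]|h]].
  + by apply: hLY; apply/In_cat; left.
  + by case/In_map_filter: h => x [_]; rewrite tltE => hx [-> ->].
  + by case/In_map_filter: h => x [].
  + by case/In_map_filter: h => x [].
  + by apply: hLY; apply/In_cat; right; right.
- exact: hS.
- move=> kap e; split.
    move=> /In_cat [h|/In_cat [/In_cat [h|/In_cat [h|h]]|h]].
    + have [|j [h1 [h2 h3]]] := (hLI kap e).1; first by apply/In_cat; left.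
      by exists j; split=> //; split=> //; apply: ltnW.
    + by case/In_map_filter: h => x [].
    + by case/In_map_filter: h => x [].
    + case/In_map_filter: h => -[e' s] [h1 /eqP /= h2 [-> ->]].
      by exists b; rewrite -h2 h1 hbk ltnS leqnn.
    + have [|j [h1 [h2 h3]]] := (hLI kap e).1; first by apply/In_cat; right; right.
      by exists j; split=> //; split=> //; apply: ltnW.
  move=> [j [h1 [h2 h3]]]; rewrite ltnS leq_eqVlt in h2; case/orP: h2 => [/eqP hjk|hjk].
    apply/In_cat; right; apply/In_cat; left; do 2!(apply/In_cat; right).
    apply/In_map_filter; exists (e, inr j); rewrite h1 /= h3 hjk; split=> //.
    by apply/eqP; congr inr; apply: val_inj; rewrite /= hjk.
  have /In_cat [h|[//|h]] := (hLI kap e).2 (ex_intro _ j (conj h1 (conj hjk h3))).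
    by apply/In_cat; left.
  by apply/In_cat; right; apply/In_cat; right.
Qed.

Lemma inv_receive k f b kappa a rs C1 C2 S1 S2 :
  token_inv k (C1 ++ LT f b kappa (a :: rs) :: C2) (S1 ++ SX a b :: S2) ->
  token_inv k (C1 ++ LT f b kappa rs :: C2) (S1 ++ S2).
Proof.
move=> [hk hT hY hP hLT hLY hS hLI]; split=> //.
- by move=> b'; have := hT b'; rewrite !cT_cat.
- move=> a' d hab; have := hY a' d hab.
  by rewrite !cY_cat !cSY_cat /cY /cSY /= !add0n.
- move=> a' d hab; have := hP a' d hab.
  rewrite !cP_cat !cSY_cat !cSX_cat /cP /cSY /cSX /=.
  by case: (a == a'); case: (b == d) => /=; lia.
- move=> f0 b0 kap0 rs0 /In_cat [h|[[<- <- <- <-]|h]].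
  + by apply: hLT; apply/In_cat; left.
  + have [|h1 [h2 h3]] := hLT f b kappa (a :: rs); first by apply/In_cat; right; left.
    by split=> //; split=> // a' ha'; apply: h3; rewrite inE ha' orbT.
  + by apply: hLT; apply/In_cat; right; right.
- move=> a' d /In_cat [h|[//|h]]; apply: hLY; apply/In_cat; [by left|by right; right].
- by move=> x /In_cat [h|h]; apply: hS; apply/In_cat; [left|right; right].
- move=> kap e; rewrite -hLI; split=> /In_cat [h|[//|h]]; apply/In_cat.
  + by left.
  + by right; right.
  + by left.
  + by right; right.
Qed.

(** One notification and one waiting relay vanish together, and a ready relay replaces the waiting
    one: the difference in [inv_Y] and the sum in [inv_P] are unchanged. *)
Lemma inv_relay k a b C1 C2 S1 S2 :
  token_inv k (C1 ++ LY a b :: C2) (S1 ++ SY a b :: S2) ->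
  token_inv k (C1 ++ C2) (S1 ++ SX a b :: S2).
Proof.
move=> [hk hT hY hP hLT hLY hS hLI]; split=> //.
- by move=> b'; have := hT b'; rewrite !cT_cat.
- move=> a' d hab; have := hY a' d hab.
  rewrite !cY_cat !cSY_cat /cY /cSY /=.
  by case: (a == a'); case: (b == d) => /=; lia.
- move=> a' d hab; have := hP a' d hab.
  rewrite !cP_cat !cSY_cat !cSX_cat /cP /cSY /cSX /=.
  by case: (a == a'); case: (b == d) => /=; lia.
- by move=> f0 b0 kap0 rs0 /In_cat [h|h]; apply: hLT; apply/In_cat; [left|right; right].
- by move=> a' d /In_cat [h|h]; apply: hLY; apply/In_cat; [left|right; right].
- move=> x /In_cat [h|[<-|h]]; first by apply: hS; apply/In_cat; left.
    by apply: hLY; apply/In_cat; right; left.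
  by apply: hS; apply/In_cat; right; right.
- move=> kap e; rewrite -hLI; split=> /In_cat h; apply/In_cat.
  + by case: h => h; [left|right; right].
  + by case: h => [h|[//|h]]; [left|right].
Qed.

(** * Transitions of the states of the implementation *)

Variable K : comPzSemiRingType.
Implicit Types p q : proc K.
Variables D1 D2 D3 : chan -> Prop.
Hypothesis X_inj : forall a b a' b', X a b = X a' b' -> a = a' /\ b = b'.
Hypothesis Y_inj : forall a b a' b', Y a b = Y a' b' -> a = a' /\ b = b'.
Hypothesis X_priv : forall a b, [/\ ~ pub (X a b), ~ D1 (X a b) & ~ D2 (X a b)].
Hypothesis Y_priv : forall a b, [/\ ~ pub (Y a b), ~ D1 (Y a b) & ~ D2 (Y a b)].
Hypothesis D12 : forall c, D1 c -> ~ D2 c.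

Definition outside (c : chan) : Prop := [/\ ~ D1 c, ~ D2 c & ~ D3 c].
Hypothesis pub_outside : forall c, pub c -> outside c.

Definition free_inactions : seq atom :=
  [seq Ina (Fr (if x.2 is inl u then u else 0%N)) x.1 | x <- tN T & is_inl x.2].

(** The three components are the events, the relays and the inactions on free names, with private
    signals in [D1], [D2] and [D3]. Only events and relays may talk to each other. *)
Inductive impl_state (k : nat) : proc K -> Prop :=
| ImplState C S a s b : token_inv k C S ->
    impls D1 (map eatom C) a -> impls D2 (map satom S) s -> impls D3 free_inactions b ->
    impl_state k (PP false (PP true a s) b).

Lemma map_split (A B : Type) (f : A -> B) s L1 x L2 : map f s = L1 ++ x :: L2 ->
  exists s1 y s2, [/\ s = s1 ++ y :: s2, L1 = map f s1, x = f y & L2 = map f s2].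
Proof.
elim: s L1 => [|y s IH] [|z L1] //= [].
  by move=> <- <-; exists [::], y, s.
by move=> <- /IH [s1 [y' [s2 [-> -> -> ->]]]]; exists (y :: s1), y', s2.
Qed.

Lemma src_chan_pub b : pub (src_chan b).
Proof. by rewrite /src_chan; case: (tsrc T b). Qed.

Lemma free_inactions_Ina L1 u e F L2 : free_inactions <> L1 ++ Lin u e F :: L2.
Proof. by rewrite /free_inactions => h; have [s1 [y [s2 []]]] := map_split h. Qed.

Lemma satom_Lin x : exists u e F, satom x = Lin u e F /\ ~ pub u /\ ~ D1 u.
Proof.
case: x => a b /=; do 3!eexists; split; try by [].
  by case: (Y_priv a b).
by case: (X_priv a b).
Qed.

Lemma inv_LT_pos k C1 f b kappa rs C2 S : token_inv k (C1 ++ LT f b kappa rs :: C2) S ->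
  exists f', f = f'.+1 /\ kappa = src_chan b.
Proof.
move=> /inv_LT h; have [|h1 [h2 _]] := h f b kappa rs; first by apply/In_cat; right; left.
exists f.-1; split=> //; rewrite prednK //; have := ltn_ord b; lia.
Qed.

(** The subjects of events are public and those of relays are not, so a communication between the
    two sides is a release on some [X a b] or a notification on some [Y a b]; neither changes [k].
    All else is internal to one component or takes an inaction. *)
Lemma impl_tau k p g c : impl_state k p -> tau p g -> outside c ->
  zero (g c) \/ impl_state k (g c).
Proof.
case=> C S a s b hi ha hs hb /tau_PP [[h hh ->]|[h hh ->]|[//]] [hc1 hc2 hc3]; last first.
  case: (impls_tau hb hh hc3) => [hz|hb']; first by left; right.
  by right; apply: ImplState hi ha hs hb'.
case/tau_PP: hh => [[h' hh ->]|[h' hh ->]|[_ [u [e [g1 [g2 [hg1 hg2 ->]]]]]]].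
- case: (impls_tau ha hh hc1) => [hz|ha']; first by left; left; left.
  by right; apply: ImplState hi ha' hs hb.
- case: (impls_tau hs hh hc2) => [hz|hs']; first by left; left; right.
  by right; apply: ImplState hi ha hs' hb.
case: (impls_vis hs hg2) => [hu2|[M1 [M2 [G [hM hG]]]]|[M1 [M2 [hM hz]]]]; last first.
- by left; left; right.
- have [S1 [y [S2 [hS hM1 hy hM2]]]] := map_split hM.
  have [u' [e' [F' [hu' [hpub hu1]]]]] := satom_Lin y.
  rewrite -hy in hu'; case: hu' => huu _ _; rewrite -{}huu in hpub hu1.
  case: (impls_vis ha hg1) => [//|[L1 [L2 [F [hL hF]]]]|[L1 [L2 [hL hz]]]]; last by left; left; left.
  have [C1 [x [C2 [hC hL1 hx hL2]]]] := map_split hL.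
  right; have hFc := hF c hc1; have hGc := hG c hc2.
  rewrite hL1 hL2 in hFc; rewrite hM1 hM2 in hGc; rewrite {}hC {}hS in hi.
  case: x hx hi => [f b0 kappa [|a0 rs]|a0 d|kappa e0] hx hi //.
  + have [f' [hf hk]] := inv_LT_pos hi.
    move: hx; rewrite hf /= => -[huk _ _]; case: hpub; rewrite huk hk.
    exact: src_chan_pub.
  + case: hx => hu he hF0; rewrite hu he /= in hy.
    case: y hy hi => a1 b1 // [] hX hG0 hi.
    have [h1 h2] := X_inj hX; subst a1 b1.
    apply: (ImplState (inv_receive hi)) hb; last by rewrite map_cat; rewrite hG0 in hGc.
    by rewrite map_cat; rewrite hF0 in hFc.
  + case: hx => hu he hF0; rewrite hu he /= in hy.
    case: y hy hi => a1 b1 // [] hX hG0 hi.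
    have [h1 h2] := Y_inj hX; subst a1 b1.
    apply: (ImplState (inv_relay hi)) hb; last by rewrite map_cat; rewrite hG0 in hGc.
    by rewrite map_cat; rewrite hF0 in hFc.
- case: (impls_vis ha hg1) => [hu1|[L1 [L2 [F [hL hF]]]]|[L1 [L2 [hL hz]]]]; last by left; left; left.
    by case: (D12 hu1).
  have [C1 [x [C2 [hC hL1 hx hL2]]]] := map_split hL; rewrite hC in hi.
  case: x hx hi {hC} => [f b0 kappa [|a0 rs]|a0 d|kappa e0] hx hi //.
  + have [f' [hf hk]] := inv_LT_pos hi.
    move: hx; rewrite hf /= => -[huk _ _].
    by case: (pub_outside (src_chan_pub b0)) => _; rewrite -hk -huk.
  + by case: hx => hu _ _; case: (X_priv a0 b0) => _ _; rewrite -hu.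
  + by case: hx => hu _ _; case: (Y_priv a0 d) => _ _; rewrite -hu.
Qed.

(** A public action takes an inaction, and fails, or fires an exposed event, which [inv_fire]
    identifies as event [k]. Its object is [Ev k], as [src_chan] expects, because the stage equals
    the number of visible actions so far. *)
Lemma impl_vis k p u e g : impl_state k p -> vis p u e g -> pub u ->
  zero (g (Ev k)) \/
  exists b : ev, [/\ b = k :> nat, u = src_chan b, e = tpol T b & impl_state k.+1 (g (Ev k))].
Proof.
move=> hst hv hu; have [hu1 hu2 hu3] := pub_outside hu.
have [hc1 hc2 hc3] : outside (Ev k) by apply: pub_outside.
case: hst hv => C S a s b hi ha hs hb /vis_PP [[h hh ->]|[h hh ->]]; last first.
  case: (impls_vis hb hh) => [//|[L1 [L2 [F [hL _]]]]|[L1 [L2 [_ hz]]]]; last by left; right.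
  by case: (free_inactions_Ina hL).
case/vis_PP: hh => [[h' hh ->]|[h' hh ->]]; last first.
  case: (impls_vis hs hh) => [//|[L1 [L2 [F [hL _]]]]|[L1 [L2 [_ hz]]]]; last by left; left; right.
  have [S1 [y [S2 [_ _ hy _]]]] := map_split hL.
  have [u' [e' [F' [hu' [hpub _]]]]] := satom_Lin y.
  by rewrite -hy in hu'; case: hu' => huu _ _; rewrite -huu in hpub.
case: (impls_vis ha hh) => [//|[L1 [L2 [F [hL hF]]]]|[L1 [L2 [_ hz]]]]; last by left; left; left.
have [C1 [x [C2 [hC hL1 hx hL2]]]] := map_split hL; right.
have hFc := hF _ hc1; rewrite hL1 hL2 in hFc; rewrite {}hC in hi.
case: x hx hi => [f b0 kappa [|a0 rs]|a0 d|kappa e0] hx hi //.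
- have [f' [hf hbk hk hi']] := inv_fire hi.
  move: hx; rewrite /eatom hf act_atomS /= => -[huk he hF0].
  exists b0; split=> //; first by rewrite huk.
  apply: ImplState hi' _ hs hb.
  by rewrite hF0 in hFc; rewrite map_cat (map_cat eatom (children _ _ _)).
- by case: hx => hux _ _; case: (X_priv a0 b0) => + _ _; rewrite -hux.
- by case: hx => hux _ _; case: (Y_priv a0 d) => + _ _; rewrite -hux.
Qed.

(** The source of event [k] is smaller than [k], hence has fired, so [inv_T] counts one exposed
    copy. *)
Lemma inv_pending k C S : token_inv k C S -> (k < n)%N ->
  exists C1 f b kappa rs C2, C = C1 ++ LT f b kappa rs :: C2 /\ b = k :> nat.
Proof.
move=> hi hk; have := inv_T hi (Ordinal hk); rewrite /= leqnn.
have -> : enabled k (Ordinal hk).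
  by rewrite /enabled; case hs: (tsrc _ _) => [u|j] //; have := hsrc hs.
move=> hc.
have {hc} : cT (Ordinal hk) C != 0%N by rewrite hc.
elim: C {hi} => //= x C IH; rewrite /cT /= -/(cT _ C).
case: (eqVneq (cT (Ordinal hk) C) 0%N) => [->|/IH]; last first.
  by move=> [C1 [f [b [kap [rs [C2 [-> hb]]]]]]] _; exists (x :: C1), f, b, kap, rs, C2.
case: x => // f b kap rs; case: (b =P Ordinal hk) => // -> _.
by exists [::], f, (Ordinal hk), kap, rs, C.
Qed.

(** Stuck components hold only inactions, so no event is pending and [k = n] by [inv_pending];
    [inv_LI] then lists the inactions on objects of events. *)
Lemma impl_stuck k p : impl_state k p -> stuckp p ->
  [/\ k = n, pval p = 1 & forall u e, pub u ->
     (offers p u e <-> (exists2 v, (e, inl v) \in tN T & u = Fr v) \/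
                       exists2 j : ev, (e, inr j) \in tN T & u = Ev j)].
Proof.
case=> C S a s b hi ha hs hb hst.
have [|haC hva] := impls_stuck ha; first by move=> g hg; apply: hst (tau_l _ _ (tau_l _ _ hg)).
have [|haS hvs] := impls_stuck hs; first by move=> g hg; apply: hst (tau_l _ _ (tau_r _ _ hg)).
have [|haN hvb] := impls_stuck hb; first by move=> g hg; apply: hst (tau_r _ _ hg).
have hkn : k = n.
  apply/eqP; rewrite eqn_leq (inv_k hi) leqNgt; apply/negP => hk.
  have [C1 [f [b0 [kap [rs [C2 [hC _]]]]]]] := inv_pending hi hk.
  rewrite hC in hi haC; have [f' [hf _]] := inv_LT_pos hi.
  by move: haC; rewrite map_cat all_cat /= hf => /andP[_ /andP[]]; case: rs {hC hi}.
split=> //; first by rewrite /= hva hvs hvb !mulr1.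
move=> u e hu; have [hu1 hu2 hu3] := pub_outside hu; split.
- move=> [g /vis_PP [[h hh _]|[h hh _]]]; last first.
    case: (impls_vis hb hh) => [//|[L1 [L2 [F [hL _]]]]|[L1 [L2 [hL _]]]].
      by case: (free_inactions_Ina hL).
    have : List.In (Ina u e) free_inactions by rewrite hL; apply/In_cat; right; left.
    move=> /In_map_filter [[e' [v|j]] [hv //= _ [-> ->]]].
    by left; exists v.
  case/vis_PP: hh => [[h' hh _]|[h' hh _]]; last first.
    case: (impls_vis hs hh) => [//|[L1 [L2 [F [hL _]]]]|[L1 [L2 [hL _]]]].
      by rewrite hL all_cat /= andbF in haS.
    have [S1 [y [S2 [_ _ hy _]]]] := map_split hL.
    by have [u' [e' [F' [hu' _]]]] := satom_Lin y; rewrite -hy in hu'.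
  case: (impls_vis ha hh) => [//|[L1 [L2 [F [hL _]]]]|[L1 [L2 [hL _]]]].
    by rewrite hL all_cat /= andbF in haC.
  have [C1 [x [C2 [hC _ hx _]]]] := map_split hL; rewrite hC in hi.
  case: x hx hi {hC} => [f b0 kappa [|a0 rs]|a0 d|kappa e0] hx hi //.
    by have [f' [hf _]] := inv_LT_pos hi; move: hx; rewrite hf.
  case: hx => -> ->; have [|j [h1 [h2 h3]]] := (inv_LI hi kappa e0).1.
    by apply/In_cat; right; left.
  by right; exists j.
- case=> [[v hv ->]|[j hj ->]].
    have [|g hg] := @impls_ina_offers _ _ _ (Fr v) e _ hb.
      by apply/In_map_filter; exists (e, inl v).
    by eexists; apply: vis_r hg.
  have hIn : List.In (LI (Ev j) e) C.
    by apply/(inv_LI hi); exists j; rewrite hkn.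
  have [|g hg] := @impls_ina_offers _ _ _ (Ev j) e _ ha.
    exact: (List.in_map eatom _ _ hIn).
  by eexists; apply: vis_l; apply: vis_l hg.
Qed.

Lemma all_In (A : Type) (P : pred A) s : (forall x, List.In x s -> P x) -> all P s.
Proof.
elim: s => //= x s IH h; rewrite h ?IH //; first by move=> y hy; apply: h; right.
by left.
Qed.

Lemma In_split (A : Type) (x : A) s : List.In x s -> exists s1 s2, s = s1 ++ x :: s2.
Proof. exact: List.in_split. Qed.

Lemma cSX_In a b S : cSX a b S <> 0%N -> List.In (SX a b) S.
Proof.
rewrite /cSX; elim: S => //= x S IH h.
case: x h => [a' b'|a' b'] /=; first by move=> /IH; right.
case: (a' =P a) => [->|_]; last by move=> /IH; right.
by case: (b' =P b) => [->|_]; [left|move=> /IH; right].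
Qed.

Lemma cSY_In a b S : cSY a b S <> 0%N -> List.In (SY a b) S.
Proof.
rewrite /cSY; elim: S => //= x S IH h.
case: x h => [a' b'|a' b'] /=; last by move=> /IH; right.
case: (a' =P a) => [->|_]; last by move=> /IH; right.
by case: (b' =P b) => [->|_]; [left|move=> /IH; right].
Qed.

Lemma cY_In a b C : cY a b C <> 0%N -> List.In (LY a b) C.
Proof.
rewrite /cY; elim: C => //= x C IH h.
case: x h => [f b' kap rs|a' b'|kap e] /=; [by move=> /IH; right| |by move=> /IH; right].
case: (a' =P a) => [->|_]; last by move=> /IH; right.
by case: (b' =P b) => [->|_]; [left|move=> /IH; right].
Qed.

(** Failure can always be avoided: an unfinished state performs event [k] or brings it one signal
    closer, and a finished one spends its remaining signals on success. *)
Lemma impl_progress k p : impl_state k p ->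
  [\/ stuckp p /\ k = n,
      exists2 g, tau p g & forall c, outside c -> impl_state k (g c) |
      exists (b : ev) g, [/\ b = k :> nat, vis p (src_chan b) (tpol T b) g &
        impl_state k.+1 (g (Ev k))]].
Proof.
case=> C S a s b hi ha hs hb.
have [hc1 hc2 hc3] : outside (Ev k) by apply: pub_outside.
case: (ltnP k n) => hk.
  have [C1 [f [b0 [kap [rs [C2 [hC hbk]]]]]]] := inv_pending hi hk.
  rewrite hC in hi ha; have [f' [hf hkap]] := inv_LT_pos hi.
  case: rs hi ha {hC} => [|a0 rs] hi ha.
    apply: Or33; have [f0 [hf0 _ _ hi']] := inv_fire hi.
    rewrite map_cat /= hf0 act_atomS in ha.
    have [g hg hg'] := impls_lin_vis ha.
    exists b0; eexists; split=> //; first by rewrite -hkap; apply: vis_l; apply: vis_l hg.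
    apply: ImplState hi' _ hs hb; rewrite map_cat (map_cat eatom (children _ _ _)).
    exact: hg'.
  apply: Or32.
  have ha0 : (a0 < b0)%N.
    have [|_ [_ h]] := inv_LT hi (f := f) (b := b0) (kappa := kap) (rs := a0 :: rs).
      by apply/In_cat; right; left.
    by apply: h; rewrite mem_head.
  have h1 := inv_P hi ha0; have h2 := inv_Y hi ha0.
  (* Event [k] awaits [a0], so [inv_P] yields a relay. If it is not ready it waits for [a0]; as [a0]
     has fired, [inv_Y] yields the notification it needs. *)
  case: (eqVneq (cSX a0 b0 S) 0%N) => [hX0|hX0].
    have hY0 : cSY a0 b0 S <> 0%N.
      by move: h1; rewrite hX0 cP_cat /cP /= eqxx eqxx; lia.
    have hY1 : cY a0 b0 (C1 ++ LT f b0 kap (a0 :: rs) :: C2) <> 0%N by move: h2; lia.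
    have [S1 [S2 hS]] := In_split (cSY_In hY0).
    have [C1' [C2' hC]] := In_split (cY_In hY1).
    rewrite hC in hi ha; rewrite hS in hi hs; rewrite map_cat in ha; rewrite map_cat in hs.
    have [g hg hg'] := impls_lin_vis ha; have [h hh hh'] := impls_lin_vis hs.
    eexists; first by apply: tau_l; apply: tau_c hg hh.
    move=> c [ho1 ho2 ho3]; apply: ImplState (inv_relay hi) _ _ hb.
      by rewrite map_cat; apply: hg'.
    by rewrite map_cat; apply: hh'.
  have [S1 [S2 hS]] := In_split (cSX_In (elimN eqP hX0)).
  rewrite hS in hi hs; rewrite map_cat in ha; rewrite map_cat in hs.
  have [g hg hg'] := impls_lin_vis ha; have [h hh hh'] := impls_lin_vis hs.
  eexists; first by apply: tau_l; apply: tau_c hg hh.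
  move=> c [ho1 ho2 ho3]; apply: ImplState (inv_receive hi) _ _ hb.
    by rewrite map_cat; apply: hg'.
  by rewrite map_cat; apply: hh'.
have hkn : k = n by apply/eqP; rewrite eqn_leq (inv_k hi) hk.
(* At stage [n] the equations of the invariant force every token count to 0, which leaves no relay
   and only inactions among the events. *)
have hT0 b0 : cT b0 C = 0%N by rewrite (inv_T hi) hkn leqNgt ltn_ord.
have hP0 (a0 b0 : ev) : (a0 < b0)%N -> cSY a0 b0 S = 0%N /\ cSX a0 b0 S = 0%N /\ cY a0 b0 C = 0%N.
  move=> hab; have h1 := inv_P hi hab; have h2 := inv_Y hi hab; move: h1 h2.
  rewrite cP_cT // /enabled; case: (tsrc T b0) => [u|j] /=; first by lia.
  by have := ltn_ord j; lia.
have hS : S = [::].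
  case: S hi hP0 {hs} => [//|x S] hi hP0.
  have := inv_S hi (or_introl erefl : List.In x (x :: S)).
  by case: x {hi} hP0 => a0 b0 hP0 hab; have [h1 [h2 _]] := hP0 a0 b0 hab; move: h1 h2;
    rewrite /cSY /cSX /= !eqxx.
have haC : all is_ina (map eatom C).
  rewrite all_map; apply: all_In => x hx; have [C1 [C2 hC]] := In_split hx; rewrite /preim /=.
  case: x hC {hx} => [f b0 kap rs|a0 d|//] hC.
    by have := hT0 b0; rewrite hC cT_cat /cT /= eqxx addnC.
  have [|_ [_]] := hP0 a0 d.
    by apply: (inv_LY hi); rewrite hC; apply/In_cat; right; left.
  by rewrite hC cY_cat /cY /= !eqxx addnC.
rewrite {}hS in hi hs.
case: (impls_progress ha haC) => [hsta|[g hg hg']]; last first.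
  apply: Or32; eexists; first by apply: tau_l; apply: tau_l hg.
  by move=> c [ho1 ho2 ho3]; apply: ImplState hi (hg' c ho1) hs hb.
case: (impls_progress hs (erefl _)) => [hsts|[g hg hg']]; last first.
  apply: Or32; eexists; first by apply: tau_l; apply: tau_r hg.
  by move=> c [ho1 ho2 ho3]; apply: (ImplState (S := [::])) hi ha (hg' c ho2) hb.
have haN : all is_ina free_inactions by rewrite /free_inactions all_map; apply: all_In.
case: (impls_progress hb haN) => [hstb|[g hg hg']]; last first.
  apply: Or32; eexists; first by apply: tau_r hg.
  by move=> c [ho1 ho2 ho3]; apply: (ImplState (S := [::])) hi ha hs (hg' c ho3).
apply: Or31; split=> // g /tau_PP [[h /tau_PP [[h' /hsta]|[h' /hsts]|]]|[h /hstb]|[]] //.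
move=> [_ [u [e [g1 [g2 [hg1 hg2 _]]]]]] _.
case: (impls_vis hs hg2) => [hu2|[L1 [L2 [F [hL _]]]]|[L1 [L2 [hL _]]]]; last by case: L1 hL.
  case: (impls_vis ha hg1) => [hu1|[L1 [L2 [F [hL _]]]]|[L1 [L2 [hL _]]]].
  - by case: (D12 hu1).
  - by rewrite hL all_cat /= andbF in haC.
  have [C1 [x [C2 [hC _ hx _]]]] := map_split hL; rewrite hC in hi.
  case: x hx hi {hC} => [f b0 kappa [|a0 rs]|a0 d|kappa e0] hx hi //.
    by have [f' [hf _]] := inv_LT_pos hi; move: hx; rewrite hf.
  case: hx => huk _; have [|j [_ [_ hj]]] := (inv_LI hi kappa e0).1.
    by apply/In_cat; right; left.
  have [_ + _] := pub_outside (I : pub (Ev j)).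
  by apply; rewrite -hj -huk.
by case: L1 hL.
Qed.

Hypothesis In_outside : forall sd m, outside (In sd m).

Definition trace_word : seq (chan * pol) := [seq (src_chan b, tpol T b) | b <- enum 'I_n].

Lemma drop_trace_word k (b : ev) : b = k :> nat ->
  drop k trace_word = (src_chan b, tpol T b) :: drop k.+1 trace_word.
Proof.
move=> hb; rewrite (drop_nth (src_chan b, tpol T b)); last first.
  by rewrite size_map size_enum_ord -hb.
congr cons; rewrite (nth_map b) ?size_enum_ord -?hb //.
by rewrite nth_ord_enum.
Qed.

(** Safety: short of failure, the word read is an initial part of what remains of the trace.
    [impl_stuck] later turns it into all of it. *)
Lemma impl_wrun sd m k p t q : wrun sd m k p t q -> impl_state k p ->
  zero q \/ exists2 k', impl_state k' q & drop k trace_word = t ++ drop k' trace_word.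
Proof.
elim=> {m k p t q}.
- by move=> m k p hp; right; exists k.
- move=> m k p g t q hg hw IH hp.
  case: (impl_tau hp hg (In_outside sd m)) => [hz|/IH //].
  by left; apply: zero_wrun hw hz.
- move=> m k p u e g t q hu hg hw IH hp.
  case: (impl_vis hp hg hu) => [hz|[b [hb -> -> /IH]]]; first by left; apply: zero_wrun hw hz.
  case=> [hz|[k' hk' ht]]; [by left|right]; exists k' => //.
  by rewrite (drop_trace_word hb) ht.
Qed.

Lemma impl_live sd m k p s : proc_size p s -> impl_state k p ->
  exists2 q, wrun sd m k p (drop k trace_word) q & stuckp q /\ impl_state n q.
Proof.
have [N] := ubnP s; elim: N s m k p => // N IH s m k p hN hs hp.
case: (impl_progress hp) => [[hst hk]|[g hg hi]|[b [g [hb hg hi]]]].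
- exists p; last by rewrite -hk.
  rewrite drop_oversize; first exact: w_nil.
  by rewrite size_map size_enum_ord hk.
- have [s' hs' hsz] := proc_size_tau hg hs.
  have [|q hw hq] := IH _ m.+1 k _ _ (hsz (In sd m)) (hi _ (In_outside sd m)).
    by rewrite ltnS in hN; apply: leq_trans hs' hN.
  by exists q => //; apply: w_tau hg hw.
- have [s' hs' hsz] := proc_size_vis hg hs.
  have [|q hw hq] := IH _ m _ _ _ (hsz (Ev k)) hi; first by rewrite hs' ltnS in hN.
  exists q => //; rewrite (drop_trace_word hb); apply: w_vis hg hw.
  exact: src_chan_pub.
Qed.

Definition trace_offers (u : chan) (e : pol) : Prop :=
  (exists2 v, (e, inl v) \in tN T & u = Fr v) \/
  exists2 j : ev, (e, inr j) \in tN T & u = Ev j.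

Lemma impl_ends_safe sd m p t q : impl_state 0 p -> ends sd m p t q ->
  pval q = 0 \/ [/\ t = trace_word, pval q = 1 &
    forall u e, pub u -> (offers q u e <-> trace_offers u e)].
Proof.
move=> hp [hw hst]; case: (impl_wrun hw hp) => [/zero_pval ->|[k hk ht]]; first by left.
have [hkn hv ho] := impl_stuck hk hst; right; split=> //.
rewrite drop0 hkn drop_oversize ?cats0 in ht; first by rewrite ht.
by rewrite size_map size_enum_ord.
Qed.

Lemma impl_ends_live sd m p s : proc_size p s -> impl_state 0 p ->
  exists q, [/\ ends sd m p trace_word q, pval q = 1 &
    forall u e, pub u -> (offers q u e <-> trace_offers u e)].
Proof.
move=> hs hp; have [q hw [hst hi]] := impl_live sd m hs hp.
rewrite drop0 in hw; have [_ hv ho] := impl_stuck hi hst.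
by exists q.
Qed.
End Tokens.

(** * Interpretation of the implementation *)

Section Realization.
Variable K : comPzSemiRingType.
Implicit Types P Q R E : term K.
Lemma den_upd_notin P rho x c s : x \notin fn P -> den P (upd rho x c) s = den P rho s.
Proof.
move=> hx; apply: den_fn => y hy; rewrite upd_other //.
by apply: contraNneq hx => <-.
Qed.

(** Uniform in the extension [t] of the path, since products and linear actions push their
    components to deeper paths while the set of private signals stays [zone s0]. *)
Definition realizes (s0 : seq nat) (rho : name -> chan) (L : seq atom) P : Prop :=
  forall t, impls (zone s0) L (den P rho (t ++ s0)).

Definition avoids (s0 : seq nat) (rho : name -> chan) : Prop :=
  forall v, ~ zone s0 (rho v).

Lemma avoids_upd s0 rho x c : avoids s0 rho -> ~ zone s0 c -> avoids s0 (upd rho x c).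
Proof. by move=> h hc v; rewrite /upd; case: eqP => _; [|apply: h]. Qed.

Lemma zone_cat t s c : zone (t ++ s) c -> zone s c.
Proof. by case=> t' ->; exists (t' ++ t); rewrite catA. Qed.

Lemma realizes_lin s0 rho u e x P F : avoids s0 rho ->
  (forall c, ~ zone s0 c -> realizes s0 (upd rho x c) (F c) P) ->
  realizes s0 rho [:: Lin (rho u) e F] (lin u e x P).
Proof.
move=> ha hF t; rewrite /lin; set w := fresh _; set W := Pv (t ++ s0).
have := fresh_notin (u :: x :: allnames P); rewrite -/w !inE !negb_or mem_cat negb_or.
move=> /and3P[hwu hwx /andP[hwP _]].
have hW : zone s0 W by exists t.
(* The four steps of the path of [P] are the restriction, the left component, the prefix, and the
   left component of its body. *)
have hden : den (TNu w (TPar (TAct u e x (TPar P (pre w true (TConst 1))))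
    (TPar (pre w true (TConst 0)) (pre w false (TConst 1))))) rho (t ++ s0) =
  PP true (PAct (rho u) e (fun c => PP true
      (den P (upd rho x c) ([:: 1; 1; 1; 1]%N ++ t ++ s0)) (wait W 1)))
    (PP true (wait W 0) (PAct W false (fun=> PC 1))).
  rewrite /= upd_other 1?eq_sym // upd_same; congr (PP _ (PAct _ _ _) _).
  apply: functional_extensionality => c; congr PP.
    by rewrite updC // den_upd_notin.
  by rewrite upd_other // upd_same.
rewrite hden; apply: im_lin => //.
- by move=> huW; apply: (ha u); rewrite huW.
- move=> c hc; apply: only_den => [v hv|d hd hdW].
    by rewrite /upd; case: eqP => // _ hvW; apply: (ha v); rewrite hvW.
  rewrite hdW in hd; apply: (@zone_strict 1 (t ++ s0)).
  exact: (@zone_cat [:: 1; 1; 1]%N).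
- by move=> c hc; rewrite catA; apply: hF.
Qed.

Lemma realizes_lin0 s0 rho u e P L : avoids s0 rho -> realizes s0 rho L P ->
  realizes s0 rho [:: Lin (rho u) e (fun=> L)] (lin0 u e P).
Proof.
move=> ha hL; apply: realizes_lin => // c _ t.
rewrite den_upd_notin //; have := fresh_notin (u :: allnames P).
by rewrite inE mem_cat !negb_or => /and3P[].
Qed.

Lemma realizes_pre0 s0 rho u e : realizes s0 rho [:: Ina (rho u) e] (pre u e (TConst 0)).
Proof. by move=> t; apply: im_ina. Qed.

Lemma realizes_const1 s0 rho : realizes s0 rho [::] (TConst 1).
Proof. by move=> t; apply: im_nil. Qed.

Lemma realizes_ppar s0 rho L1 L2 P Q : realizes s0 rho L1 P -> realizes s0 rho L2 Q ->
  realizes s0 rho (L1 ++ L2) (TPPar P Q).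
Proof. by move=> h1 h2 t; apply: im_par; [apply: (h1 (1%N :: t))|apply: (h2 (2 :: t))]. Qed.

Lemma realizes_bigpar s0 rho Ls Ps : List.Forall2 (realizes s0 rho) Ls Ps ->
  realizes s0 rho (flatten Ls) (bigpar Ps).
Proof.
elim=> {Ls Ps} [|L P Ls Ps hL hLs IH]; first exact: realizes_const1.
case: Ps hLs IH => [|Q Ps] hLs IH; last by apply: realizes_ppar.
by inversion hLs; rewrite /= cats0.
Qed.

Lemma Forall2_map (I : eqType) (A B : Type) (R : A -> B -> Prop) (f : I -> A) (g : I -> B) s :
  {in s, forall i, R (f i) (g i)} -> List.Forall2 R (map f s) (map g s).
Proof.
elim: s => [|i s IH] h /=; constructor; first by apply: h; rewrite mem_head.
by apply: IH => j hj; apply: h; rewrite inE hj orbT.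
Qed.

Lemma realizes_bigpar1 (I : eqType) s0 rho (f : I -> atom) (g : I -> term K) s :
  {in s, forall i, realizes s0 rho [:: f i] (g i)} ->
  realizes s0 rho (map f s) (bigpar (map g s)).
Proof.
by move=> h; rewrite -flatten_map1; apply: realizes_bigpar; apply: Forall2_map.
Qed.

Section Trace.
Variable T : trace.
Local Notation n := (tn T).
Local Notation ev := 'I_(tn T).
Hypothesis hle : forall a b, tle T a b = (a <= b)%N.
Hypothesis hsrc : forall a b, tsrc T b = inr a -> (a < b)%N.

Lemma realizes_receive s0 rho (X : ev -> ev -> chan) b x P rs : avoids s0 rho ->
  (forall a, rho (xn a b) = X a b) -> realizes s0 rho [:: x] P ->
  realizes s0 rho [:: receive X b x rs] (foldr (fun a P => lin0 (xn a b) true P) P rs).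
Proof.
by move=> ha hX hx; elim: rs => //= a rs IH; rewrite -hX; apply: realizes_lin0.
Qed.

Lemma xn_zn (a b c : ev) : xn a b != zn c.
Proof. by apply/eqP; rewrite /xn /zn; have := ltn_ord c; lia. Qed.

Lemma yn_zn (a b c : ev) : yn a b != zn c.
Proof. by apply/eqP; rewrite /yn /zn; have := ltn_ord c; nia. Qed.

(** The subject is read through [rho]: for an event with source [b], the induction is applied under
    the binder of [zn b], where [rho] already returns the object received. *)
Lemma realizes_A s0 (X Y : ev -> ev -> chan) f (b : ev) rho : (n <= f + b)%N ->
  avoids s0 rho -> (forall a b, rho (xn a b) = X a b) -> (forall a b, rho (yn a b) = Y a b) ->
  realizes s0 rho [:: receive X b (act_atom X Y f b (rho (subj b))) (below b)] (A K f b).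
Proof.
elim: f b rho => [|f IH] b rho hf ha hX hY; first by have := ltn_ord b; lia.
apply: realizes_receive => //; apply: realizes_lin => // c hc.
have ha' := avoids_upd (x := zn b) ha hc.
have hX' a d : upd rho (zn b) c (xn a d) = X a d by rewrite upd_other // xn_zn.
have hY' a d : upd rho (zn b) c (yn a d) = Y a d by rewrite upd_other // yn_zn.
apply: realizes_ppar; last apply: realizes_ppar.
- apply: realizes_bigpar1 => d _; rewrite -hY'; apply: realizes_lin0 => //.
  exact: realizes_const1.
- apply: realizes_bigpar1 => d; rewrite mem_filter => /andP[/eqP hd _].
  have hfd : (n <= f + d)%N by have := hsrc hd; lia.
  by have := IH d _ hfd ha' hX' hY'; rewrite /subj hd upd_same.
- apply: realizes_bigpar1 => p _.
  by have := realizes_pre0 s0 (upd rho (zn b) c) (zn b) p.1; rewrite upd_same.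
Qed.

Definition relay_pairs : seq (ev * ev) :=
  flatten [seq [seq (a, b) | b <- enum 'I_n & tlt a b] | a <- enum 'I_n].

Lemma mem_relay_pairs p : List.In p relay_pairs -> (p.1 < p.2)%N.
Proof.
move=> /In_mem /flattenP [s /mapP [a _ ->] /mapP [b]].
by rewrite mem_filter => /andP[hab _] ->; rewrite -tltE.
Qed.

Lemma sumn_flatten (ss : seq (seq nat)) : sumn (flatten ss) = sumn (map sumn ss).
Proof. by elim: ss => //= s ss IH; rewrite sumn_cat IH. Qed.

Lemma relay_count (a b : ev) : (a < b)%N ->
  sumn [seq ((p.1 == a) && (p.2 == b) : nat) | p <- relay_pairs] = 1%N.
Proof.
move=> hab; rewrite /relay_pairs map_flatten sumn_flatten -!map_comp.
pose g (c : ev) : nat := ((c == a) * (c < b))%N.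
rewrite (eq_map (g := g)) => [|c /=]; last first.
  rewrite -map_comp (@sumn_filter_eq _ _ _ _ b) ?enum_uniq ?mem_enum //=.
    by rewrite eqxx andbT tltE // /g mulnC.
  by move=> d /negbTE ->; rewrite andbF.
rewrite -enumT -[enum _]filter_predT (@sumn_filter_eq _ _ _ _ a) ?enum_uniq ?mem_enum //.
  by rewrite /g eqxx hab.
by move=> d /negbTE; rewrite /g => ->.
Qed.

Definition root_events : seq (ecode T) :=
  [seq LT n b (src_chan b) (below b) | b <- enum 'I_n & is_inl (tsrc T b)].

Definition relays : seq (scode T) := [seq SY p.1 p.2 | p <- relay_pairs].

Lemma inv_init : token_inv 0 root_events relays.
Proof.
have hrel (a b : ev) : (a < b)%N -> cSY a b relays = 1%N.
  by move=> hab; rewrite /cSY /relays -map_comp -[RHS](relay_count hab).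
have hX (a b : ev) : cSX a b relays = 0%N.
  by rewrite /cSX /relays -map_comp; apply: sumn_const0.
split.
- by [].
- move=> b; rewrite /cT /root_events -map_comp.
  rewrite (@sumn_filter_eq _ _ _ _ b) ?enum_uniq ?mem_enum //=.
    by rewrite eqxx muln1 /enabled; case: (tsrc T b).
  by move=> d /negbTE ->.
- move=> a b hab; rewrite hrel // leq0n /cY /root_events -map_comp.
  by rewrite sumn_const0.
- move=> a b hab; rewrite hrel // hX /cP /root_events -map_comp.
  rewrite (@sumn_filter_eq _ _ _ _ b) ?enum_uniq ?mem_enum //=.
    rewrite eqxx mul1n count_uniq_mem ?below_uniq // mem_below // hab muln1 /enabled.
    by case: (tsrc T b).
  by move=> d /negbTE ->.
- move=> f b kap rs /In_map_filter [d [_ _ [-> -> -> ->]]]; split; first exact: leq_addr.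
  by split=> // a; rewrite mem_below.
- by move=> a d /In_map_filter [b []].
- move=> x /List.in_map_iff [p [<- /mem_relay_pairs]] //.
- move=> kap e; split=> [/In_map_filter [b []] //|[j [_ []]] //].
Qed.

Lemma realizes_relays s0 rho (X Y : ev -> ev -> chan) : avoids s0 rho ->
  (forall a b, rho (xn a b) = X a b) -> (forall a b, rho (yn a b) = Y a b) ->
  realizes s0 rho (map (satom X Y) relays)
    (bigpar (flatten [seq [seq lin0 (yn a b) true (lin0 (xn a b) false (TConst (1 : K)))
                          | b <- enum 'I_n & tlt a b] | a <- enum 'I_n])).
Proof.
move=> ha hX hY.
pose g (p : ev * ev) := lin0 (yn p.1 p.2) true (lin0 (xn p.1 p.2) false (TConst (1 : K))).
have -> : flatten [seq [seq lin0 (yn a b) true (lin0 (xn a b) false (TConst (1 : K)))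
                       | b <- enum 'I_n & tlt a b] | a <- enum 'I_n] = map g relay_pairs.
  rewrite /relay_pairs map_flatten -map_comp; congr flatten; apply: eq_map => a /=.
  by rewrite -map_comp.
rewrite /relays -map_comp; apply: realizes_bigpar1 => p _ /=.
rewrite -hX -hY; apply: realizes_lin0 => //; apply: realizes_lin0 => //.
exact: realizes_const1.
Qed.

(** Each further binder receives a longer path, so lengths tell the restricted channels apart and
    separate them from those of the body, whose paths are at least as long as [s']. A repeated name
    follows its innermost binder. *)
Lemma den_nus P xs rho s : exists rho' s', [/\
  den (foldr (@TNu K) P xs) rho s = den P rho' s',
  (forall v, v \notin xs -> rho' v = rho v),
  (forall v, v \in xs -> exists t, rho' v = Pv t /\ (size s <= size t < size s')%N),
  (size s <= size s')%N & {in xs &, injective rho'}].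
Proof.
elim: xs rho s => [|x xs IH] rho s /=; first by exists rho, s; split.
have [rho' [s' [h1 h2 h3 h4 h5]]] := IH (upd rho x (Pv s)) (1%N :: s).
have hx : x \notin xs -> rho' x = Pv s by move=> hx; rewrite h2 // upd_same.
exists rho', s'; split=> //.
- by move=> v; rewrite inE negb_or => /andP[hvx hv]; rewrite h2 // upd_other.
- move=> v; rewrite inE; case: (boolP (v \in xs)) => [/h3 [t [-> /= ht]] _|hv].
    by exists t; split=> //; lia.
  by rewrite orbF => /eqP hvx; rewrite hvx in hv *; exists s; rewrite hx // leqnn.
- by apply: ltnW.
- have hne v : v \in xs -> x \notin xs -> rho' v <> rho' x.
    by move=> /h3 [t [-> /= ht]] /hx -> [hts]; rewrite hts in ht; lia.
  move=> v w; rewrite !inE; case: (boolP (v \in xs)) => hv; case: (boolP (w \in xs)) => hw.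
  + by move=> _ _; apply: h5.
  + by rewrite orbF => _ /eqP hwx; rewrite hwx in hw * => /hne; case.
  + by rewrite orbF => /eqP hvx _; rewrite hvx in hv * => /esym /hne; case.
  + by rewrite !orbF => /eqP -> /eqP ->.
Qed.

Definition restricted : seq name :=
  flatten [seq flatten [seq [:: xn a b; yn a b] | b <- enum 'I_n] | a <- enum 'I_n].

Lemma mem_restricted (a b : ev) : xn a b \in restricted /\ yn a b \in restricted.
Proof.
have h x : x \in [:: xn a b; yn a b] -> x \in restricted.
  move=> hx; apply/flattenP; exists (flatten [seq [:: xn a b; yn a b] | b <- enum 'I_n]).
    by apply/mapP; exists a; rewrite ?mem_enum.
  apply/flattenP; exists [:: xn a b; yn a b] => //.
  by apply/mapP; exists b; rewrite ?mem_enum.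
by split; apply: h; rewrite !inE eqxx ?orbT.
Qed.

Lemma tnames_restricted u : u \in tnames T -> u \notin restricted.
Proof.
move=> /ltn_fresh hu; apply/negP => /flattenP [s /mapP [a _ ->] /flattenP [s' /mapP [b _ ->]]].
by rewrite !inE /xn /yn /tbase => /orP[] /eqP hub; rewrite hub in hu; lia.
Qed.

Lemma xn_inj (a b a' b' : ev) : xn a b = xn a' b' -> a = a' /\ b = b'.
Proof.
rewrite /xn => h; have {}h : (a * n + b = a' * n + b')%N by lia.
have hn : (0 < n)%N by apply: leq_trans (ltn_ord a).
have ha : a = a' :> nat.
  by have := congr1 (divn^~ n) h; rewrite !divnMDl // !divn_small // !addn0.
split; apply: val_inj => //=; rewrite ha in h; exact: addnI h.
Qed.

Lemma yn_inj (a b a' b' : ev) : yn a b = yn a' b' -> a = a' /\ b = b'.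
Proof. by rewrite /yn => h; apply: xn_inj; rewrite /xn; lia. Qed.

Lemma realizes_roots s0 rho (X Y : ev -> ev -> chan) : avoids s0 rho ->
  (forall a b, rho (xn a b) = X a b) -> (forall a b, rho (yn a b) = Y a b) ->
  (forall u, u \in tnames T -> rho u = Fr u) ->
  realizes s0 rho (map (eatom X Y) root_events)
    (bigpar [seq A K n a | a <- enum 'I_n & is_inl (tsrc T a)]).
Proof.
move=> ha hX hY hF; rewrite /root_events -map_comp; apply: realizes_bigpar1 => b.
rewrite mem_filter => /andP[hb _] /=.
have -> : src_chan b = rho (subj b).
  rewrite /src_chan /subj; case hs: (tsrc T b) hb => [u|//] _; rewrite hF //.
  rewrite /tnames mem_cat; apply/orP; left; apply/mapP; exists b; rewrite ?mem_enum //.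
  by rewrite hs.
by apply: realizes_A => //; apply: leq_addr.
Qed.

Lemma realizes_free_inactions s0 :
  realizes s0 Fr (free_inactions T)
    (bigpar [seq pre (if p.2 is inl u then u else 0%N) p.1 (TConst (0 : K)) | p <- tN T & is_inl p.2]).
Proof. by apply: realizes_bigpar1 => p _; apply: realizes_pre0. Qed.

Record separated (X Y : ev -> ev -> chan) (D1 D2 D3 : chan -> Prop) : Prop := Separated {
  sep_X_inj : forall a b a' b', X a b = X a' b' -> a = a' /\ b = b';
  sep_Y_inj : forall a b a' b', Y a b = Y a' b' -> a = a' /\ b = b';
  sep_X : forall a b, [/\ ~ pub (X a b), ~ D1 (X a b) & ~ D2 (X a b)];
  sep_Y : forall a b, [/\ ~ pub (Y a b), ~ D1 (Y a b) & ~ D2 (Y a b)];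
  sep_12 : forall c, D1 c -> ~ D2 c;
  sep_pub : forall c, pub c -> outside D1 D2 D3 c;
  sep_In : forall sd m, outside D1 D2 D3 (In sd m)
}.

Lemma impl_state_den s : exists X Y D1 D2 D3, separated X Y D1 D2 D3 /\
  impl_state X Y D1 D2 D3 0 (den (impl K T) Fr s).
Proof.
pose body := TPar (bigpar [seq A K n a | a <- enum 'I_n & is_inl (tsrc T a)])
  (bigpar (flatten [seq [seq lin0 (yn a b) true (lin0 (xn a b) false (TConst (1 : K)))
                          | b <- enum 'I_n & tlt a b] | a <- enum 'I_n])).
have [rho [s' [h1 h2 h3 h4 h5]]] := den_nus body restricted Fr (1%N :: s).
have hX (a b : ev) := proj1 (mem_restricted a b).
have hY (a b : ev) := proj2 (mem_restricted a b).
have hz k v : ~ zone (k :: s') (rho v).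
  move=> [t]; case: (boolP (v \in restricted)) => [/h3 [t' [-> ht']] [htt]|/h2 -> //].
  by rewrite htt size_cat /= in ht'; lia.
have hpv v : v \in restricted -> ~ pub (rho v) by move=> /h3 [t [-> _]].
(* The paths of the private signals end in [1 :: s'] on the event side and in [2 :: s'] on the relay
   side, hence are longer than those of the restricted channels. *)
exists (fun a b => rho (xn a b)), (fun a b => rho (yn a b)).
exists (zone (1%N :: s')), (zone (2 :: s')), (zone (2 :: s)); split.
  split.
  - by move=> a b a' b' /h5 h; apply: xn_inj; apply: h.
  - by move=> a b a' b' /h5 h; apply: yn_inj; apply: h.
  - by move=> a b; split; [apply: hpv|apply: hz|apply: hz].
  - by move=> a b; split; [apply: hpv|apply: hz|apply: hz].
  - exact: zone_disj.
  - by case=> //= v _; split; case.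
  - by move=> sd m; split; case.
have -> : den (impl K T) Fr s = PP false (den body rho s')
    (den (bigpar [seq pre (if p.2 is inl u then u else 0%N) p.1 (TConst 0)
                 | p <- tN T & is_inl p.2]) Fr (2 :: s)).
  by rewrite -h1.
apply: ImplState inv_init _ _ _.
- apply: (realizes_roots (hz 1%N) (fun a b => erefl) (fun a b => erefl) _ [::]).
  by move=> u /tnames_restricted /h2.
- exact: (realizes_relays (hz 2) (fun a b => erefl) (fun a b => erefl) [::]).
- exact: (realizes_free_inactions (2 :: s) [::]).
Qed.

Lemma impl_safe sd m s t q : ends sd m (den (impl K T) Fr s) t q ->
  pval q = 0 \/ [/\ t = trace_word T, pval q = 1 &
    forall u e, pub u -> (offers q u e <-> trace_offers T u e)].
Proof.
have [X [Y [D1 [D2 [D3 [[a1 a2 a3 a4 a5 a6 a7] hi]]]]]] := impl_state_den s.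
exact: impl_ends_safe hi.
Qed.

Lemma impl_complete sd m s : exists q, [/\ ends sd m (den (impl K T) Fr s) (trace_word T) q,
  pval q = 1 & forall u e, pub u -> (offers q u e <-> trace_offers T u e)].
Proof.
have [X [Y [D1 [D2 [D3 [[a1 a2 a3 a4 a5 a6 a7] hi]]]]]] := impl_state_den s.
apply: impl_ends_live hi => //; exact: proc_size_den.
Qed.
End Trace.
End Realization.

(** * Sums and the theorem *)

Section Sums.
Variable K : comPzSemiRingType.
Implicit Types P Q R E : term K.
Implicit Types p q r x y : proc K.
(** The dead context [y] models what [scale] and a resolved sum leave next to the active process
    [x]; [l] puts [x] on the left. *)
Definition beside (l b : bool) y x : proc K := if l then PP b x y else PP b y x.

Lemma beside_vis l b y x u e g : vis (beside l b y x) u e g ->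
  (exists2 h, vis x u e h & g = fun c => beside l b y (h c)) \/ exists h, vis y u e h.
Proof.
by case: l => /vis_PP [[h hh ->]|[h hh ->]]; [left|right|right|left]; exists h.
Qed.

Lemma vis_beside l b y x u e g : vis x u e g -> vis (beside l b y x) u e (fun c => beside l b y (g c)).
Proof. by case: l => h; [apply: vis_l|apply: vis_r]. Qed.

Lemma tau_beside l b y x g : tau x g -> tau (beside l b y x) (fun c => beside l b y (g c)).
Proof. by case: l => h; [apply: tau_l|apply: tau_r]. Qed.

Definition inert (S : chan -> Prop) y : Prop :=
  stuckp y /\ forall u e g, vis y u e g -> S u.

Lemma beside_tau S l b y x g : inert S y -> only (fun c => ~ S c) x ->
  tau (beside l b y x) g -> exists2 h, tau x h & g = fun c => beside l b y (h c).
Proof.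
move=> [hst hS] hx; case: l => /tau_PP [[h hh ->]|[h hh ->]|].
- by exists h.
- by case: (hst _ hh).
- by move=> [_ [u [e [g1 [g2 [/(only_vis hx) [hu _] /hS]]]]]].
- by case: (hst _ hh).
- by exists h.
- by move=> [_ [u [e [g1 [g2 [/hS hu /(only_vis hx) []]]]]]].
Qed.

Lemma pval_beside l b y x : pval (beside l b y x) = pval y * pval x.
Proof. by case: l => //=; rewrite mulrC. Qed.

Lemma ends_beside sd m S l b y x t q : inert S y -> only (fun c => ~ S c) x ->
  (forall c, pub c -> ~ S c) -> (forall k, ~ S (In sd k)) ->
  ends sd m (beside l b y x) t q <-> exists2 x', ends sd m x t x' & q = beside l b y x'.
Proof.
move=> hy hx hpub hIn; split.
- rewrite /ends; move hz: (beside l b y x) => z [hw].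
  elim: hw x hx hz => {m z t q}.
  + move=> m n p x _ <- hst; exists x => //; split; first exact: w_nil.
    by move=> g /(tau_beside l b y) /hst.
  + move=> m n p g t q hg _ IH x hx hz hq; rewrite -hz in hg.
    have [h hh hgh] := beside_tau hy hx hg.
    have hx' : only (fun c => ~ S c) (h (In sd m)) by apply: only_tau hx hh _ (hIn m).
    have [|x' [hw hs] hqx] := IH _ hx' _ hq; first by rewrite hgh.
    by exists x' => //; split=> //; apply: w_tau hh hw.
  + move=> m n p u e g t q hu hg _ IH x hx hz hq; rewrite -hz in hg.
    case: (beside_vis hg) => [[h hh hgh]|[h hh]]; last by case: (hpub u hu); apply: hy.2 hh.
    have hx' : only (fun c => ~ S c) (h (Ev n)) by apply: (only_vis hx hh).2; apply: hpub.
    have [|x' [hw hs] hqx] := IH _ hx' _ hq; first by rewrite hgh.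
    by exists x' => //; split=> //; apply: w_vis hu hh hw.
- move=> [x' [hw hs] ->] {q}; split.
    elim: hw {hx hs} => {m x t x'}.
    + by move=> *; apply: w_nil.
    + by move=> m n p g t q hg _ IH; apply: w_tau (tau_beside l b y hg) IH.
    + by move=> m n p u e g t q hu hg _ IH; apply: w_vis hu (vis_beside l b y hg) IH.
  have hx' : only (fun c => ~ S c) x'.
    elim: hw hx {hs} => {m x t x'} //.
    + by move=> m n p h t q hg _ IH hp; apply: IH; apply: only_tau hp hg _ _.
    + by move=> m n p u e h t q hu hg _ IH hp; apply: IH; apply: (only_vis hp hg).2; apply: hpub.
  by move=> g hg; have [h hh _] := beside_tau hy hx' hg; apply: hs hh.
Qed.

Lemma offers_beside S l b y x u e : inert S y -> (forall c, pub c -> ~ S c) -> pub u ->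
  offers (beside l b y x) u e <-> offers x u e.
Proof.
move=> hy hpub hu; split=> [[g /beside_vis [[h hh _]|[h hh]]]|[g hg]].
- by exists h.
- by case: (hpub u hu); apply: hy.2 hh.
- by eexists; apply: vis_beside hg.
Qed.

Lemma only_true (S : chan -> Prop) p : (forall c, S c) -> only S p.
Proof. by move=> h; elim: p => //= b p IHp q IHq; split. Qed.

Lemma only_nofalse p : only (fun c => ~ (fun=> False) c) p.
Proof. by apply: only_true => c; apply. Qed.

Lemma inert_PC k : inert (fun=> False) (PC k).
Proof. by split=> [g /tau_PC|u e g /vis_PC]. Qed.

Lemma inert_PAct W e f : inert (fun c => c = W) (PAct W e f).
Proof. by split=> [g /tau_PAct|u e' g /vis_PAct [-> _ _]]. Qed.

(** The counter and the path are arbitrary because a summand starts deeper in the term and after the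
    internal steps that select it. *)
Definition yields P (t : seq (chan * pol)) (v : K) (O : chan -> pol -> Prop) : Prop :=
  forall m s, exists q, [/\ ends true m (den P Fr s) t q, pval q = v &
    forall u e, pub u -> (offers q u e <-> O u e)].

(** Offers are compared on public channels only: the discarded summand still offers its selector,
    which no partner can reach. *)
Definition same_end q q' : Prop :=
  pval q = pval q' /\ forall u e, pub u -> (offers q u e <-> offers q' u e).

Lemma den_pre u e P s rho :
  den (pre u e P) rho s = PAct (rho u) e (fun=> den P rho (1%N :: s)).
Proof.
rewrite /=; congr PAct; apply: functional_extensionality => c.
rewrite den_upd_notin //; have := fresh_notin (u :: allnames P).
by rewrite inE mem_cat !negb_or => /and3P[].
Qed.

Lemma ends_beside_PC sd m l b k x t q :
  ends sd m (beside l b (PC k) x) t q <-> exists2 x', ends sd m x t x' & q = beside l b (PC k) x'.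
Proof. by apply: ends_beside; [apply: inert_PC|apply: only_nofalse|move=> c _; apply|move=> i; apply]. Qed.

Lemma offers_beside_PC l b k x u e : pub u -> offers (beside l b (PC k) x) u e <-> offers x u e.
Proof. by apply: offers_beside (inert_PC k) _ => c _; apply. Qed.

Lemma yields_scale k P t v O : yields P t v O -> yields (scale k P) t (k * v) O.
Proof.
move=> h m s; have [q [hq <- hO]] := h m (2 :: s).
exists (beside false true (PC k) q); split.
- by apply/(ends_beside_PC _ _ false true); exists q.
- by rewrite pval_beside.
- by move=> u e hu; rewrite offers_beside_PC // hO.
Qed.

Lemma ends_scale m s k P t q : ends true m (den (scale k P) Fr s) t q ->
  exists s' q', [/\ ends true m (den P Fr s') t q', pval q = k * pval q' &
    forall u e, pub u -> (offers q u e <-> offers q' u e)].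
Proof.
move=> /(ends_beside_PC _ _ false true) [q' hq' ->].
exists (2 :: s), q'; split=> //.
by move=> u e hu; rewrite offers_beside_PC.
Qed.

Definition choice W p q : proc K :=
  PP true (PP true (PAct W true (fun=> p)) (PAct W true (fun=> q))) (PAct W false (fun=> PC 1)).

(** The emitter on [W] can serve one summand only. The other waits for ever on a spent private
    channel, with state 1. *)
Lemma choice_tau W p q g : tau (choice W p q) g ->
  (forall c, g c = beside true true (PC 1) (beside true true (PAct W true (fun=> q)) p)) \/
  (forall c, g c = beside true true (PC 1) (beside false true (PAct W true (fun=> p)) q)).
Proof.
case/tau_PP => [[h /tau_PP [[h' /tau_PAct //]|[h' /tau_PAct //]|]]|[h /tau_PAct //]|].
  by move=> [_ [u [e [g1 [g2 [/vis_PAct [_ -> _] /vis_PAct []]]]]]].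
move=> [_ [u [e [g1 [g2 [h1 /vis_PAct [_ _ ->] ->]]]]]].
by case/vis_PP: h1 => -[h /vis_PAct [_ _ ->] ->]; [left|right].
Qed.

Lemma choice_l W p q :
  tau (choice W p q) (fun=> beside true true (PC 1) (beside true true (PAct W true (fun=> q)) p)).
Proof. exact: tau_c (vis_l _ _ (vis_act _ _ _)) (vis_act _ _ _). Qed.

Lemma choice_r W p q :
  tau (choice W p q) (fun=> beside true true (PC 1) (beside false true (PAct W true (fun=> p)) q)).
Proof. exact: tau_c (vis_r _ _ (vis_act _ _ _)) (vis_act _ _ _). Qed.

Lemma choice_vis W p q u e g : vis (choice W p q) u e g -> u = W.
Proof. by case/vis_PP => -[h]; [case/vis_PP => -[h']|] => /vis_PAct []. Qed.

Lemma den_oplus P Q s : exists s1 s2, [/\ den (oplus P Q) Fr s = choice (Pv s) (den P Fr s1) (den Q Fr s2),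
  only (fun c => c <> Pv s) (den P Fr s1) & only (fun c => c <> Pv s) (den Q Fr s2)].
Proof.
exists ([:: 1; 1; 1; 1]%N ++ s), ([:: 1; 2; 1; 1]%N ++ s).
have ho R k t : only (fun c => c <> Pv s) (den R Fr ([:: k] ++ t ++ 1%N :: s)).
  by apply: only_den => // c /zone_cons /zone_cat hz hc; rewrite hc in hz; apply: zone_strict hz.
split; last 2 first.
- exact: (ho P 1%N [:: 1; 1]%N).
- exact: (ho Q 1%N [:: 2; 1]%N).
rewrite /oplus; set u := fresh _.
have := fresh_notin (allnames P ++ allnames Q).
rewrite -/u !mem_cat !negb_or => /andP[/andP[hP _] /andP[hQ _]].
rewrite -[LHS]/(PP true
  (PP true (den (pre u true P) (upd Fr u (Pv s)) ([:: 1; 1; 1]%N ++ s))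
           (den (pre u true Q) (upd Fr u (Pv s)) ([:: 2; 1; 1]%N ++ s)))
  (den (pre u false (TConst 1)) (upd Fr u (Pv s)) ([:: 2; 1]%N ++ s))).
by rewrite !den_pre !upd_same !den_upd_notin.
Qed.

Lemma beside_twice W l f m t q p : only (fun c => c <> W) p -> ~ pub W -> (forall k, In true k <> W) ->
  ends true m (beside true true (PC 1) (beside l true (PAct W true f) p)) t q <->
  exists2 q', ends true m p t q' & q = beside true true (PC 1) (beside l true (PAct W true f) q').
Proof.
move=> hp hW hIn; rewrite ends_beside_PC.
have h x : ends true m (beside l true (PAct W true f) p) t x <->
    exists2 q', ends true m p t q' & x = beside l true (PAct W true f) q'.
  by apply: ends_beside (inert_PAct W true f) hp _ hIn => c hc hcW; rewrite hcW in hc.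
split=> [[x /h [q' hq' ->] ->]|[q' hq' ->]]; first by exists q'.
by exists (beside l true (PAct W true f) q') => //; apply/h; exists q'.
Qed.

Lemma same_end_twice W l f p : ~ pub W ->
  same_end (beside true true (PC 1) (beside l true (PAct W true f) p)) p.
Proof.
move=> hW; split; first by rewrite !pval_beside /= !mul1r.
move=> u e hu; rewrite offers_beside_PC //.
by apply: offers_beside (inert_PAct _ _ _) _ hu => c hc hcW; rewrite hcW in hc.
Qed.

Lemma ends_oplus m s P Q t q : ends true m (den (oplus P Q) Fr s) t q ->
  exists R s' q', [/\ R = P \/ R = Q, ends true m.+1 (den R Fr s') t q' & same_end q q'].
Proof.
have [s1 [s2 [-> hP hQ]]] := den_oplus P Q s; move=> [hw hst].
have hWp : ~ pub (Pv s) by [].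
have hIn k : In true k <> Pv s by [].
inversion hw; subst.
- by case: (hst _ (choice_l _ _ _)).
- case: (choice_tau H) => hg; rewrite hg in H0.
  + have [|q' hq' ->] := (beside_twice true (fun=> den Q Fr s2) m.+1 t q hP hWp hIn).1; first by split; [apply: H0|].
    by exists P, s1, q'; split=> //; [left|apply: same_end_twice].
  + have [|q' hq' ->] := (beside_twice false (fun=> den P Fr s1) m.+1 t q hQ hWp hIn).1; first by split; [apply: H0|].
    by exists Q, s2, q'; split=> //; [right|apply: same_end_twice].
- by move: H; rewrite (choice_vis H0).
Qed.

Lemma yields_oplus P Q R t v O : R = P \/ R = Q -> yields R t v O -> yields (oplus P Q) t v O.
Proof.
move=> hR h m s; have [s1 [s2 [-> hP hQ]]] := den_oplus P Q s.
have hWp : ~ pub (Pv s) by [].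
have hIn k : In true k <> Pv s by [].
case: hR => hR; rewrite hR in h.
- have [q [hq <- hO]] := h m.+1 s1.
  have [hv ho] := same_end_twice true (fun=> den Q Fr s2) q hWp.
  have [hw hst] := (beside_twice true (fun=> den Q Fr s2) m.+1 t (beside true true (PC 1) (beside true true (PAct (Pv s) true (fun=> den Q Fr s2)) q)) hP hWp hIn).2
    (ex_intro2 _ _ q hq erefl).
  exists (beside true true (PC 1) (beside true true (PAct (Pv s) true (fun=> den Q Fr s2)) q)); split=> //; last by move=> u e hu; rewrite ho ?hO.
  by split=> //; apply: w_tau (choice_l _ _ _) hw.
- have [q [hq <- hO]] := h m.+1 s2.
  have [hv ho] := same_end_twice false (fun=> den P Fr s1) q hWp.
  have [hw hst] := (beside_twice false (fun=> den P Fr s1) m.+1 t (beside true true (PC 1) (beside false true (PAct (Pv s) true (fun=> den P Fr s1)) q)) hQ hWp hIn).2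
    (ex_intro2 _ _ q hq erefl).
  exists (beside true true (PC 1) (beside false true (PAct (Pv s) true (fun=> den P Fr s1)) q)); split=> //; last by move=> u e hu; rewrite ho ?hO.
  by split=> //; apply: w_tau (choice_r _ _ _) hw.
Qed.

Lemma yields_bigoplus l P t v O : List.In P l -> yields P t v O -> yields (bigoplus l) t v O.
Proof.
elim: l => // Q [|Q' l] IH hP h.
  by case: hP => [hQ|[]]; rewrite hQ.
case: hP => [hQ|hP]; first by apply: (yields_oplus (R := P)) h; left.
by apply: (yields_oplus (R := bigoplus (Q' :: l))); [right|apply: IH].
Qed.

(** The value 0 comes from the empty sum, which is the constant 0. *)
Lemma ends_bigoplus l m s t q : ends true m (den (bigoplus l) Fr s) t q ->
  pval q = 0 \/ exists P m' s' q', [/\ List.In P l, ends true m' (den P Fr s') t q' & same_end q q'].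
Proof.
elim: l m s q => [|P [|Q l] IH] m s q.
- move=> [hw _]; left; inversion hw; subst => //; first by case: (tau_PC H).
  by case: (vis_PC H0).
- by move=> h; right; exists P, m, s, q; split=> //; left.
move=> /ends_oplus [R [s' [q' [[->|->] hq' [hv ho]]]]].
  by right; exists P, m.+1, s', q'; split=> //; left.
case: (IH _ _ _ hq') => [h0|[P' [m1 [s1 [q1 [hP hq1 [hv1 ho1]]]]]]]; first by left; rewrite hv.
right; exists P', m1, s1, q1; split=> //; first by right.
by split=> [|u e hu]; [rewrite hv|rewrite ho // ho1].
Qed.

(** The inverse of reading a source as a channel. The default [inl 0] is never met on public
    channels seen before [n]. *)
Definition event_of n (c : chan) : name + 'I_n :=
  match c with
  | Fr u => inl u
  | Ev j => if insub j is Some o then inr o else inl 0%N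
  | _ => inl 0%N
  end.

Lemma event_of_inl n c v : pub c -> seen n c -> event_of n c = inl v -> c = Fr v.
Proof. by case: c => // [u _ _ [->] //|j _ hj]; rewrite /event_of insubT. Qed.

Lemma event_of_inr n c j : pub c -> seen n c -> event_of n c = inr j -> c = Ev j.
Proof. by case: c => // i _ hi; rewrite /event_of insubT => -[<-]. Qed.

Lemma event_ofK n c : pub c -> seen n c ->
  match event_of n c with inl u => Fr u | inr j => Ev j end = c.
Proof. by case: c => // i _ hi; rewrite /event_of insubT. Qed.

Lemma trace_of_ends m p t q : fits 0 p -> ends true m p t q ->
  exists T : trace, [/\ is_trace T, (forall a b, tle T a b = (a <= b)%N), trace_word T = t &
    forall u e, pub u -> (offers q u e <-> trace_offers T u e)].
Proof.
move=> hp [hw _]; have [hq hseen] := wrun_fits hw hp.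
have hs (i : 'I_(size t)) : seen i (tnth (in_tuple t) i).1 /\ pub (tnth (in_tuple t) i).1.
  by rewrite (tnth_nth (Fr 0%N, true)) /=; apply: hseen.
have hsn i : seen (size t) (tnth (in_tuple t) i).1.
  by apply: seen_leq (ltnW (ltn_ord i)) (hs i).1.
have [N hN] : finite (fun a => exists2 c, vis q c.1.1 c.1.2 c.2 &
    pub c.1.1 /\ a = (c.1.2, event_of (size t) c.1.1)).
  by apply: finite_bind (finite_vis q) _ => c _; apply: finite_sing.
pose T := @Trace (size t) (fun i => (tnth (in_tuple t) i).2)
  (fun i => event_of (size t) (tnth (in_tuple t) i).1) (fun a b => (a <= b)%N) (undup N).
have hTN e s : (e, s) \in tN T <->
    exists u, [/\ pub u, offers q u e & s = event_of (size t) u].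
  rewrite /= mem_undup; split.
    move/In_mem/hN => [[[u e'] g] /= hg [hu [-> ->]]].
    by exists u; split=> //; exists g.
  move=> [u [hu [g hg] ->]]; apply/In_mem/hN.
  by exists (u, e, g).
have hoff u e : offers q u e -> seen (size t) u by move=> h; apply: fits_offers hq h.
exists T; split=> //.
- split; first by move=> a; apply: leqnn.
  split; first by move=> a b /= h1 h2; apply/val_inj/eqP; rewrite eqn_leq h1.
  split; first by move=> a b c; apply: leq_trans.
  split; last exact: undup_uniq.
  (* The source of event [b] is an event below [b], because the subject of letter [b] has been seen
     at that point of the word. *)
  move=> a b /= hab; rewrite /tlt /=.
  have := (hs b).1; rewrite (event_of_inr (hs b).2 (hsn b) hab) /= => hlt.
  by rewrite ltnW // -val_eqE /= neq_ltn hlt.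
- rewrite /trace_word -[RHS](map_tnth_enum (in_tuple t)); apply: eq_map => b.
  rewrite /src_chan /= (surjective_pairing (tnth _ b)) /=; congr pair.
  exact: event_ofK (hs b).2 (hsn b).
- move=> u e hu; split.
    move=> ho; have hsu := hoff _ _ ho.
    have hin : (e, event_of (size t) u) \in tN T by apply/hTN; exists u.
    case he : (event_of (size t) u) hin => [v|j] hin; [left|right].
      by exists v => //; apply: event_of_inl hu hsu he.
    by exists j => //; apply: event_of_inr hu hsu he.
  case=> [[v /hTN [u' [hu' ho he]] ->]|[j /hTN [u' [hu' ho he]] ->]].
    by rewrite -(event_of_inl hu' (hoff _ _ ho) (esym he)).
  by rewrite -(event_of_inr hu' (hoff _ _ ho) (esym he)).
Qed.

Definition summand_of (x : seq (chan * pol) * proc K) (kT : K * trace) : Prop :=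
  [/\ is_trace kT.2, (forall a b, tle kT.2 a b = (a <= b)%N), trace_word kT.2 = x.1,
      kT.1 = pval x.2 & forall u e, pub u -> (offers x.2 u e <-> trace_offers kT.2 u e)].

Lemma trace_src (T : trace) : is_trace T -> (forall a b, tle T a b = (a <= b)%N) ->
  forall a b, tsrc T b = inr a -> (a < b)%N.
Proof. by move=> [_ [_ [_ [h _]]]] hle a b /h; rewrite tltE. Qed.

Lemma finite_summands P : exists l : seq (K * trace),
  (forall kT, List.In kT l -> exists2 x, ends true 0 (den P Fr (side_path true)) x.1 x.2 & summand_of x kT) /\
  (forall t q, ends true 0 (den P Fr (side_path true)) t q ->
     exists2 kT, List.In kT l & summand_of (t, q) kT).
Proof.
set p := den P Fr (side_path true).
have [L hL] : finite (fun a => exists2 x, wrun true 0 0 p x.1 x.2 & stuckp x.2 /\ a = x).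
  apply: finite_bind (finite_wrun _ _ _ (proc_size_den P Fr (side_path true))) _ => x _.
  exact: finite_sing.
have {}hL (x : seq (chan * pol) * proc K) : List.In x L <-> ends true 0 p x.1 x.2.
  by rewrite -hL; split=> [[a h1 [h2 ->]]|[h1 h2]]; [split|exists x].
suff [l [h1 h2]] : exists l : seq (K * trace),
    (forall kT, List.In kT l -> exists2 x, ends true 0 p x.1 x.2 & summand_of x kT) /\
    (forall x : seq (chan * pol) * proc K, List.In x L -> exists2 kT, List.In kT l & summand_of x kT).
  by exists l; split=> // t q h; apply: h2; apply/hL.
have {}hL (x : seq (chan * pol) * proc K) : List.In x L -> ends true 0 p x.1 x.2 by move/hL.
elim: L hL => [|x L IH] hL; first by exists [::].
have [|l [h1 h2]] := IH; first by move=> y hy; apply: hL; right.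
have hx := hL x (or_introl erefl).
have [T [hT hle hw ho]] := trace_of_ends (@fits_den K P (side_path true)) hx.
exists ((pval x.2, T) :: l); split.
- by move=> kT [<-|/h1 //]; exists x.
- by move=> y [<-|/h2 [kT hk hs]]; [exists (pval x.2, T) => //; left|exists kT => //; right].
Qed.
End Sums.

Theorem theorem6p1 (K : comPzSemiRingType) (Kidem : forall x : K, x + x = x)
    (P : term K) :
  exists l : seq (K * trace),
    (forall kT, List.In kT l -> is_trace kT.2 /\ total_trace kT.2) /\
    obs_equiv P (bigoplus [seq scale kT.1 (impl K kT.2) | kT <- l]).
Proof.
have [l [hl1 hl2]] := finite_summands P.
exists l; split.
  move=> kT /hl1 [x _ [hT hle _ _ _]]; split=> // a b.
  by rewrite !hle leq_total.
apply: obs_equiv_reaches => // R v.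
(* The summand of the word [t] imitates the run. Its inactions are the public offers of [q], so it
   stays stuck against the same [r], with the same value. *)
- move=> /reaches_par_ends [t [q [r [hq hr hc ->]]]].
  have [kT hin [hT hle hw hk ho]] := hl2 _ _ hq.
  have hy : yields (bigoplus [seq scale kT.1 (impl K kT.2) | kT <- l]) t (pval q) (trace_offers kT.2).
    apply: yields_bigoplus (List.in_map _ _ _ hin) _.
    move: hw hk => /= hw hk; rewrite -[pval q]mulr1 -hk -hw; apply: yields_scale => m s.
    exact: (impl_complete K hle (trace_src hT hle) true m s).
  have [q' [hq' <- ho']] := hy 0%N (side_path true).
  apply: ends_reaches_par hq' hr _ => u e hu /(ho' _ _ hu) /(ho _ _ hu).
  exact: hc.
(* A run of the sum that does not end in state 0 is a complete run of one summand; the word and end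
   of [P] that gave this summand meet the same run of [R]. *)
- move=> /reaches_par_ends [t [q [r [hq hr hc ->]]]].
  case: (ends_bigoplus hq) => [->|]; first by left; rewrite mul0r.
  move=> [S [m [s [q1 [/List.in_map_iff [kT [<- hin]] hq1 [hv1 ho1]]]]]].
  have [s' [q2 [hq2 hv2 ho2]]] := ends_scale hq1.
  have [[t0 q0] hq0 [hT hle hw hk ho]] := hl1 _ hin.
  case: (impl_safe hle (trace_src hT hle) hq2) => [h0|[ht hv3 ho3]].
    by left; rewrite hv1 hv2 h0 mulr0 mul0r.
  right; rewrite hv1 hv2 hv3 mulr1 hk.
  rewrite ht hw in hr; apply: ends_reaches_par hq0 hr _ => u e hu /(ho _ _ hu).
  by move=> /(ho3 _ _ hu) /(ho2 _ _ hu) /(ho1 _ _ hu); apply: hc.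
Qed.
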